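(* Let $N\in\mathbb N$, let $\mathbf s=\{s_i\}_{i=0}^{2n_N-2}$ be a regular sequence of real numbers with set of normal indices $\mathcal N(\mathbf s)=\{n_j\}_{j=1}^N$ ($n_1<\dots<n_N$), let $\kappa,k\in\mathbb Z_+$, and let $m_j(z)$ $(1\le j\le N)$ and $l_j$ $(1\le j\le N-1)$ be the polynomials and nonzero real numbers defined by the Schur recursion described in the context. Then: (1) The (nondegenerate odd) moment problem $MP_\kappa^k(\mathbf s,2n_N-2)$ is solvable (i.e. $\mathcal M_\kappa^k(\mathbf s,2n_N-2)\neq\emptyset$) if and only if $$\kappa_N:=\nu_-(S_{n_N})\le\kappa\quad\text{and}\quad k_N:=\nu_-(S^+_{n_N-1})\le k .$$ (2) $f\in\mathcal M_\kappa^k(\mathbf s,2n_N-2)$ if and only if $f$ admits the representation $f=T_{W_{2N-1}}[\tau]$, where $$W_{2N-1}(z):=M_1(z)L_1\cdots M_{N-1}(z)L_{N-1}M_N(z)$$ and $\tau$ satisfies $$\tau\in\mathbf N_{\kappa-\kappa_N}^{k-k_N}\quad\text{and}\quad \frac1{\tau(z)}=o(z),\quad z\widehat\to\infty .$$ (3) The representation $f=T_{W_{2N-1}}[\tau]$ can be rewritten as the continued fraction expansion $$f(z)=\cfrac{1}{-zm_1(z)+\cfrac{1}{l_1+\cfrac{1}{-zm_2(z)+\cdots+\cfrac{1}{-zm_N(z)+\cfrac{1}{\tau(z)}}}}}.$$ (4) The indices $\kappa_N$ and $k_N$ are related to $m_j$ and $l_j$ by $$\kappa_N=\sum_{j=1}^N\kappa_-(zm_j),\qquad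 k_N=\sum_{j=1}^N\kappa_-(m_j)+\sum_{j=1}^{N-1}\kappa_-(zl_j).$$
   Context: Classes. A function $f$, meromorphic on $\mathbb C\setminus\mathbb R$ with $f(\bar z)=\overline{f(z)}$ and domain of holomorphy $\mathfrak h_f$, belongs to $\mathbf N_\kappa$ ($\kappa\in\mathbb Z_+=\mathbb N\cup\{0\}$) if for all finite sets $z_1,\dots,z_n\in\mathbb C_+\cap\mathfrak h_f$ the form $\sum_{i,j}\frac{f(z_i)-\overline{f(z_j)}}{z_i-\bar z_j}\xi_i\bar\xi_j$ has at most $\kappa$ negative squares, and for some choice exactly $\kappa$. $\mathbf N_\kappa^k$ is the set of $f\in\mathbf N_\kappa$ with $zf(z)\in\mathbf N_k$ (classes with a negative index are empty). Convention: $\tau\equiv\infty$ is admitted as an element of $\mathbf N_0^0$, with $1/\tau=0$. For a real polynomial $P$, $\kappa_-(P)$ is the number $\kappa$ with $P\in\mathbf N_\kappa$. $z\widehat\to\infty$ means $z\to\infty$ nontangentially, i.e. inside sectors $\varepsilon<\arg z<\pi-\varepsilon$, $\varepsilon>0$. Problem. For a real sequence $\mathbf s=\{s_j\}_{j=0}^\ell$, $\mathcal M_\kappa^k(\mathbf s,\ell)$, the solution set of $MP_\kappa^k(\mathbf s,\ell)$, is the set of $f\in\mathbf N_\kappa^k$ with $f(z)=-\frac{s_0}{z}-\cdots-\frac{s_\ell}{z^{\ell+1}}+o\left(\frac1{z^{\ell+1}}\right)$ for $z=iy$, $y\uparrow\infty$. Matrices. $S_n=(s_{i+j})_{i,j=0}^{n-1}$,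 $S_n^+=(s_{i+j+1})_{i,j=0}^{n-1}$, $D_n=\det S_n$, $D_n^+=\det S_n^+$, $D_0^+=1$; $\nu_-(S)$ is the number of negative eigenvalues of $S$ (zero for an empty matrix). $n\ge1$ is a normal index of $\mathbf s$ if $D_n\ne0$. The sequence $\mathbf s=\{s_i\}_{i=0}^{2n_N-2}$ is regular if $D^+_{n_j-1}\ne0$ for all $j=1,\dots,N$ (equivalently $D_{n_j}^+\neq 0$ for $j=1,\dots,N-1$). The odd problem $MP_\kappa^k(\mathbf s,2n_N-2)$ is nondegenerate if $D_{n_N}\ne0$ and $D^+_{n_N-1}\ne0$. Toeplitz notation. $T(c_0,\dots,c_n)$ is the upper triangular $(n+1)\times(n+1)$ matrix with entries $c_{j-i}$ for $i\le j$ and $0$ for $i>j$. Schur recursion (here $\ell=2n_N-2$). Put $n_0=0$, $\mathbf s^{(0)}=\mathbf s$. Given $\mathbf s^{(j-1)}=\{s_i^{(j-1)}\}_{i=0}^{\ell-2n_{j-1}}$, let $\nu=n_j-n_{j-1}$ (then $s^{(j-1)}_0=\dots=s^{(j-1)}_{\nu-2}=0$, $s^{(j-1)}_{\nu-1}\ne0$), $D_\nu^{(j-1)}=\det(s^{(j-1)}_{i+p})_{i,p=0}^{\nu-1}$, $(D_\nu^{(j-1)})^+=\det(s^{(j-1)}_{i+p+1})_{i,p=0}^{\nu-1}$. Then $$m_j(z)=\frac{(-1)^{\nu+1}}{D_\nu^{(j-1)}}\Delta_j(z)=\sum_{i=0}^{\nu-1}m_i^{(j)}z^i\quad(1\le j\le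 N),$$ where $\Delta_j(z)$ is the determinant of the $\nu\times\nu$ matrix whose first $\nu-1$ rows are $(s^{(j-1)}_{i+1},s^{(j-1)}_{i+2},\dots,s^{(j-1)}_{i+\nu})$, $i=0,\dots,\nu-2$, and whose last row is $(1,z,\dots,z^{\nu-1})$; and, for $1\le j\le N-1$, $$l_j=(-1)^{\nu+1}s^{(j-1)}_{\nu-1}\frac{D_\nu^{(j-1)}}{(D_\nu^{(j-1)})^+}.$$ For $1\le j\le N-1$ the sequences $\{\mathfrak s_i^{(j)}\}_{i=-1}^{\ell-2n_j}$ and $\mathbf s^{(j)}=\{s_i^{(j)}\}_{i=0}^{\ell-2n_j}$ are determined by $$T(m^{(j)}_{\nu-1},\dots,m^{(j)}_0,-\mathfrak s^{(j)}_{-1},\dots,-\mathfrak s^{(j)}_{\ell-2n_j})\,T(s^{(j-1)}_{\nu-1},\dots,s^{(j-1)}_{\ell-2n_{j-1}})=I,$$ $$T(l_j,-s_0^{(j)},\dots,-s^{(j)}_{\ell-2n_j})\,T(\mathfrak s^{(j)}_{-1},\dots,\mathfrak s^{(j)}_{\ell-2n_j})=I .$$ Transforms. $M_j(z)=\begin{pmatrix}1&0\\-zm_j(z)&1\end{pmatrix}$, $L_j=\begin{pmatrix}1&l_j\\0&1\end{pmatrix}$, and for $W=(w_{ij})_{i,j=1}^2$, $T_W[\tau]=\dfrac{w_{11}\tau+w_{12}}{w_{21}\tau+w_{22}}$ (equal to $w_{11}/w_{21}$ if $\tau\equiv\infty$). *)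

(* Defs.v *)
From HB Require Import structures.
From mathcomp Require Import all_boot all_order all_algebra.
From mathcomp Require Import polyrcf complex.
From mathcomp Require Import all_classical all_reals all_analysis.

Set Implicit Arguments.
Unset Strict Implicit.
Unset Printing Implicit Defensive.

Import Order.TTheory GRing.Theory Num.Theory.
Import numFieldNormedType.Exports.

Local Open Scope classical_set_scope.
Local Open Scope ring_scope.
Local Open Scope complex_scope.

(** * The Riemann sphere

    Meromorphic functions on C \ R are functions into the sphere
    [option R[i]], where [None] is the point at infinity and is the value at
    a pole. The constant function [None] is the function "identically
    infinity". Only values off the real line are ever used. *)

Section Sphere.
Variable R : realType.
Local Notation C := (R[i]).
Local Notation sphere := (option C).

(* a / b for (a, b) <> (0, 0) *)
Definition sph_div (a b : C) : sphere := if b == 0 then None else Some (a / b).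

Definition sph_inv (t : sphere) : sphere :=
  if t is Some a then sph_div 1 a else Some 0.

Definition sph_shift (a : C) (t : sphere) : sphere := omap (+%R a) t.

Definition mobius (W : 'M[C]_2) (t : sphere) : sphere :=
  if t is Some a then
    sph_div (W ord0 ord0 * a + W ord0 ord_max)
            (W ord_max ord0 * a + W ord_max ord_max)
  else sph_div (W ord0 ord0) (W ord_max ord0).

Definition nonreal (z : C) : Prop := complex.Im z != 0.

Definition upper (z : C) : Prop := 0 < complex.Im z.

(* [R[i]^o] carries the topology of [R[i]]; [derivable _ _ 1] over it is
   complex differentiability. *)
Definition holomorphic_at (g : C -> C) (z : C) : Prop :=
  \forall w \near (z : C^o), derivable (g : C^o -> C^o) w 1.

Definition regular_at (f : C -> sphere) (z : C) : Prop :=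
  exists2 g : C -> C, holomorphic_at g z &
    \forall w \near (z : C^o), f w = Some (g w).

Definition pole_at (f : C -> sphere) (z : C) : Prop :=
  f z = None /\
  exists (p : nat) (g : C -> C),
    [/\ (0 < p)%N, holomorphic_at g z, g z != 0 &
        \forall w \near (z : C^o)^', f w = Some (g w / (w - z) ^+ p)].

Definition meromorphic_nonreal (f : C -> sphere) : Prop :=
  forall z, nonreal z -> regular_at f z \/ pole_at f z.

Definition real_symmetric (f : C -> sphere) : Prop :=
  forall z, nonreal z -> f (z^*) = omap (@conjc R) (f z).

(** * Generalized Nevanlinna classes *)

(* The hermitian form with matrix [H] is reduced to a sum of squares
   [\sum_p d_p |eta_p|^2] by an invertible linear substitution
   [eta = xi P], with exactly [q] negative [d_p]. *)
Definition has_negative_squares (n : nat) (H : 'M[C]_n) (q : nat) : Prop :=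
  exists (P : 'M[C]_n) (d : 'I_n -> R),
    [/\ P \in unitmx,
        forall xi : 'rV[C]_n,
          \sum_i \sum_j H i j * xi ord0 i * (xi ord0 j)^* =
          \sum_p (d p)%:C * `|(xi *m P) ord0 p| ^+ 2 &
        #|[set p : 'I_n | d p < 0]%SET| = q].

Definition sph_fin (t : sphere) : C := odflt 0 t.

Definition nevanlinna_form (f : C -> sphere) (n : nat) (z : 'I_n -> C) :
    'M[C]_n :=
  \matrix_(i, j) ((sph_fin (f (z i)) - (sph_fin (f (z j)))^*)
                  / (z i - (z j)^*)).

Definition nevanlinna (kappa : nat) (f : C -> sphere) : Prop :=
  [/\ meromorphic_nonreal f,
      real_symmetric f,
      forall (n : nat) (z : 'I_n -> C),
        (forall i, upper (z i) /\ regular_at f (z i)) ->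
        exists2 q : nat, (q <= kappa)%N &
          has_negative_squares (nevanlinna_form f z) q &
      exists (n : nat) (z : 'I_n -> C),
        (forall i, upper (z i) /\ regular_at f (z i)) /\
        has_negative_squares (nevanlinna_form f z) kappa].

Definition zmul (f : C -> sphere) : C -> sphere :=
  fun z => omap ( *%R z) (f z).

(* The class N_kappa^k; empty if an index is negative, and with the function
   identically infinity adjoined to N_0^0. *)
Definition nevanlinna2 (kappa k : int) (f : C -> sphere) : Prop :=
  match kappa, k with
  | Posz a, Posz b =>
      (nevanlinna a f /\ nevanlinna b (zmul f)) \/
      [/\ a = 0%N, b = 0%N & forall z, nonreal z -> f z = None]
  | _, _ => False
  end.

Definition peval (p : {poly R}) (z : C) : C :=
  (map_poly (real_complex R) p).[z].

(* The default value 0 is never used: every real polynomial belongs to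
   N_kappa for exactly one kappa. *)
Definition kappa_minus (p : {poly R}) : nat :=
  xget 0%N [set q | nevanlinna q (fun z => Some (peval p z))].

(** * The moment problem *)

Definition moment_solution (kappa k : nat) (s : nat -> R) (ell : nat)
    (f : C -> sphere) : Prop :=
  [/\ nevanlinna2 kappa%:Z k%:Z f,
      \forall y \near +oo, f (0 +i* y) != None &
      (fun y : R => sph_fin (f (0 +i* y))
         + \sum_(i < ell.+1) (s i)%:C / (0 +i* y) ^+ i.+1 : C^o)
        =o_ (FilterType (pinfty_nbhs R) _) (fun y : R => ((0 +i* y) ^+ ell.+1)^-1 : C^o)].

(* 1 / tau (z) = o(z) as z = r e^{i theta} tends to infinity, uniformly in each
   sector e < theta < pi - e; in particular 1 / tau is eventually finite
   there. *)
Definition inv_littleo_nontangential (tau : C -> sphere) : Prop :=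
  forall e delta : R, 0 < e -> 0 < delta ->
    \forall r \near +oo, forall theta : R, e < theta < pi - e ->
      let z := r%:C * (cos theta +i* sin theta) in
      exists2 v : C, sph_inv (tau z) = Some v & `|v| <= delta%:C * `|z|.

End Sphere.

(** * Hankel matrices *)

Section Hankel.
Variable R : realType.
Implicit Types (s : nat -> R) (n : nat -> nat).

Definition hankel s (p : nat) : 'M[R]_p := \matrix_(i, j) s (i + j)%N.

Definition hankel_plus s (p : nat) : 'M[R]_p := \matrix_(i, j) s (i + j).+1.

(* Number of negative eigenvalues, counted with multiplicity. *)
Definition nu_minus (p : nat) (S : 'M[R]_p) : nat :=
  \sum_(x <- rootsR (char_poly S) | (x < 0)%R) mup x (char_poly S).

(* n 1 < ... < n N are the normal indices of {s_0, ..., s_(2 (n N) - 2)},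
   and n 0 = 0. *)
Definition normal_indices s (N : nat) n : Prop :=
  [/\ n 0%N = 0%N,
      forall i j, (i < j)%N -> (j <= N)%N -> (n i < n j)%N &
      forall p, (1 <= p <= n N)%N ->
        \det (hankel s p) != 0 <-> exists2 j, (1 <= j <= N)%N & p = n j].

Definition regular_seq s (N : nat) n : Prop :=
  forall j, (1 <= j <= N)%N -> \det (hankel_plus s (n j).-1) != 0.

(** * Schur recursion *)

(* T(c_0, ..., c_q) *)
Definition toeplitz (q : nat) (c : nat -> R) : 'M[R]_q.+1 :=
  \matrix_(i, j) if (i <= j)%N then c (j - i)%N else 0.

(* The next two definitions take a sequence s_0, ..., s_L whose smallest
   normal index is nu. *)
Definition step_m (nu : nat) s : {poly R} :=
  ((-1) ^+ nu.+1 / \det (hankel s nu)) *: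
    \det (\matrix_(i < nu, p < nu)
            if (i < nu.-1)%N then (s (i + p).+1)%:P else 'X^p).

Definition step_l (nu : nat) s : R :=
  (-1) ^+ nu.+1 * s nu.-1 * (\det (hankel s nu) / \det (hankel_plus s nu)).

(* The matrix T(m_(nu-1), ..., m_0, - frs_(-1), ..., - frs_(L - 2 nu)) is the
   inverse of T(s_(nu-1), ..., s_L), so frs is read off its first row.
   [step_frak nu L s i] is frs_(i-1): the sequence frs starts at index -1. *)
Definition step_frak (nu L : nat) s : nat -> R := fun i =>
  - invmx (toeplitz (L - nu.-1) (fun a => s (nu.-1 + a)%N)) ord0
      (inord (nu + i)).

(* Likewise T(l, - s'_0, ..., - s'_(L - 2 nu)) is the inverse of
   T(frs_(-1), ..., frs_(L - 2 nu)). *)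
Definition step_seq (nu L : nat) s : nat -> R := fun i =>
  - invmx (toeplitz (L - nu.*2).+1 (step_frak nu L s)) ord0 (inord i.+1).

Fixpoint schur_seq s n (ell : nat) (j : nat) : nat -> R :=
  if j is j'.+1 then
    step_seq (n j - n j')%N (ell - (n j').*2)%N (schur_seq s n ell j')
  else s.

Definition schur_m s n (ell j : nat) : {poly R} :=
  step_m (n j - n j.-1)%N (schur_seq s n ell j.-1).

Definition schur_l s n (ell j : nat) : R :=
  step_l (n j - n j.-1)%N (schur_seq s n ell j.-1).

End Hankel.

(** * Transforms and continued fractions *)

Section Transforms.
Variable R : realType.
Local Notation C := (R[i]).

Definition mx2 (a b c d : C) : 'M[C]_2 :=
  \matrix_(i, j) if i == ord0 then if j == ord0 then a else b
                 else if j == ord0 then c else d.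

Definition M_mx (m : nat -> {poly R}) (j : nat) (z : C) : 'M[C]_2 :=
  mx2 1 0 (- (z * peval (m j) z)) 1.

Definition L_mx (l : nat -> R) (j : nat) : 'M[C]_2 := mx2 1 (l j)%:C 0 1.

(* M_1(z) L_1 ... M_(N-1)(z) L_(N-1) M_N(z), which is W_(2N-1)(z) *)
Definition W_mx (m : nat -> {poly R}) (l : nat -> R) (N : nat) (z : C) :
    'M[C]_2 :=
  (\prod_(1 <= j < N) (M_mx m j z * L_mx l j)) * M_mx m N z.

(* [cfrac m l z t j d] is the part of the continued fraction that starts at
   - z m_j(z) and ends with - z m_(j+d)(z) + 1 / t. *)
Fixpoint cfrac (m : nat -> {poly R}) (l : nat -> R) (z : C) (t : option C)
    (j d : nat) : option C :=
  sph_inv (sph_shift (- (z * peval (m j) z))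
    (sph_inv (if d is d'.+1
              then sph_shift (l j)%:C (cfrac m l z t j.+1 d')
              else t))).

End Transforms.

(* Main.v *)
Require Import Defs.
From mathcomp Require Import all_boot all_order all_algebra.
From mathcomp Require Import polyrcf complex.
From mathcomp Require Import all_classical all_reals all_analysis.
From mathcomp Require Import perm.
From mathcomp Require Import ring lra zify.
Import Order.TTheory GRing.Theory Num.Theory.
Import numFieldNormedType.Exports.
Local Open Scope classical_set_scope.
Local Open Scope ring_scope.
Local Open Scope complex_scope.

(** Write [ninv f] for [- 1 / f]. The factors of [W_(2N-1)] are inversions
    composed with the addition of a real polynomial: if [f = T_(M_j) [tau]],
    then [- 1 / f = z m_j + (- 1 / tau)] and [- 1 / (z f) = m_j + (- 1 / (z tau))],
    while [T_(L_j)] adds [l_j] to [tau] and [z l_j] to [z tau]. The theorem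
    follows by applying [N] such steps, and each of its ingredients can be
    followed through a single step.

    Indices. The number of negative squares is the same for [f] and [- 1 / f],
    because the two kernels differ by a diagonal congruence
    ([nevanlinna_ninv]). If [g (iy) = o(y)], adding a real polynomial [P] to [g]
    adds [kappa_-(P)], the number of negative eigenvalues of the Hankel matrix
    of the coefficients of [P]: at most that many squares are gained by
    subadditivity, and exactly that many because far out on the imaginary axis there
    are points which resolve [P] but do not see [g] ([neg_ge_padd]). Hence the
    two indices under [T_(M_j)] and [T_(L_j)] change by the numbers in part (4)
    ([nevanlinna2_T_M], [nevanlinna2_T_L]).

    Asymptotics. In the variable [x = 1 / z] the moment condition prescribes the
    first terms of a power series, and the triangular Toeplitz inverses of the
    recursion are reciprocals of truncated power series. The coefficients of
    [z m_j] are the leading terms of the expansion of [- 1 / f] and [l_j] is the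
    constant term of the next reciprocal; so [f] has the moments [s^(j-1)] if and
    only if the function two transformations further has the moments [s^(j)]
    ([moment_expansion_inner]). At the last level [z m_N] exhausts the data, and
    the condition left over is [1 / tau = o(z)] on the imaginary axis
    ([moment_expansion_last]).

    Hankel matrices. For a power series [c] with reciprocal [d], multiplication by
    [c] is a congruence between the Hankel matrix of [x^nu c] and a block diagonal
    matrix read off [d] ([hankel_congr]). This identifies the inertia lost in a
    step with [kappa_-(z m_j)], and with [kappa_-(m_j) + kappa_-(z l_j)] for the
    shifted matrices; it also shows that normal indices and regularity are
    inherited, so that no division by zero occurs ([level_invariantS]). Summing
    gives part (4) ([index_sums]), and the whole chain gives the parametrization
    ([parametrization]).

    Nontangential limits. The chain produces [1 / tau = o(z)] only along the
    imaginary axis. For a function with finitely many negative squares this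
    already implies the same in every sector: once the negative squares are used
    up by finitely many fixed points, the kernel is nonnegative up to a
    controlled error, and the Cauchy-Schwarz inequality compares the value at [z]
    with the value at [i |z|] ([small_sector]).

    Solvability then amounts to the existence of a parameter with given indices,
    built from the constant infinity by elementary steps
    ([parameter_exists]). Part (3) is the pointwise composition of the Moebius
    maps ([cfracE]).

    Meromorphy has to be preserved by all these maps. Functions that are locally
    quotients of holomorphic functions are visibly stable under Moebius maps, and
    such a quotient is regular or has a pole wherever it is not locally infinite
    ([quot_at_cases]). That rests on the factorization
    [g = (w - z)^p h] of a holomorphic function ([holo_factor]), which is derived
    from an integral theorem on rectangles. *)

Set Implicit Arguments.
Unset Strict Implicit.
Unset Printing Implicit Defensive.

(** * Moduli and complex differentiability *)

Section Modulus.
Variable R : realType.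
Local Notation C := (R[i]).
Implicit Types (z w : C) (x y : R).

(** The modulus as a real number, so that estimates are inequalities in the
    ordered field [R] and not in the partially ordered complex field. *)
Definition cm z : R := Normc.normc z.

Lemma cmE z : `|z| = (cm z)%:C.
Proof. by case: z. Qed.

Lemma cm_ge0 z : 0 <= cm z.
Proof. by case: z => a b; rewrite /cm /= sqrtr_ge0. Qed.

Lemma cm0 : cm 0 = 0. Proof. exact: Normc.normc0. Qed.
Lemma cm1 : cm 1 = 1. Proof. exact: Normc.normc1. Qed.
Lemma cmM z w : cm (z * w) = cm z * cm w. Proof. exact: Normc.normcM. Qed.
Lemma cmV z : cm z^-1 = (cm z)^-1. Proof. exact: Normc.normcV. Qed.
Lemma cmN z : cm (- z) = cm z.
Proof. by apply: complexI; rewrite -!cmE normrN. Qed.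
Lemma cmX z n : cm (z ^+ n) = cm z ^+ n.
Proof. by elim: n => [|n IH]; rewrite ?expr0 ?cm1 // !exprS cmM IH. Qed.
Lemma cmD z w : cm (z + w) <= cm z + cm w.
Proof. by rewrite -lecR rmorphD/= -!cmE ler_normD. Qed.
Lemma cmB z w : cm (z - w) = cm (w - z).
Proof. by rewrite -cmN opprB. Qed.
Lemma cmD3 z w v : cm (z - v) <= cm (z - w) + cm (w - v).
Proof. by rewrite -[z - v](subrKA w); exact: cmD. Qed.
Lemma cm_eq0 z : (cm z == 0) = (z == 0).
Proof.
by apply/eqP/eqP => [/Normc.eq0_normc //|->]; rewrite cm0.
Qed.
Lemma cm_gt0 z : (0 < cm z) = (z != 0).
Proof. by rewrite lt_def cm_eq0 cm_ge0 andbT. Qed.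
Lemma cmR x : cm x%:C = `|x|.
Proof. by rewrite /cm /= expr0n addr0 sqrtr_sqr. Qed.
Lemma cmJ z : cm z^* = cm z.
Proof. by apply: complexI; rewrite -!cmE normcJ. Qed.
Lemma cm_i : cm 'i%C = 1.
Proof. by rewrite /cm /= expr0n add0r expr1n sqrtr1. Qed.
Lemma cm_Re z : `|complex.Re z| <= cm z.
Proof. by rewrite -lecR -cmE normc_ge_Re. Qed.
Lemma cm_Im z : `|complex.Im z| <= cm z.
Proof. by have := cm_Re (z * 'i%C); rewrite ReiNIm normrN cmM cm_i mulr1. Qed.
Lemma cm_ReIm z : cm z <= `|complex.Re z| + `|complex.Im z|.
Proof.
rewrite {1}[z]complexE; apply: le_trans (cmD _ _) _.
by rewrite cmM cm_i mul1r !cmR.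
Qed.
Lemma cm_sum (I : Type) (r : seq I) (P : pred I) (F : I -> C) :
  cm (\sum_(i <- r | P i) F i) <= \sum_(i <- r | P i) cm (F i).
Proof.
elim/big_ind2: _ => //; first by rewrite cm0.
by move=> x1 x2 y1 y2 h1 h2; apply: le_trans (cmD _ _) _; apply: lerD.
Qed.
Lemma cmBr z w : cm z - cm w <= cm (z - w).
Proof. by rewrite lerBlDr; apply: le_trans (cmD _ _); rewrite subrK. Qed.

Lemma nearP z (P : C -> Prop) :
  (\forall w \near (z : C^o), P w) <->
  exists2 d : R, 0 < d & forall w, cm (w - z) < d -> P w.
Proof.
split.
  case/nbhs_ballP => e /= e0 H; exists (complex.Re e).
    by move: e0; rewrite ltcE /= => /andP[].
  move=> w hw; apply: H; rewrite /ball /= -normrN opprB ltcE /=.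
  by move: e0; rewrite ltcE => /andP[] /eqP -> _; rewrite eqxx.
case=> d d0 H; apply/nbhs_ballP; exists d%:C; first by rewrite /= ltcR.
by move=> w; rewrite /ball /= -normrN opprB cmE ltcR => hw; apply: H.
Qed.

Lemma dnearP z (P : C -> Prop) :
  (\forall w \near (z : C^o)^', P w) <->
  exists2 d : R, 0 < d & forall w, cm (w - z) < d -> w != z -> P w.
Proof. exact: (nearP z (fun w => w != z -> P w)). Qed.

Definition cdiff (f : C -> C) z (l : C) := forall e, 0 < e -> exists2 d : R,
  0 < d & forall w, cm (w - z) < d ->
    cm (f w - f z - l * (w - z)) <= e * cm (w - z).

Lemma derivable_cdiff (f : C -> C) z :
  derivable (f : C^o -> C^o) z 1 <-> exists l, cdiff f z l.
Proof.
split.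
  move=> df; have := df; rewrite derivable1_diffP => dff.
  move/cvg_ex: df => [l hl].
  exists l => e e0.
  move/cvgrPdist_le: hl => /(_ e%:C); rewrite ltcR => /(_ e0) /dnearP [d d0 H].
  exists d => // w hw.
  have [->|wz] := eqVneq w z; first by rewrite !subrr mulr0 subr0 cm0 mulr0.
  have := H (w - z); rewrite subr0 subr_eq0 => /(_ hw wz) /=.
  rewrite scaler1 subrK cmE lecR /GRing.scale /= => hq.
  have -> : f w - f z - l * (w - z) = - (l - (w - z)^-1 * (f w - f z)) * (w - z).
    by rewrite mulNr mulrBl mulrAC mulVf ?subr_eq0 // mul1r opprB.
  by rewrite cmM cmN ler_wpM2r ?cm_ge0.
case=> l hl; apply/cvg_ex; exists l; apply/cvgrPdist_le => e e0.
have e1 : 0 < complex.Re e by move: e0; rewrite ltcE /= => /andP[].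
have [d d0 H] := hl _ e1.
apply/dnearP; exists d => // w; rewrite subr0 => hw w0.
have := H (z + w); rewrite addrAC subrr add0r => /(_ hw) => hq.
have -> : e = (complex.Re e)%:C.
  by move: e0; case: (e) => a b; rewrite ltcE /= => /andP[/eqP -> _].
rewrite cmE lecR /= scaler1 /GRing.scale /= -(ler_pM2r (x := cm w)) ?cm_gt0 //.
rewrite -cmM mulrBl mulrAC mulVf // mul1r -cmN opprB [w + z]addrC.
exact: hq.
Qed.

Definition ccont (f : C -> C) z := forall e, 0 < e -> exists2 d : R,
  0 < d & forall w, cm (w - z) < d -> cm (f w - f z) <= e.

Lemma ccont_cvg (f : C -> C) z :
  ccont f z <-> {for z, continuous (f : C^o -> C^o)}.
Proof.
split=> h.
  rewrite /prop_for /continuous_at.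
  apply: (proj2 (@cvgrPdist_le _ C^o _ (nbhs (z : C^o)) _ f (f z))) => e e0.
  have e1 : 0 < complex.Re e by move: e0; rewrite ltcE /= => /andP[].
  have [d d0 H] := h _ e1; apply/nearP; exists d => // w hw.
  have -> : e = (complex.Re e)%:C.
    by move: e0; case: (e) => a b; rewrite ltcE /= => /andP[/eqP -> _].
  by rewrite cmE lecR cmB; apply: H.
move=> e e0; move/cvgrPdist_le: h => /(_ e%:C); rewrite ltcR => /(_ e0) /nearP [d d0 H].
by exists d => // w hw; have := H w hw; rewrite cmE lecR cmB.
Qed.

Lemma cdiff_ccont (f : C -> C) z l : cdiff f z l -> ccont f z.
Proof.
move=> h; apply/ccont_cvg.
have : derivable (f : C^o -> C^o) z 1 by apply/derivable_cdiff; exists l.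
by rewrite derivable1_diffP => /differentiable_continuous.
Qed.

End Modulus.

Arguments cm {R} z : simpl never.

(** * Integrals of complex functions over intervals *)

Section Integral.
Variable R : realType.
Local Notation C := (R[i]).
Implicit Types (h : R -> R) (a b x y : R).

Lemma is_derive_eps (G : R -> R) x l :
  (forall e, 0 < e -> exists2 d : R, 0 < d & forall u, `|u - x| < d ->
    `|G u - G x - l * (u - x)| <= e * `|u - x|) -> is_derive x 1 G l.
Proof.
move=> H.
suff hl : h^-1 *: ((G \o shift x) (h *: 1) - G x) @[h --> 0^'] --> l.
  by split; [apply/cvg_ex; exists l | exact: (cvg_lim _ hl)].
apply/cvgrPdist_le => e e0; have [d d0 Hd] := H _ e0.
apply/nbhs_ballP; exists d => //= w; rewrite /ball /= sub0r normrN => hw w0.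
have := Hd (x + w); rewrite addrAC subrr add0r => /(_ hw) => hq.
rewrite /= -(ler_pM2r (x := `|w|)) ?normr_gt0 // -normrM mulrBl.
by rewrite /GRing.scale /= mulr1 mulrAC mulVf // mul1r -normrN opprB [w + x]addrC.
Qed.

Definition prim_on h a b (G : R -> R) := forall x, a <= x <= b -> is_derive x 1 G (h x).

Lemma prim_exists h a b : continuous h -> exists G, prim_on h a b G.
Proof.
move=> ch; exists (fun x => \int[lebesgue_measure]_(t in `[a - 1, x]) h t)%R.
move=> x /andP[ax xb].
have := @continuous_FTC1 R h (BLeft (a - 1)) x (x + 1).
case.
- by rewrite ltrDl.
- apply: continuous_compact_integrable; first exact: segment_compact.
  exact: continuous_subspaceT.
- by rewrite /= lte_fin; lra.
- exact: ch.
by move=> d1 d2; split; [exact: d1 | rewrite -derive1E; exact: d2].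
Qed.

Lemma MVT_prim h a b G : a <= b -> prim_on h a b G ->
  exists2 c, a <= c <= b & G b - G a = h c * (b - a).
Proof.
move=> ab p.
have [||c ci ->] := @MVT_segment R G h a b ab.
- by move=> x; rewrite in_itv /= => /andP[/ltW xa /ltW xb]; apply: p; rewrite xa.
- apply: continuous_in_subspaceT => x; rewrite inE /= => xi.
  have dx := p x xi.
  by apply: differentiable_continuous; apply/derivable1_diffP; exact: ex_derive.
by exists c => //; move: ci; rewrite in_itv.
Qed.

(** The increment of a primitive; by [rintE] any primitive gives the same
    value. *)
Definition rint h a b : R :=
  let G := xget (fun=> 0) [set G | prim_on h a b G] in G b - G a.

Lemma rintE h a b G : a <= b -> prim_on h a b G -> rint h a b = G b - G a.
Proof.
move=> ab p; rewrite /rint; case: xgetP => [F _ pF|/(_ G)] //.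
have pd : prim_on (fun=> 0) a b (F - G).
  move=> x xi; have := pF x xi; have := p x xi => d1 d2.
  have -> : 0 = h x - h x by rewrite subrr.
  exact: is_deriveB.
have [c _] := MVT_prim ab pd; rewrite mul0r => /eqP.
rewrite !fctE subr_eq0 => /eqP e; lra.
Qed.

Lemma rint_bound h a b M : continuous h -> a <= b ->
  (forall x, a <= x <= b -> `|h x| <= M) -> `|rint h a b| <= M * (b - a).
Proof.
move=> ch ab hM; have [G p] := prim_exists a b ch; rewrite (rintE ab p).
have [c ci ->] := MVT_prim ab p.
by rewrite normrM (ger0_norm (x := b - a)) ?subr_ge0 // ler_wpM2r ?subr_ge0 // hM.
Qed.

Lemma rint_ge h a b m : continuous h -> a <= b ->
  (forall x, a <= x <= b -> m <= h x) -> m * (b - a) <= rint h a b.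
Proof.
move=> ch ab hM; have [G p] := prim_exists a b ch; rewrite (rintE ab p).
have [c ci ->] := MVT_prim ab p.
by rewrite ler_wpM2r ?subr_ge0 // hM.
Qed.

Lemma rint_le h a b m : continuous h -> a <= b ->
  (forall x, a <= x <= b -> h x <= m) -> rint h a b <= m * (b - a).
Proof.
move=> ch ab hM; have [G p] := prim_exists a b ch; rewrite (rintE ab p).
have [c ci ->] := MVT_prim ab p.
by rewrite ler_wpM2r ?subr_ge0 // hM.
Qed.

Implicit Types (g : R -> C).

Definition rcont g := forall t e, 0 < e -> exists2 d : R, 0 < d &
  forall u, `|u - t| < d -> cm (g u - g t) <= e.

Lemma ReB (z w : C) : complex.Re (z - w) = complex.Re z - complex.Re w.
Proof. by case: z w => [? ?] []. Qed.
Lemma ImB (z w : C) : complex.Im (z - w) = complex.Im z - complex.Im w.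
Proof. by case: z w => [? ?] []. Qed.
Lemma ReD (z w : C) : complex.Re (z + w) = complex.Re z + complex.Re w.
Proof. by case: z w => [? ?] []. Qed.
Lemma ImD (z w : C) : complex.Im (z + w) = complex.Im z + complex.Im w.
Proof. by case: z w => [? ?] []. Qed.
Lemma ReM (z w : C) :
  complex.Re (z * w) = complex.Re z * complex.Re w - complex.Im z * complex.Im w.
Proof. by case: z w => [? ?] []. Qed.
Lemma ImM (z w : C) :
  complex.Im (z * w) = complex.Re z * complex.Im w + complex.Im z * complex.Re w.
Proof. by case: z w => [? ?] []. Qed.

Lemma ReMr (z : C) x : complex.Re (z * x%:C) = complex.Re z * x.
Proof. by rewrite ReM /= mulr0 subr0. Qed.
Lemma ImMr (z : C) x : complex.Im (z * x%:C) = complex.Im z * x.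
Proof. by rewrite ImM /= mulr0 add0r. Qed.

Lemma rcont_Re g : rcont g -> continuous (fun t => complex.Re (g t)).
Proof.
move=> cg t.
apply: (proj2 (@cvgrPdist_le _ R^o _ (nbhs (t : R^o)) _ _ _)) => e e0.
have [d d0 H] := cg t e e0.
apply/nbhs_ballP; exists d => //= u; rewrite /ball /= => hu.
rewrite -ReB; apply: le_trans (cm_Re _) _; rewrite cmB; apply: H.
by rewrite distrC.
Qed.

Lemma rcont_Im g : rcont g -> continuous (fun t => complex.Im (g t)).
Proof.
move=> cg t.
apply: (proj2 (@cvgrPdist_le _ R^o _ (nbhs (t : R^o)) _ _ _)) => e e0.
have [d d0 H] := cg t e e0.
apply/nbhs_ballP; exists d => //= u; rewrite /ball /= => hu.
rewrite -ImB; apply: le_trans (cm_Im _) _; rewrite cmB; apply: H.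
by rewrite distrC.
Qed.

Definition cprim_on g a b (G : R -> C) :=
  prim_on (fun t => complex.Re (g t)) a b (fun t => complex.Re (G t)) /\
  prim_on (fun t => complex.Im (g t)) a b (fun t => complex.Im (G t)).

Definition cint g a b : C :=
  rint (fun t => complex.Re (g t)) a b +i* rint (fun t => complex.Im (g t)) a b.

Lemma cprim_exists g a b : rcont g -> exists G, cprim_on g a b G.
Proof.
move=> cg; have [G1 p1] := prim_exists a b (rcont_Re cg).
have [G2 p2] := prim_exists a b (rcont_Im cg).
by exists (fun t => G1 t +i* G2 t).
Qed.

Lemma cintE g a b G : a <= b -> cprim_on g a b G -> cint g a b = G b - G a.
Proof.
move=> ab [p1 p2]; rewrite /cint (rintE ab p1) (rintE ab p2).
by case: (G b) (G a) => [? ?] [].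
Qed.

Lemma cprimD g1 g2 a b G1 G2 : cprim_on g1 a b G1 -> cprim_on g2 a b G2 ->
  cprim_on (fun t => g1 t + g2 t) a b (fun t => G1 t + G2 t).
Proof.
move=> [p1 p2] [q1 q2]; split=> x xi /=.
  rewrite (_ : (fun t => _) = (fun t => complex.Re (G1 t)) + fun t => complex.Re (G2 t)).
    by rewrite ReD; apply: is_deriveD; [exact: p1|exact: q1].
  by apply/funext => t; rewrite ReD.
rewrite (_ : (fun t => _) = (fun t => complex.Im (G1 t)) + fun t => complex.Im (G2 t)).
  by rewrite ImD; apply: is_deriveD; [exact: p2|exact: q2].
by apply/funext => t; rewrite ImD.
Qed.

Lemma cprimZ (c : C) g a b G : cprim_on g a b G ->
  cprim_on (fun t => c * g t) a b (fun t => c * G t).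
Proof.
move=> [p1 p2]; split=> x xi /=.
  rewrite (_ : (fun t => _) = complex.Re c *: (fun t => complex.Re (G t))
     - complex.Im c *: fun t => complex.Im (G t)).
    rewrite ReM; apply: is_deriveB; apply: is_deriveZ; [exact: p1|exact: p2].
  by apply/funext => t; rewrite ReM.
rewrite (_ : (fun t => _) = complex.Re c *: (fun t => complex.Im (G t))
     + complex.Im c *: fun t => complex.Re (G t)).
  rewrite ImM; apply: is_deriveD; apply: is_deriveZ; [exact: p2|exact: p1].
by apply/funext => t; rewrite ImM.
Qed.

Lemma cintD g1 g2 a b : a <= b -> rcont g1 -> rcont g2 ->
  cint (fun t => g1 t + g2 t) a b = cint g1 a b + cint g2 a b.
Proof.
move=> ab c1 c2; have [G1 p1] := cprim_exists a b c1; have [G2 p2] := cprim_exists a b c2.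
by rewrite (cintE ab (cprimD p1 p2)) (cintE ab p1) (cintE ab p2) /=; ring.
Qed.

Lemma cintZ (c : C) g a b : a <= b -> rcont g ->
  cint (fun t => c * g t) a b = c * cint g a b.
Proof.
move=> ab c1; have [G1 p1] := cprim_exists a b c1.
by rewrite (cintE ab (cprimZ c p1)) (cintE ab p1) /= mulrBr.
Qed.

Lemma cint_split g a b c : a <= b -> b <= c -> rcont g ->
  cint g a c = cint g a b + cint g b c.
Proof.
move=> ab bc cg; have [G [p1 p2]] := cprim_exists a c cg.
rewrite (@cintE _ a c G) ?(le_trans ab bc) // (@cintE _ a b G) //; last first.
  by split=> x /andP[ax xb]; [apply: p1|apply: p2]; rewrite ax (le_trans xb).
rewrite (@cintE _ b c G) //; first by ring.
by split=> x /andP[ax xb]; [apply: p1|apply: p2]; rewrite xb (le_trans ab).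
Qed.

(** The factor 2 comes from estimating real and imaginary part separately. *)
Lemma cint_bound g a b M : rcont g -> a <= b ->
  (forall t, a <= t <= b -> cm (g t) <= M) -> cm (cint g a b) <= 2 * M * (b - a).
Proof.
move=> cg ab hM; apply: le_trans (cm_ReIm _) _ => /=.
have h1 := @rint_bound _ a b M (rcont_Re cg) ab.
have h2 := @rint_bound _ a b M (rcont_Im cg) ab.
have {}h1 := h1 (fun x xi => le_trans (cm_Re _) (hM x xi)).
have {}h2 := h2 (fun x xi => le_trans (cm_Im _) (hM x xi)).
lra.
Qed.

Lemma eq_cint g1 g2 a b : g1 =1 g2 -> cint g1 a b = cint g2 a b.
Proof. by move=> /funext ->. Qed.

(** A primitive of the integrand along a segment, for the integrals of affine
    functions. *)
Lemma cprim_line (F f : C -> C) (z v : C) a b :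
  (forall w, cdiff F w (f w)) ->
  cprim_on (fun t => f (z + t%:C * v) * v) a b (fun t => F (z + t%:C * v)).
Proof.
move=> dF.
have K x e : 0 < e -> exists2 d : R, 0 < d & forall u, `|u - x| < d ->
    cm (F (z + u%:C * v) - F (z + x%:C * v) - f (z + x%:C * v) * v * (u - x)%:C)
      <= e * `|u - x|.
  move=> e0; have e1 : 0 < e / (cm v + 1).
    by rewrite divr_gt0 // ltr_wpDl ?cm_ge0.
  have v1 : 0 < cm v + 1 by rewrite ltr_wpDl ?cm_ge0.
  have [d d0 H] := dF (z + x%:C * v) _ e1.
  exists (d / (cm v + 1)); first by rewrite divr_gt0.
  move=> u hu; have E : z + u%:C * v - (z + x%:C * v) = (u - x)%:C * v.
    by rewrite rmorphB /=; ring.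
  have hE : cm ((u - x)%:C * v) <= `|u - x| * (cm v + 1).
    by rewrite cmM cmR ler_wpM2l // lerDl.
  have := H (z + u%:C * v); rewrite E => /(_ _).
  rewrite -[_ * v * _]mulrA [v * _]mulrC => h; apply: le_trans (h _) _.
    by apply: le_lt_trans hE _; rewrite -ltr_pdivlMr.
  apply: le_trans (_ : e / (cm v + 1) * (`|u - x| * (cm v + 1)) <= _).
    by rewrite ler_wpM2l // ltW.
  by rewrite le_eqVlt; apply/orP; left; apply/eqP; field; rewrite gt_eqF.
split=> x _ /=; apply: is_derive_eps => e e0; have [d d0 H] := K x e e0.
  exists d => // u hu; apply: le_trans (H u hu); apply: le_trans (cm_Re _).
  by rewrite !ReB ReMr.
exists d => // u hu; apply: le_trans (H u hu); apply: le_trans (cm_Im _).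
by rewrite !ImB ImMr.
Qed.

End Integral.

Arguments rint {R} h a b : simpl never.
Arguments cint {R} g a b : simpl never.

(** * The integral theorem on rectangles *)

Section Goursat.
Variable R : realType.
Local Notation C := (R[i]).
Implicit Types (F g : C -> C) (x y t : R) (w z : C).

Lemma CxE x y : x +i* y = x%:C + y%:C * 'i%C.
Proof. by apply/eqP; rewrite eq_complex !raddfD /= !(mulr0, mul0r, mulr1, addr0, add0r, subr0) !eqxx. Qed.

Lemma ccont_rcont F (p v : C) :
  (forall t, ccont F (p + t%:C * v)) -> rcont (fun t => F (p + t%:C * v)).
Proof.
move=> cF t e e0; have [d d0 H] := cF t e e0.
have v1 : 0 < cm v + 1 by rewrite ltr_wpDl ?cm_ge0.
exists (d / (cm v + 1)); first by rewrite divr_gt0.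
move=> u hu; apply: H.
have -> : p + u%:C * v - (p + t%:C * v) = (u - t)%:C * v by rewrite rmorphB /=; ring.
rewrite cmM cmR; apply: le_lt_trans (_ : _ <= `|u - t| * (cm v + 1)) _.
  by rewrite ler_wpM2l // lerDl.
by rewrite -ltr_pdivlMr.
Qed.

Definition hline F y t := F (t +i* y).
Definition vline F x t := F (x +i* t).

Lemma hlineE F y : hline F y = fun t => F (y%:C * 'i%C + t%:C * 1).
Proof. by apply/funext => t; rewrite /hline CxE mulr1 addrC. Qed.
Lemma vlineE F x : vline F x = fun t => F (x%:C + t%:C * 'i%C).
Proof. by apply/funext => t; rewrite /vline CxE. Qed.

(** The integral over the boundary of a rectangle, counterclockwise. *)
Definition rect_int F x1 x2 y1 y2 : C :=
  cint (hline F y1) x1 x2 + 'i%C * cint (vline F x2) y1 y2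
  - cint (hline F y2) x1 x2 - 'i%C * cint (vline F x1) y1 y2.

Arguments rect_int : simpl never.

Lemma hline_rcont F y : (forall w, complex.Im w = y -> ccont F w) -> rcont (hline F y).
Proof.
move=> H; rewrite hlineE; apply: ccont_rcont => t; apply: H.
by rewrite /= !(mulr0, mul0r, mulr1, addr0, add0r).
Qed.
Lemma vline_rcont F x : (forall w, complex.Re w = x -> ccont F w) -> rcont (vline F x).
Proof.
move=> H; rewrite vlineE; apply: ccont_rcont => t; apply: H.
by rewrite /= !(mulr0, mul0r, mulr1, addr0, subr0).
Qed.

Lemma rect_int_splitx F a b c y1 y2 : (forall w, ccont F w) -> a <= b -> b <= c ->
  rect_int F a c y1 y2 = rect_int F a b y1 y2 + rect_int F b c y1 y2.
Proof.
move=> cF ab bc; rewrite /rect_int.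
rewrite (@cint_split _ (hline F y1) a b c) //; last exact: hline_rcont.
rewrite (@cint_split _ (hline F y2) a b c) //; last exact: hline_rcont.
by ring.
Qed.

Lemma rect_int_splity F a b c x1 x2 : (forall w, ccont F w) -> a <= b -> b <= c ->
  rect_int F x1 x2 a c = rect_int F x1 x2 a b + rect_int F x1 x2 b c.
Proof.
move=> cF ab bc; rewrite /rect_int.
rewrite (@cint_split _ (vline F x1) a b c) //; last exact: vline_rcont.
rewrite (@cint_split _ (vline F x2) a b c) //; last exact: vline_rcont.
by ring.
Qed.

Section Lines.
Variables (x1 x2 y1 y2 : R).
Hypotheses (hx : x1 <= x2) (hy : y1 <= y2).

(** Continuity is required on the whole lines that carry the sides and not only
    on the sides, since primitives are taken of functions on all of [R]. *)
Definition online w := [\/ complex.Re w = x1, complex.Re w = x2,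
  complex.Im w = y1 | complex.Im w = y2].

Definition inrect w := x1 <= complex.Re w <= x2 /\ y1 <= complex.Im w <= y2.

Definition lcont F := forall w, online w -> ccont F w.

Lemma lcont_lines F : lcont F -> [/\ rcont (hline F y1), rcont (hline F y2),
  rcont (vline F x1) & rcont (vline F x2)].
Proof.
by move=> H; split; [apply: hline_rcont|apply: hline_rcont|apply: vline_rcont|
   apply: vline_rcont] => w hw; apply: H; [constructor 3|constructor 4|
   constructor 1|constructor 2].
Qed.

Lemma rect_intD F g : lcont F -> lcont g ->
  rect_int (fun w => F w + g w) x1 x2 y1 y2 = rect_int F x1 x2 y1 y2 + rect_int g x1 x2 y1 y2.
Proof.
move=> /lcont_lines[f1 f2 f3 f4] /lcont_lines[g1 g2 g3 g4].
rewrite /rect_int (cintD hx f1 g1) (cintD hx f2 g2) (cintD hy f3 g3) (cintD hy f4 g4).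
by ring.
Qed.

Lemma rect_intZ (c : C) F : lcont F ->
  rect_int (fun w => c * F w) x1 x2 y1 y2 = c * rect_int F x1 x2 y1 y2.
Proof.
move=> /lcont_lines[f1 f2 f3 f4].
rewrite /rect_int (cintZ c hx f1) (cintZ c hx f2) (cintZ c hy f3) (cintZ c hy f4).
by ring.
Qed.

Lemma eq_rect_int F g : (forall w, online w -> F w = g w) ->
  rect_int F x1 x2 y1 y2 = rect_int g x1 x2 y1 y2.
Proof.
move=> H; rewrite /rect_int; congr (_ + _ * _ - _ - _ * _); apply: eq_cint => t;
  apply: H; [constructor 3|constructor 2|constructor 4|constructor 1] => //.
Qed.

Lemma rect_int_bound F M : lcont F -> (forall w, online w -> inrect w -> cm (F w) <= M) ->
  cm (rect_int F x1 x2 y1 y2) <= 4 * M * ((x2 - x1) + (y2 - y1)).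
Proof.
move=> /lcont_lines[f1 f2 f3 f4] H; rewrite /rect_int.
have b1 : cm (cint (hline F y1) x1 x2) <= 2 * M * (x2 - x1).
  apply: cint_bound => // t ht; apply: H; first by constructor 3.
  by split => //=; rewrite lexx.
have b2 : cm (cint (hline F y2) x1 x2) <= 2 * M * (x2 - x1).
  apply: cint_bound => // t ht; apply: H; first by constructor 4.
  by split => //=; rewrite lexx andbT.
have b3 : cm (cint (vline F x1) y1 y2) <= 2 * M * (y2 - y1).
  apply: cint_bound => // t ht; apply: H; first by constructor 1.
  by split => //=; rewrite lexx.
have b4 : cm (cint (vline F x2) y1 y2) <= 2 * M * (y2 - y1).
  apply: cint_bound => // t ht; apply: H; first by constructor 2.
  by split => //=; rewrite lexx andbT.
have := cmD (cint (hline F y1) x1 x2 + 'i%C * cint (vline F x2) y1 y2 -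
   cint (hline F y2) x1 x2) (- ('i%C * cint (vline F x1) y1 y2)).
have := cmD (cint (hline F y1) x1 x2 + 'i%C * cint (vline F x2) y1 y2)
   (- cint (hline F y2) x1 x2).
have := cmD (cint (hline F y1) x1 x2) ('i%C * cint (vline F x2) y1 y2).
rewrite !cmN !cmM !cm_i !mul1r; lra.
Qed.

Lemma cdiff_sqr (a b w : C) : cdiff (fun v => a * v ^+ 2 + b * v) w (a * 2 * w + b).
Proof.
move=> e e0; have a1 : 0 < cm a + 1 by rewrite ltr_wpDl ?cm_ge0.
exists (e / (cm a + 1)); first by rewrite divr_gt0.
move=> v hv.
have -> : a * v ^+ 2 + b * v - (a * w ^+ 2 + b * w) - (a * 2 * w + b) * (v - w) =
  a * (v - w) * (v - w) by ring.
rewrite cmM ler_wpM2r ?cm_ge0 // cmM.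
apply: le_trans (_ : (cm a + 1) * cm (v - w) <= _); first by rewrite ler_wpM2r ?cm_ge0 ?lerDl.
by rewrite mulrC -ler_pdivlMr // ltW.
Qed.

(** Affine functions have a primitive. *)
Lemma rect_int_affine (a b : C) : rect_int (fun w => a * w + b) x1 x2 y1 y2 = 0.
Proof.
have D w : cdiff (fun v => a / 2 * v ^+ 2 + b * v) w (a * w + b).
  have := @cdiff_sqr (a / 2) b w; rewrite divfK ?pnatr_eq0 //.
pose G (v : C) : C := a / 2 * v ^+ 2 + b * v.
have h y : cint (hline (fun w => a * w + b) y) x1 x2 = G (x2 +i* y) - G (x1 +i* y).
  rewrite (@cintE _ _ x1 x2 (hline G y)) //.
  have := @cprim_line _ _ _ (y%:C * 'i%C) 1 x1 x2 D.
  by rewrite !hlineE; under eq_fun do rewrite mulr1.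
have v x : 'i%C * cint (vline (fun w => a * w + b) x) y1 y2 = G (x +i* y2) - G (x +i* y1).
  rewrite -cintZ //; last first.
    apply: vline_rcont => w _; apply: (@cdiff_ccont _ _ _ a) => e e0.
    exists 1 => // u _; have -> : a * u + b - (a * w + b) - a * (u - w) = 0 by ring.
    by rewrite cm0 mulr_ge0 ?cm_ge0 ?ltW.
  rewrite (@cintE _ _ y1 y2 (vline G x)) //.
  have := @cprim_line _ _ _ x%:C 'i%C y1 y2 D.
  by rewrite !vlineE; under eq_fun do rewrite mulrC.
rewrite /rect_int !h !v; ring.
Qed.
End Lines.

Lemma ccont_affine (a b w : C) : ccont (fun w => a * w + b) w.
Proof.
apply: (@cdiff_ccont _ _ _ a) => e e0.
exists 1 => // u _; have -> : a * u + b - (a * w + b) - a * (u - w) = 0 by ring.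
by rewrite cm0 mulr_ge0 ?cm_ge0 ?ltW.
Qed.

Lemma ccontD F g w : ccont F w -> ccont g w -> ccont (fun v => F v + g v) w.
Proof.
move=> cF cg e e0; have e2 : 0 < e / 2 by lra.
have [d d0 H] := cF _ e2; have [d' d0' H'] := cg _ e2.
exists (Num.min d d'); first by rewrite lt_min d0.
move=> v; rewrite lt_min => /andP[h1 h2].
have -> : F v + g v - (F w + g w) = (F v - F w) + (g v - g w) by ring.
by have := cmD (F v - F w) (g v - g w); have := H v h1; have := H' v h2; lra.
Qed.

Section Bisect.
Variables (F : C -> C) (x1 x2 y1 y2 : R).
Hypotheses (hx : x1 <= x2) (hy : y1 <= y2) (cF : forall w, ccont F w).
Hypothesis dF : forall w, inrect x1 x2 y1 y2 w -> exists l, cdiff F w l.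

Let p := x2 - x1.
Let q := y2 - y1.
Let rr n (c : R * R) := rect_int F c.1 (c.1 + p / 2 ^+ n) c.2 (c.2 + q / 2 ^+ n).

(** The integral over a rectangle is the sum of those over its four quarters,
    so one quarter carries at least a fourth of it. *)
Lemma bisect_step (eta : R) n c : eta / 4 ^+ n < cm (rr n c) -> exists c' : R * R,
  [/\ eta / 4 ^+ n.+1 < cm (rr n.+1 c'),
    c.1 <= c'.1, c'.1 + p / 2 ^+ n.+1 <= c.1 + p / 2 ^+ n,
    c.2 <= c'.2 & c'.2 + q / 2 ^+ n.+1 <= c.2 + q / 2 ^+ n].
Proof.
move=> H; set u := p / 2 ^+ n.+1; set v := q / 2 ^+ n.+1.
have u0 : 0 <= u by rewrite divr_ge0 ?subr_ge0 ?exprn_ge0.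
have v0 : 0 <= v by rewrite divr_ge0 ?subr_ge0 ?exprn_ge0.
have E2 : (2 ^+ n : R) != 0 by rewrite expf_neq0.
have E4 : (4 ^+ n : R) != 0 by rewrite expf_neq0.
have uE : p / 2 ^+ n = u + u by rewrite /u exprS; field.
have vE : q / 2 ^+ n = v + v by rewrite /v exprS; field.
have eE : eta / 4 ^+ n = 4 * (eta / 4 ^+ n.+1) by rewrite [4 ^+ n.+1]exprS; field.
move: H; rewrite eE /rr uE vE; set e := eta / 4 ^+ n.+1 => H.
have [[x y] /= ] : exists c', [/\ e < cm (rect_int F c'.1 (c'.1 + u) c'.2 (c'.2 + v)),
    c'.1 = c.1 \/ c'.1 = c.1 + u & c'.2 = c.2 \/ c'.2 = c.2 + v].
  apply: contrapT => /forallNP N.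
  have M a b : a = c.1 \/ a = c.1 + u -> b = c.2 \/ b = c.2 + v ->
    cm (rect_int F a (a + u) b (b + v)) <= e.
    by move=> ha hb; rewrite leNgt; apply/negP => hh; apply: (N (a, b)).
  move: H; apply/negP; rewrite -leNgt !addrA.
  rewrite (@rect_int_splitx F c.1 (c.1 + u)) ?lerDl //.
  rewrite (@rect_int_splity F c.2 (c.2 + v) _ c.1) ?lerDl //.
  rewrite (@rect_int_splity F c.2 (c.2 + v) _ (c.1 + u)) ?lerDl //.
  have := M c.1 c.2 (or_introl erefl) (or_introl erefl).
  have := M c.1 (c.2 + v) (or_introl erefl) (or_intror erefl).
  have := M (c.1 + u) c.2 (or_intror erefl) (or_introl erefl).
  have := M (c.1 + u) (c.2 + v) (or_intror erefl) (or_intror erefl).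
  set A := rect_int _ _ _ _ _; set B := rect_int _ _ _ _ _; set D := rect_int _ _ _ _ _; set E := rect_int _ _ _ _ _.
  by have := cmD (E + D) (B + A); have := cmD E D; have := cmD B A; lra.
move=> [h1 h2 h3]; exists (x, y) => /=; split=> //.
- by case: h2 => ->; rewrite ?lerDl.
- by case: h2 => ->; lra.
- by case: h3 => ->; rewrite ?lerDl.
- by case: h3 => ->; lra.
Qed.

Lemma nested_halving (x : nat -> R) (s : R) : 0 <= s ->
  (forall n, x n <= x n.+1 /\ x n.+1 + s / 2 ^+ n.+1 <= x n + s / 2 ^+ n) ->
  exists c, forall n, x n <= c <= x n + s / 2 ^+ n.
Proof.
move=> s0 H.
have sn n : 0 <= s / 2 ^+ n by rewrite divr_ge0 ?exprn_ge0.
have up n k : x n <= x (n + k)%N.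
  by elim: k => [|k IH]; rewrite ?addn0 // addnS; apply: le_trans IH (H _).1.
have dn n k : x (n + k)%N + s / 2 ^+ (n + k) <= x n + s / 2 ^+ n.
  by elim: k => [|k IH]; rewrite ?addn0 // addnS; apply: le_trans (H _).2 IH.
have ub n m : x n <= x m + s / 2 ^+ m.
  case: (leqP n m) => [/subnKC <-|/ltnW/subnKC <-].
    by apply: le_trans (up n (m - n)%N) _; rewrite lerDl.
  by apply: le_trans (dn m (n - m)%N); rewrite lerDl.
exists (sup (range x)) => n; apply/andP; split.
  by apply: ub_le_sup; [exists (x 0%N + s / 2 ^+ 0) => _ [k _ <-]|exists n].
by apply: ge_sup => [|_ [k _ <-]]; [exists (x n), n|].
Qed.

(** Goursat's argument: bisection gives rectangles shrinking to a point and
    integrals of size at least [eta / 4^n], but near a point of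
    differentiability [F] is affine up to an error that is small compared with
    the diameter, and affine functions integrate to 0. *)
Lemma goursat : rect_int F x1 x2 y1 y2 = 0.
Proof.
apply/eqP; rewrite -cm_eq0 eq_le cm_ge0 andbT leNgt; apply/negP => I0.
(* Half the modulus, so that the initial inequality is strict. *)
set eta := cm (rect_int F x1 x2 y1 y2) / 2.
have eta0 : 0 < eta by rewrite divr_gt0.
have /choice[st hst] : forall nc : nat * (R * R), exists c', eta / 4 ^+ nc.1 < cm (rr nc.1 nc.2) ->
  [/\ eta / 4 ^+ nc.1.+1 < cm (rr nc.1.+1 c'),
    nc.2.1 <= c'.1, c'.1 + p / 2 ^+ nc.1.+1 <= nc.2.1 + p / 2 ^+ nc.1,
    nc.2.2 <= c'.2 & c'.2 + q / 2 ^+ nc.1.+1 <= nc.2.2 + q / 2 ^+ nc.1].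
  move=> [n c] /=; have [h|h] := boolP (eta / 4 ^+ n < cm (rr n c)); last by exists c.
  by have [c' hc'] := bisect_step h; exists c'.
pose s := fix s n := if n is n'.+1 then st (n', s n') else (x1, y1).
have bad n : eta / 4 ^+ n < cm (rr n (s n)).
  elim: n => [|n IH]; last by have [] := hst (n, s n) IH.
  by rewrite /rr /p /q /= !expr0 !divr1 !subrKC /eta; lra.
have [cx hcx] : exists c, forall n, (s n).1 <= c <= (s n).1 + p / 2 ^+ n.
  apply: nested_halving; first by rewrite subr_ge0.
  by move=> n; have [] := hst (n, s n) (bad n).
have [cy hcy] : exists c, forall n, (s n).2 <= c <= (s n).2 + q / 2 ^+ n.
  apply: (nested_halving (x := fun n => (s n).2)); first by rewrite subr_ge0.
  by move=> n; have [] := hst (n, s n) (bad n).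
have cin : inrect x1 x2 y1 y2 (cx +i* cy).
  have := hcx 0%N; have := hcy 0%N; rewrite /= expr0 !divr1 /p /q !subrKC.
  by split.
have [l hl] := dF cin.
set S := p + q.
have p0 : 0 <= p by rewrite subr_ge0.
have q0 : 0 <= q by rewrite subr_ge0.
have S0 : 0 <= S by rewrite addr_ge0.
have e1 : 0 < eta / (4 * S ^+ 2 + 1).
  by rewrite divr_gt0 // ltr_wpDl // mulr_ge0 ?exprn_ge0.
have [d d0 H] := hl _ e1; move: e1 H; set e := eta / _ => e1 H.
have [n hn] : exists n, S / 2 ^+ n < d.
  exists (Num.truncn (S / d)).+1.
  rewrite ltr_pdivrMr ?exprn_gt0 // -ltr_pdivrMl // mulrC.
  apply: lt_le_trans (truncnS_gt _) _; rewrite -natrX ler_nat.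
  exact/ltnW/ltn_expl.
have E2 : (2 ^+ n : R) > 0 by rewrite exprn_gt0.
have := bad n; apply/negP; rewrite -leNgt /rr.
have pn0 : 0 <= p / 2 ^+ n by rewrite divr_ge0 // ltW.
have qn0 : 0 <= q / 2 ^+ n by rewrite divr_ge0 // ltW.
set c := cx +i* cy.
have SE : S / 2 ^+ n = p / 2 ^+ n + q / 2 ^+ n by rewrite /S mulrDl.
(* Subtracting the affine part at the common point c does not change the integral. *)
pose G w := F w + ((- l) * w + (l * c - F c)).
have cG w : ccont G w.
  by apply: ccontD => //; exact: ccont_affine.
have a1 : (s n).1 <= (s n).1 + p / 2 ^+ n by rewrite lerDl.
have a2 : (s n).2 <= (s n).2 + q / 2 ^+ n by rewrite lerDl.
have <- : rect_int G (s n).1 ((s n).1 + p / 2 ^+ n) (s n).2 ((s n).2 + q / 2 ^+ n) =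
   rect_int F (s n).1 ((s n).1 + p / 2 ^+ n) (s n).2 ((s n).2 + q / 2 ^+ n).
  rewrite rect_intD //.
    by rewrite rect_int_affine // addr0.
  by move=> w _; apply: ccont_affine.
have := @rect_int_bound _ _ _ _ a1 a2 G (e * (S / 2 ^+ n)).
move=> /(_ (fun w _ => cG w)) h; apply: le_trans (h _) _.
  move=> w _ [/andP[w1 w2] /andP[w3 w4]].
  have hw : cm (w - c) <= S / 2 ^+ n.
    apply: le_trans (cm_ReIm _) _; rewrite SE.
    have /andP[cx1 cx2] := hcx n; have /andP[cy1 cy2] := hcy n.
    by rewrite ReB ImB lerD // ler_norml; apply/andP; split=> /=; lra.
  have -> : G w = F w - F c - l * (w - c) by rewrite /G; ring.
  apply: le_trans (H _ (le_lt_trans hw hn)) _.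
  by rewrite ler_wpM2l // ltW.
rewrite ![_ + _ - _]addrAC !subrr !add0r -SE.
have -> : 4 * (e * (S / 2 ^+ n)) * (S / 2 ^+ n) = (4 * S ^+ 2) * e / 4 ^+ n.
  have -> : (4 : R) ^+ n = 2 ^+ n * 2 ^+ n by rewrite -exprMn -natrM.
  by field; rewrite gt_eqF.
rewrite ler_wpM2r ?invr_ge0 ?exprn_ge0 //.
rewrite /e mulrA ler_pdivrMr ?ltr_wpDl ?mulr_ge0 ?exprn_ge0 //.
by rewrite mulrDr mulr1 mulrC lerDl ltW.
Qed.
End Bisect.

(** An exceptional point at which [F] is merely continuous does no harm: a
    small square around it has a small integral. *)
Lemma goursat_except_point F x1 x2 y1 y2 (w0 : C) : (forall w, ccont F w) ->
  x1 < complex.Re w0 < x2 -> y1 < complex.Im w0 < y2 ->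
  (forall w, inrect x1 x2 y1 y2 w -> w != w0 -> exists l, cdiff F w l) ->
  rect_int F x1 x2 y1 y2 = 0.
Proof.
move=> cF /andP[hx1 hx2] /andP[hy1 hy2] dF.
have [d d0 H] := cF w0 _ ltr01.
set M := cm (F w0) + 1.
have M0 : 0 < M by rewrite ltr_wpDl ?cm_ge0.
apply/eqP; rewrite -cm_eq0 eq_le cm_ge0 andbT; apply/ler_addgt0Pr => e e0; rewrite add0r.
set a := complex.Re w0; set b := complex.Im w0.
(* The small square has sides 2 r, so its integral is at most 16 M r <= e. *)
pose r := Num.min (Num.min (d / 4) (e / (16 * M))) (Num.min (Num.min (a - x1) (x2 - a)) (Num.min (b - y1) (y2 - b))).
have r0 : 0 < r by rewrite !lt_min !subr_gt0 hx1 hx2 hy1 hy2 !divr_gt0 ?mulr_gt0.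
have [r1 r2 r3 r4] : [/\ r <= a - x1, r <= x2 - a, r <= b - y1 & r <= y2 - b].
  by rewrite /r; split; rewrite !ge_min lexx !orbT.
have [r5 r6] : r <= d / 4 /\ r <= e / (16 * M) by rewrite /r; split; rewrite !ge_min lexx ?orbT.
(* Four rectangles around the small square, on which F is differentiable. *)
rewrite (@rect_int_splitx F x1 (a - r)) //; [|lra|lra].
rewrite (@rect_int_splitx F (a - r) (a + r)) //; [|lra|lra].
rewrite (@rect_int_splity F y1 (b - r) _ (a - r)) //; [|lra|lra].
rewrite (@rect_int_splity F (b - r) (b + r) _ (a - r)) //; [|lra|lra].
rewrite (@goursat F x1 (a - r)) //; [|lra|lra|]; last first.
  move=> w [/andP[w1 w2] /andP[w3 w4]]; apply: dF.
    by split; apply/andP; split; lra.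
  by apply/eqP => ww; move: w2; rewrite ww -/a; lra.
rewrite (@goursat F (a + r) x2) //; [|lra|lra|]; last first.
  move=> w [/andP[w1 w2] /andP[w3 w4]]; apply: dF.
    by split; apply/andP; split; lra.
  by apply/eqP => ww; move: w1; rewrite ww -/a; lra.
rewrite (@goursat F (a - r) (a + r) y1 (b - r)) //; [|lra|lra|]; last first.
  move=> w [/andP[w1 w2] /andP[w3 w4]]; apply: dF.
    by split; apply/andP; split; lra.
  by apply/eqP => ww; move: w4; rewrite ww -/b; lra.
rewrite (@goursat F (a - r) (a + r) (b + r) y2) //; [|lra|lra|]; last first.
  move=> w [/andP[w1 w2] /andP[w3 w4]]; apply: dF.
    by split; apply/andP; split; lra.
  by apply/eqP => ww; move: w3; rewrite ww -/b; lra.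
rewrite !(addr0, add0r).
have h1 : a - r <= a + r by lra.
have h2 : b - r <= b + r by lra.
have := @rect_int_bound _ _ _ _ h1 h2 F M (fun w _ => cF w) _; set I := cm _ => hI.
have {}hI : I <= 4 * M * (a + r - (a - r) + (b + r - (b - r))).
  apply: hI => w _ [/andP[w1 w2] /andP[w3 w4]].
  rewrite /M -lerBlDl; apply: le_trans (cmBr _ _) _; apply: H.
  apply: le_lt_trans (cm_ReIm _) _; rewrite ReB ImB -/a -/b.
  have : `|complex.Re w - a| <= r by rewrite ler_norml; apply/andP; split; lra.
  have : `|complex.Im w - b| <= r by rewrite ler_norml; apply/andP; split; lra.
  lra.
apply: le_trans hI _.
have -> : 4 * M * (a + r - (a - r) + (b + r - (b - r))) = (16 * M) * r by ring.
by rewrite mulrC -ler_pdivlMr ?mulr_gt0.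
Qed.

End Goursat.

(** * Cauchy transforms *)

Section Cont.
Variable R : realType.
Local Notation C := (R[i]).
Implicit Types (F g k : C -> C) (w z : C).

Lemma ccontM F g w : ccont F w -> ccont g w -> ccont (fun v => F v * g v) w.
Proof.
move=> /ccont_cvg cF /ccont_cvg cg; apply/ccont_cvg.
exact: (@continuousM C C^o (F : C^o -> C^o) g w cF cg).
Qed.

Lemma ccontV F w : ccont F w -> F w != 0 -> ccont (fun v => (F v)^-1) w.
Proof.
move=> /ccont_cvg cF Fw; apply/ccont_cvg.
exact: (@continuousV C C^o (F : C^o -> C^o) w Fw cF).
Qed.

Lemma ccont_cst (a w : C) : ccont (fun=> a) w.
Proof. by move=> e e0; exists 1 => // v _; rewrite subrr cm0 ltW. Qed.

Lemma ccont_id w : ccont id w.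
Proof. by move=> e e0; exists e => // v; exact: ltW. Qed.

Lemma ccontX F w n : ccont F w -> ccont (fun v => F v ^+ n) w.
Proof.
move=> cF; elim: n => [|n IH]; first exact: ccont_cst.
under eq_fun do rewrite exprS; exact: ccontM.
Qed.

Lemma ccont_sub (a w : C) : ccont (fun v => v - a) w.
Proof. by apply: ccontD; [exact: ccont_id|exact: ccont_cst]. Qed.

Lemma rcont_bounded (h : R -> C) a b : a <= b -> rcont h ->
  exists M, forall t, a <= t <= b -> cm (h t) <= M.
Proof.
move=> ab ch.
have cc : continuous (fun t : R => cm (h t)).
  move=> t; apply: (proj2 (@cvgrPdist_le _ R^o _ (nbhs (t : R^o)) _ _ _)) => e e0.
  have [d d0 H] := ch t e e0.
  apply/nbhs_ballP; exists d => //= u; rewrite /ball /= => hu.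
  have {}hu : `|u - t| < d by rewrite distrC.
  have := H u hu; have := cmBr (h u) (h t); have := cmBr (h t) (h u).
  rewrite (cmB (h t)) => ? ? ?; rewrite ler_norml; apply/andP; split; lra.
have [c _ hc] := @EVT_max R (fun t : R => cm (h t)) a b ab (continuous_subspaceT cc).
by exists (cm (h c)) => t ht; apply: hc; rewrite in_itv.
Qed.

Lemma lcont_bounded x1 x2 y1 y2 g : x1 <= x2 -> y1 <= y2 -> lcont x1 x2 y1 y2 g ->
  exists2 M, 0 <= M & forall w, online x1 x2 y1 y2 w -> inrect x1 x2 y1 y2 w -> cm (g w) <= M.
Proof.
move=> hx hy /lcont_lines[f1 f2 f3 f4].
have [M1 h1] := rcont_bounded hx f1; have [M2 h2] := rcont_bounded hx f2.
have [M3 h3] := rcont_bounded hy f3; have [M4 h4] := rcont_bounded hy f4.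
have : exists2 M, 0 <= M & [/\ M1 <= M, M2 <= M, M3 <= M & M4 <= M].
  exists (Num.max 0 (Num.max (Num.max M1 M2) (Num.max M3 M4))).
    by rewrite le_max lexx.
  by split; rewrite !le_max lexx !orbT.
case=> M M0 [m1 m2 m3 m4]; exists M => // -[a b] H [ha hb]; move: ha hb => /= ha hb.
case: H => /= E; subst.
- by apply: le_trans m3; exact: h3.
- by apply: le_trans m4; exact: h4.
- by apply: le_trans m1; exact: h1.
- by apply: le_trans m2; exact: h2.
Qed.
End Cont.

Section Cauchy.
Variable R : realType.
Local Notation C := (R[i]).
Implicit Types (F g k : C -> C) (w : C).
Variables (z : C) (r : R).
Hypothesis r0 : 0 < r.

Let a1 := complex.Re z - r.
Let a2 := complex.Re z + r.
Let b1 := complex.Im z - r.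
Let b2 := complex.Im z + r.
Let onl := online a1 a2 b1 b2.
Let lc := lcont a1 a2 b1 b2.

Let ha : a1 <= a2. Proof. rewrite /a1 /a2; move: r0; lra. Qed.
Let hb : b1 <= b2. Proof. rewrite /b1 /b2; move: r0; lra. Qed.

Definition square_int g := rect_int g a1 a2 b1 b2.

(** The Cauchy transform over the boundary of the square of centre [z], without
    the customary factor. *)
Definition cauchyT k w := square_int (fun v => k v / (v - w)).

Lemma onl_dist v : onl v -> r <= cm (v - z).
Proof.
have h1 := cm_Re (v - z); have h2 := cm_Im (v - z).
rewrite ReB in h1; rewrite ImB in h2.
have A (x y : R) : x = y - r \/ x = y + r -> r <= `|x - y|.
  by case=> ->; [rewrite distrC opprB addrC subrK|rewrite addrAC subrr add0r];
    rewrite ger0_norm // ltW.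
case=> e.
- by apply: le_trans h1; apply: A; left.
- by apply: le_trans h1; apply: A; right.
- by apply: le_trans h2; apply: A; left.
- by apply: le_trans h2; apply: A; right.
Qed.

Lemma onl_dist2 v w : onl v -> r - cm (w - z) <= cm (v - w).
Proof.
by move=> /onl_dist h; have := cmD3 v w z; lra.
Qed.

Lemma onl_neq v w : onl v -> cm (w - z) < r -> v - w != 0.
Proof. by move=> h hw; have := @onl_dist2 v w h; rewrite -cm_gt0; lra. Qed.

Lemma center_in_square : cm (z - z) < r. Proof. by rewrite subrr cm0. Qed.

Lemma lc_div k w p : lc k -> cm (w - z) < r -> lc (fun v => k v / (v - w) ^+ p).
Proof.
move=> ck hw v hv; apply: ccontM; first exact: ck.
apply: ccontV; first by apply: ccontX; exact: ccont_sub.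
by rewrite expf_neq0 ?onl_neq.
Qed.

Lemma lc_div1 k w : lc k -> cm (w - z) < r -> lc (fun v => k v / (v - w)).
Proof.
by move=> ck hw; have := @lc_div k w 1 ck hw; under eq_fun do rewrite expr1.
Qed.

Lemma lcZ (c : C) k : lc k -> lc (fun v => c * k v).
Proof. by move=> ck v hv; apply: ccontM; [exact: ccont_cst|exact: ck]. Qed.

(** The identity [1 / (v - w) = 1 / (v - z) + (w - z) / ((v - z) (v - w))]
    under the integral; iterated, it is the Taylor expansion at [z]. *)
Lemma cauchyT_step k w : lc k -> cm (w - z) < r ->
  cauchyT k w = cauchyT k z + (w - z) * cauchyT (fun v => k v / (v - z)) w.
Proof.
move=> ck hw; rewrite /cauchyT /square_int.
rewrite -rect_intZ //; last by apply: lc_div1 => //; apply: lc_div1 => //; exact: center_in_square.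
rewrite -rect_intD //.
- by apply: eq_rect_int => v hv; field; rewrite !onl_neq ?center_in_square.
- by apply: lc_div1 => //; exact: center_in_square.
- by apply: lcZ; apply: lc_div1 => //; apply: lc_div1 => //; exact: center_in_square.
Qed.

(** Differentiation under the integral sign: the second order remainder of
    [1 / (v - w)] is bounded uniformly in [v]. *)
Lemma cauchyT_cdiff k w : lc k -> cm (w - z) < r -> exists l, cdiff (cauchyT k) w l.
Proof.
move=> ck hw.
have [K K0 hK] := lcont_bounded ha hb ck.
exists (square_int (fun v => k v / (v - w) ^+ 2)) => e e0.
set rho := r - cm (w - z).
have rho0 : 0 < rho by rewrite subr_gt0.
set A := 4 * (K * (2 / rho ^+ 3)) * (4 * r).
have A0 : 0 <= A by rewrite !mulr_ge0 ?invr_ge0 ?exprn_ge0 // ltW.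
have A1 : 0 < A + 1 by rewrite ltr_wpDl.
exists (Num.min (rho / 2) (e / (A + 1))).
  by rewrite lt_min !divr_gt0.
move=> w'; rewrite lt_min => /andP[h1 h2].
have hw' : cm (w' - z) < r by have := cmD3 w' w z; rewrite /rho in h1; lra.
set G := fun v => (w' - w) ^+ 2 * (k v / (v - w) ^+ 2 / (v - w')).
have lG : lc G.
  by apply: lcZ; apply: lc_div1 => //; exact: lc_div.
have -> : cauchyT k w' - cauchyT k w - square_int (fun v => k v / (v - w) ^+ 2) * (w' - w)
   = square_int G.
  rewrite /cauchyT /square_int mulrC -rect_intZ //; last exact: lc_div.
  rewrite -[- rect_int (fun v => _ / (v - w)) _ _ _ _]mulN1r -rect_intZ //; last exact: lc_div1.
  rewrite -[- rect_int (fun v => (w' - w) * _) _ _ _ _]mulN1r -rect_intZ //; last first.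
    by apply: lcZ; exact: lc_div.
  rewrite -rect_intD //; [|exact: lc_div1|by apply: lcZ; exact: lc_div1].
  rewrite -rect_intD //; last first.
  - by apply: lcZ; apply: lcZ; exact: lc_div.
  - move=> v hv; apply: ccontD; first by apply: lc_div1.
    by apply: lcZ => //; exact: lc_div1.
  by apply: eq_rect_int => v hv; rewrite /G; field; rewrite !onl_neq.
have := @rect_int_bound _ _ _ _ _ ha hb G (cm (w' - w) ^+ 2 * (K * (2 / rho ^+ 3))) lG.
move=> h; apply: le_trans (h _) _.
  move=> v hv iv; rewrite /G cmM cmX ler_wpM2l ?exprn_ge0 ?cm_ge0 //.
  rewrite -mulrA cmM; apply: ler_pM; rewrite ?cm_ge0 //; first exact: hK.
  have d1 : rho <= cm (v - w) by exact: onl_dist2.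
  have d2 : rho / 2 <= cm (v - w') by have := cmD3 v w' w; lra.
  rewrite cmM !cmV cmX -invfM.
  have -> : 2 / rho ^+ 3 = (rho ^+ 2 * (rho / 2))^-1 by field; rewrite gt_eqF.
  have p1 : 0 < cm (v - w) by exact: lt_le_trans d1.
  have p2 : 0 < cm (v - w') by apply: lt_le_trans d2; rewrite divr_gt0.
  have rho1 := ltW rho0.
  rewrite lef_pV2 ?posrE; [|by rewrite mulr_gt0 ?exprn_gt0|by rewrite !mulr_gt0 ?exprn_gt0 ?invr_gt0].
  apply: ler_pM => //; [by rewrite exprn_ge0|by rewrite divr_ge0|].
  by rewrite lerXn2r // nnegrE cm_ge0.
have -> : 4 * (cm (w' - w) ^+ 2 * (K * (2 / rho ^+ 3))) * (a2 - a1 + (b2 - b1)) =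
  A * cm (w' - w) * cm (w' - w) by rewrite /A /a1 /a2 /b1 /b2; ring.
rewrite ler_wpM2r ?cm_ge0 //; apply: le_trans (_ : (A + 1) * cm (w' - w) <= _).
  by rewrite ler_wpM2r ?cm_ge0 ?lerDl.
by rewrite mulrC -ler_pdivlMr // ltW.
Qed.

(** The value is [2 pi i], but only its being nonzero matters: every side of
    the square contributes positively to the imaginary part. *)
Lemma cauchyT1_neq0 : cauchyT (fun=> 1) z != 0.
Proof.
have l1 : lc (fun v => 1 / (v - z)) by apply: lc_div1 center_in_square; move=> v _; exact: ccont_cst.
have [c1 c2 c3 c4] := lcont_lines l1.
suff : 0 < complex.Im (cauchyT (fun=> 1) z).
  by case: (eqVneq (cauchyT _ _) 0) => [->|//]; rewrite /= ltxx.
(* On a side, at distance |s| <= r from its midpoint, the part of 1 / (v - z) that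
   counts is, up to sign, r / (s^2 + r^2) >= 1 / (2 r). *)
set m := (2 * r)^-1.
have m0 : 0 < m by rewrite invr_gt0 mulr_gt0.
have I (x y : R) : complex.Im (1 / (x +i* y)) = - y / (x ^+ 2 + y ^+ 2).
  by rewrite mul1r mulNr.
have Re' (x y : R) : complex.Re (1 / (x +i* y)) = x / (x ^+ 2 + y ^+ 2).
  by rewrite mul1r.
have K (s : R) : `|s| <= r -> m <= r / (s ^+ 2 + r ^+ 2).
  move=> hs.
  have s2 : s ^+ 2 <= r ^+ 2 by rewrite -[s ^+ 2]real_normK ?num_real // lerXn2r ?nnegrE // ltW.
  have p0 : 0 < s ^+ 2 + r ^+ 2 by rewrite ltr_wpDl ?sqr_ge0 ?exprn_gt0.
  rewrite /m ler_pdivlMr // mulrC ler_pdivrMr ?mulr_gt0 //.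
  by move: s2; rewrite !expr2 => s2; lra.
rewrite /cauchyT /square_int /rect_int !(ImB, ImD, ImM) /= !(mul0r, mul1r, add0r).
have E1 t : t +i* b1 - z = (t - complex.Re z) +i* (- r).
  by apply/eqP; rewrite eq_complex ReB ImB /= /b1 addrAC subrr add0r !eqxx.
have E2 t : t +i* b2 - z = (t - complex.Re z) +i* r.
  by apply/eqP; rewrite eq_complex ReB ImB /= /b2 addrAC subrr add0r !eqxx.
have E3 t : a1 +i* t - z = (- r) +i* (t - complex.Im z).
  by apply/eqP; rewrite eq_complex ReB ImB /= /a1 addrAC subrr add0r !eqxx.
have E4 t : a2 +i* t - z = r +i* (t - complex.Im z).
  by apply/eqP; rewrite eq_complex ReB ImB /= /a2 addrAC subrr add0r !eqxx.
have A t : a1 <= t <= a2 -> `|t - complex.Re z| <= r.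
  by rewrite /a1 /a2 ler_norml => /andP[? ?]; apply/andP; split; lra.
have B t : b1 <= t <= b2 -> `|t - complex.Im z| <= r.
  by rewrite /b1 /b2 ler_norml => /andP[? ?]; apply/andP; split; lra.
have m1 : m * (a2 - a1) > 0 by rewrite mulr_gt0 // /a2 /a1; move: r0; lra.
have m2 : m * (b2 - b1) > 0 by rewrite mulr_gt0 // /b2 /b1; move: r0; lra.
have h1 : m * (a2 - a1) <= rint (fun t => complex.Im (hline (fun v => 1 / (v - z)) b1 t)) a1 a2.
  apply: rint_ge (rcont_Im c1) ha _ => t /A ht.
  by rewrite /hline E1 I opprK sqrrN; exact: K.
have h2 : rint (fun t => complex.Im (hline (fun v => 1 / (v - z)) b2 t)) a1 a2 <= - m * (a2 - a1).
  apply: rint_le (rcont_Im c2) ha _ => t /A ht.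
  by rewrite /hline E2 I mulNr lerN2; exact: K.
have h3 : rint (fun t => complex.Re (vline (fun v => 1 / (v - z)) a1 t)) b1 b2 <= - m * (b2 - b1).
  apply: rint_le (rcont_Re c3) hb _ => t /B ht.
  by rewrite /vline E3 Re' mulNr lerN2 sqrrN addrC; exact: K.
have h4 : m * (b2 - b1) <= rint (fun t => complex.Re (vline (fun v => 1 / (v - z)) a2 t)) b1 b2.
  apply: rint_ge (rcont_Re c4) hb _ => t /B ht.
  by rewrite /vline E4 Re' addrC; exact: K.
lra.
Qed.

(** Cauchy's formula, with the transform of 1 in place of [2 pi i]. *)
Lemma cauchy_formula F w : (forall v, ccont F v) ->
  (forall v, inrect a1 a2 b1 b2 v -> exists l, cdiff F v l) -> cm (w - z) < r ->
  F w * cauchyT (fun=> 1) w = cauchyT F w.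
Proof.
move=> cF dF hw.
have rw : `|complex.Re (w - z)| < r by apply: le_lt_trans (cm_Re _) hw.
have iw : `|complex.Im (w - z)| < r by apply: le_lt_trans (cm_Im _) hw.
move: rw iw; rewrite ReB ImB !ltr_norml => /andP[rw1 rw2] /andP[iw1 iw2].
have [l hl] : exists l, cdiff F w l.
  by apply: dF; split; apply/andP; split; rewrite /a1 /a2 /b1 /b2; lra.
(* The difference quotient is continuous at w, the one exceptional point. *)
pose q v := if v == w then l else (F v - F w) / (v - w).
have cq v : ccont q v.
  have [->|vw] := eqVneq v w.
    move=> e e0; have [d d0 H] := hl e e0; exists d => // u hu.
    rewrite /q eqxx; have [|uw] := eqVneq u w; first by rewrite subrr cm0 ltW.
    have u0 : u - w != 0 by rewrite subr_eq0.
    have := H u hu.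
    have -> : F u - F w - l * (u - w) = ((F u - F w) / (u - w) - l) * (u - w) by field.
    by rewrite cmM ler_pM2r ?cm_gt0.
  have : ccont (fun v => (F v - F w) / (v - w)) v.
    apply: ccontM; first by apply: ccontD; [exact: cF|exact: ccont_cst].
    by apply: ccontV; [exact: ccont_sub|rewrite subr_eq0].
  move=> h e e0; have [d d0 H] := h e e0.
  exists (Num.min d (cm (v - w))).
    by rewrite lt_min d0 cm_gt0 subr_eq0.
  move=> u; rewrite lt_min => /andP[h1 h2].
  rewrite /q (negbTE vw); have [uw|uw] := eqVneq u w; last exact: H.
  by move: h2; rewrite uw cmB ltxx.
have Iq : square_int q = 0.
  apply: (@goursat_except_point _ _ _ _ _ _ w cq); [apply/andP; split..|].
  - by rewrite /a1; lra.
  - by rewrite /a2; lra.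
  - by rewrite /b1; lra.
  - by rewrite /b2; lra.
  move=> v iv vw; have [l' hl'] := dF v iv.
  have v0 : v - w != 0 by rewrite subr_eq0.
  apply/derivable_cdiff.
  have : derivable ((fun u : C => (F u - F w) / (u - w)) : C^o -> C^o) v 1.
    apply: (@derivableM _ C^o (fun u => F u - F w) (fun u => (u - w)^-1)).
      by apply: derivableB; [apply/derivable_cdiff; exists l'|exact: derivable_cst].
    apply: derivableV; first exact: v0.
    by apply: derivableB; [exact: derivable_id|exact: derivable_cst].
  apply: near_eq_derivable.
  apply/nearP; exists (cm (v - w)); first by rewrite cm_gt0.
  move=> u hu; rewrite /q; case: eqVneq => // uw.
  by move: hu; rewrite uw cmB ltxx.
apply/eqP; rewrite eq_sym -subr_eq0; apply/eqP; rewrite -Iq /cauchyT /square_int.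
rewrite -mulNr -rect_intZ //; last by apply: lc_div1 hw; move=> v _; exact: ccont_cst.
rewrite -rect_intD //; last 2 first.
- by apply: lc_div1 hw; move=> v _; exact: cF.
- by apply: lcZ; apply: lc_div1 hw; move=> v _; exact: ccont_cst.
apply: eq_rect_int => v hv; have vw := onl_neq hv hw.
by rewrite /q -subr_eq0 (negbTE vw); field.
Qed.

End Cauchy.

(** * Local factorization of holomorphic functions *)

Section Factor.
Variable R : realType.
Local Notation C := (R[i]).
Implicit Types (F g k h : C -> C) (w z : C).

Lemma ccont_neq0 F z : ccont F z -> F z != 0 ->
  exists2 d : R, 0 < d & forall w, cm (w - z) < d -> F w != 0.
Proof.
move=> cF Fz; have e0 : 0 < cm (F z) / 2 by rewrite divr_gt0 ?cm_gt0.
have [d d0 H] := cF _ e0; exists d => // w hw.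
have := H w hw; have := cmBr (F z) (F w); rewrite cmB -cm_gt0 => h1 h2.
by lra.
Qed.

Lemma holomorphic_atP g z : holomorphic_at g z <->
  exists2 d : R, 0 < d & forall w, cm (w - z) < d -> exists l, cdiff g w l.
Proof.
split; first by move=> /nearP[d d0 H]; exists d => // w hw; apply/derivable_cdiff; exact: H.
by case=> d d0 H; apply/nearP; exists d => // w hw; apply/derivable_cdiff; exact: H.
Qed.

Lemma cdiff_eq F g z l (d : R) : 0 < d -> (forall w, cm (w - z) < d -> F w = g w) ->
  cdiff F z l -> cdiff g z l.
Proof.
move=> d0 E D e e0; have [d' d'0 H] := D e e0.
exists (Num.min d d'); first by rewrite lt_min d0.
move=> w; rewrite lt_min => /andP[h1 h2].
by rewrite -!E ?subrr ?cm0 //; exact: H.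
Qed.

(** Retraction of the line onto the interval of centre [c] and radius [s]. *)
Definition clampr (c s x : R) : R := Num.max (c - s) (Num.min (c + s) x).

Lemma clampr_lip c s x y : `|clampr c s x - clampr c s y| <= `|x - y|.
Proof.
have A (u v : R) : u - v <= `|u - v| /\ v - u <= `|u - v|.
  by split; [exact: ler_norm|rewrite distrC; exact: ler_norm].
have mx (a u v : R) : `|Num.max a u - Num.max a v| <= `|u - v|.
  have [A1 A2] := A u v; rewrite ler_norml /Num.max.
  by case: (ltP a u) => ?; case: (ltP a v) => ?; apply/andP; split; lra.
have mn (a u v : R) : `|Num.min a u - Num.min a v| <= `|u - v|.
  have [A1 A2] := A u v; rewrite ler_norml /Num.min.
  by case: (ltP a u) => ?; case: (ltP a v) => ?; apply/andP; split; lra.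
exact: le_trans (mx _ _ _) (mn _ _ _).
Qed.

Lemma clampr_in c s x : 0 <= s -> `|clampr c s x - c| <= s.
Proof.
move=> s0; rewrite /clampr /Num.max /Num.min ler_norml.
case: (ltP (c + s) x) => h; first by case: (ltP (c - s) (c + s)) => ?; apply/andP; split; lra.
by case: (ltP (c - s) x) => ?; apply/andP; split; lra.
Qed.

Lemma clampr_id c s x : `|x - c| < s -> clampr c s x = x.
Proof.
rewrite ltr_norml /clampr /Num.max /Num.min => /andP[h1 h2].
case: (ltP (c + s) x) => h; first by lra.
by case: (ltP (c - s) x) => ?; lra.
Qed.

(** Composing with this retraction onto a square extends a function that is
    holomorphic near [z] to a continuous function on the plane without changing it
    near [z]; boundary integrals ask for continuity on whole lines. *)
Definition clampc z (s : R) w : C :=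
  clampr (complex.Re z) s (complex.Re w) +i* clampr (complex.Im z) s (complex.Im w).

Lemma clampc_lip z s w v : cm (clampc z s w - clampc z s v) <= 2 * cm (w - v).
Proof.
apply: le_trans (cm_ReIm _) _; rewrite ReB ImB /=.
have := clampr_lip (complex.Re z) s (complex.Re w) (complex.Re v).
have := clampr_lip (complex.Im z) s (complex.Im w) (complex.Im v).
have := cm_Re (w - v); have := cm_Im (w - v); rewrite ReB ImB; lra.
Qed.

Lemma clampc_in z s w : 0 <= s -> cm (clampc z s w - z) <= 2 * s.
Proof.
move=> s0; apply: le_trans (cm_ReIm _) _; rewrite ReB ImB /=.
have := clampr_in (complex.Re z) (complex.Re w) s0.
have := clampr_in (complex.Im z) (complex.Im w) s0; lra.
Qed.

Lemma clampc_id z s w : `|complex.Re w - complex.Re z| < s ->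
  `|complex.Im w - complex.Im z| < s -> clampc z s w = w.
Proof. by move=> h1 h2; rewrite /clampc !clampr_id //; case: (w). Qed.

Lemma le_halving_eq0 (x A : R) : 0 <= x -> (forall p : nat, x <= A / 2 ^+ p) -> x = 0.
Proof.
move=> x0 H; apply/eqP; rewrite eq_le x0 andbT leNgt; apply/negP => xp.
have := H (Num.truncn (A / x)).+1; apply/negP; rewrite -ltNge.
rewrite ltr_pdivrMr ?exprn_gt0 // -ltr_pdivrMl // mulrC.
apply: lt_le_trans (truncnS_gt _) _; rewrite -natrX ler_nat.
exact/ltnW/ltn_expl.
Qed.

(** Up to the nonvanishing transform of 1, [g] is a Cauchy transform, which is
    expanded at [z]. If some Taylor coefficient is nonzero, the first such
    coefficient gives [p] and the remaining transform gives [h]; otherwise [g] is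
    equal to all its remainders, and these tend to 0. *)
Lemma holo_factor g z : holomorphic_at g z ->
  (exists2 d : R, 0 < d & forall w, cm (w - z) < d -> g w = 0) \/
  exists p h, [/\ holomorphic_at h z, h z != 0 &
    exists2 d : R, 0 < d & forall w, cm (w - z) < d -> g w = (w - z) ^+ p * h w].
Proof.
move=> /holomorphic_atP[rho rho0 dg].
(* Clamped points are at distance at most 4 r < rho from z. *)
pose r := rho / 5; have r0 : 0 < r by rewrite /r; lra.
pose F w := g (clampc z (2 * r) w).
have r2 : 0 <= 2 * r by lra.
have cF w : ccont F w.
  have [l hl] : exists l, cdiff g (clampc z (2 * r) w) l.
    by apply: dg; have := clampc_in z w r2; rewrite /r; lra.
  move=> e e0; have [d d0 H] := cdiff_ccont hl e0.
  exists (d / 2); first by lra.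
  by move=> v hv; apply: H; have := clampc_lip z (2 * r) v w; lra.
have Fg w : cm (w - z) < 2 * r -> F w = g w.
  move=> hw; rewrite /F clampc_id // -?ReB -?ImB.
    exact: le_lt_trans (cm_Re _) hw.
  exact: le_lt_trans (cm_Im _) hw.
have dF v : inrect (complex.Re z - r) (complex.Re z + r) (complex.Im z - r) (complex.Im z + r) v ->
    exists l, cdiff F v l.
  move=> [/andP[v1 v2] /andP[v3 v4]].
  have [l hl] : exists l, cdiff g v l.
    apply: dg; apply: le_lt_trans (cm_ReIm _) _; rewrite ReB ImB.
    have : `|complex.Re v - complex.Re z| <= r by rewrite ler_norml; apply/andP; split; lra.
    have : `|complex.Im v - complex.Im z| <= r by rewrite ler_norml; apply/andP; split; lra.
    by rewrite /r in r0 *; lra.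
  exists l; apply: cdiff_eq r0 _ hl => w hw.
  rewrite /F clampc_id // ltr_norml.
    by have := cm_Re (w - v); rewrite ReB ler_norml => /andP[? ?]; apply/andP; split; lra.
  by have := cm_Im (w - v); rewrite ImB ler_norml => /andP[? ?]; apply/andP; split; lra.
have CF w : cm (w - z) < r -> F w * cauchyT z r (fun=> 1) w = cauchyT z r F w.
  by move=> hw; apply: cauchy_formula.
pose kk p v := F v / (v - z) ^+ p.
have lk p : lcont (complex.Re z - r) (complex.Re z + r) (complex.Im z - r) (complex.Im z + r) (kk p).
  by apply: lc_div => //; exact: center_in_square.
have l1 : lcont (complex.Re z - r) (complex.Re z + r) (complex.Im z - r) (complex.Im z + r) (fun=> 1).
  by move=> v _; exact: ccont_cst.
have step p w : cm (w - z) < r ->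
    cauchyT z r (kk p) w = cauchyT z r (kk p) z + (w - z) * cauchyT z r (kk p.+1) w.
  move=> hw; have -> : kk p.+1 = fun v => kk p v / (v - z).
    by apply/funext => v; rewrite /kk exprSr invfM mulrA.
  exact: (@cauchyT_step _ z r r0 (kk p) w (lk p) hw).
(* Taylor expansion with remainder, the first p coefficients being 0. *)
have expand p w : cm (w - z) < r -> (forall j, (j < p)%N -> cauchyT z r (kk j) z = 0) ->
    cauchyT z r F w = (w - z) ^+ p * cauchyT z r (kk p) w.
  move=> hw; elim: p => [|p IH] H.
    have -> : kk 0%N = F by apply/funext => v; rewrite /kk expr0 invr1 mulr1.
    by rewrite expr0 mul1r.
  rewrite IH; last by move=> j hj; apply: H; rewrite ltnW.
  by rewrite step // H // add0r exprSr mulrA.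
have [dc [dc0 hdc]] : exists d : R, 0 < d /\ forall w, cm (w - z) < d -> cauchyT z r (fun=> 1) w != 0.
  have [l hl] := cauchyT_cdiff r0 l1 (center_in_square z r0).
  by have [d ? ?] := ccont_neq0 (cdiff_ccont hl) (cauchyT1_neq0 z r0); exists d.
have gE w : cm (w - z) < Num.min r dc ->
    g w = cauchyT z r F w / cauchyT z r (fun=> 1) w.
  rewrite lt_min => /andP[h1 h2]; rewrite -CF // mulfK ?hdc // Fg //; lra.
have m0 : 0 < Num.min r dc by rewrite lt_min r0.
have [[p hp]|none] := pselect (exists p, cauchyT z r (kk p) z != 0).
  right; have ex : exists p, cauchyT z r (kk p) z != 0 by exists p.
  case: (ex_minnP ex) => {hp}p hp pmin.
  exists p, (fun w => cauchyT z r (kk p) w / cauchyT z r (fun=> 1) w); split.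
  - apply/holomorphic_atP; exists (Num.min r dc); first exact: m0.
    move=> w; rewrite lt_min => /andP[h1 h2]; apply/derivable_cdiff.
    apply: (@derivableM _ C^o (cauchyT z r (kk p)) (fun w => (cauchyT z r (fun=> 1) w)^-1)).
      by apply/derivable_cdiff; exact: cauchyT_cdiff.
    apply: derivableV; first exact: hdc.
    by apply/derivable_cdiff; exact: cauchyT_cdiff.
  - by rewrite mulf_eq0 invr_eq0 negb_or hp /= hdc // subrr cm0.
  exists (Num.min r dc); first exact: m0.
  move=> w hw; have wr : cm (w - z) < r by move: hw; rewrite lt_min => /andP[].
  rewrite (gE w hw) mulrA -(expand p w wr); first by [].
  move=> j jp; apply/eqP; apply: contraTT jp => h.
  by rewrite -leqNgt; apply: pmin.
(* All Taylor coefficients vanish: at distance at most r / 2 the remainder of order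
   p is O(2^-p). *)
left; exists (Num.min (r / 2) dc); first by rewrite lt_min divr_gt0.
move=> w; rewrite lt_min => /andP[h1 h2].
have hw : cm (w - z) < r by lra.
rewrite gE ?lt_min ?hw //.
suff -> : cauchyT z r F w = 0 by rewrite mul0r.
have lF : lcont (complex.Re z - r) (complex.Re z + r) (complex.Im z - r) (complex.Im z + r) F.
  by move=> v _.
have ha : complex.Re z - r <= complex.Re z + r by lra.
have hb : complex.Im z - r <= complex.Im z + r by lra.
have [K K0 hK] := lcont_bounded ha hb lF.
apply/eqP; rewrite -cm_eq0; apply/eqP.
apply: (@le_halving_eq0 _ (4 * (K * (2 / r)) * (4 * r))) (cm_ge0 _) _ => p.
rewrite (@expand p) //; last first.
  by move=> j _; apply/eqP; apply/negP => /negP h; apply: none; exists j.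
have B : cm (cauchyT z r (kk p) w) <= 4 * (K / r ^+ p * (2 / r)) * (4 * r).
  have -> : 4 * r = complex.Re z + r - (complex.Re z - r) + (complex.Im z + r - (complex.Im z - r)).
    by ring.
  apply: (rect_int_bound ha hb); first exact: lc_div1.
  move=> v hv iv; rewrite !cmM; apply: ler_pM; rewrite ?mulr_ge0 ?cm_ge0 //.
    apply: ler_pM; rewrite ?cm_ge0 //; first exact: hK.
    rewrite cmV cmX lef_pV2 ?posrE ?exprn_gt0 //.
      by rewrite lerXn2r ?nnegrE ?cm_ge0 ?(ltW r0) //; exact: (onl_dist r0).
    exact: lt_le_trans (onl_dist r0 hv).
  have d1 : r / 2 <= cm (v - w).
    by have := @onl_dist2 _ z r r0 v w hv; lra.
  rewrite cmV (_ : 2 / r = (r / 2)^-1); last by field; rewrite gt_eqF.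
  rewrite lef_pV2 ?posrE ?divr_gt0 //.
  by apply: lt_le_trans d1; rewrite divr_gt0.
rewrite cmM cmX; apply: le_trans (_ : (r / 2) ^+ p * (4 * (K / r ^+ p * (2 / r)) * (4 * r)) <= _).
  apply: ler_pM; rewrite ?exprn_ge0 ?cm_ge0 //.
  by rewrite lerXn2r ?nnegrE ?cm_ge0 ?divr_ge0 ?(ltW r0) // ltW.
rewrite le_eqVlt; apply/orP; left; apply/eqP.
by rewrite expr_div_n; field; rewrite !gt_eqF ?exprn_gt0.
Qed.

End Factor.

(** * Meromorphic functions with values in the sphere *)

Section Sphere.
Variable R : realType.
Local Notation C := (R[i]).
Local Notation sphere := (option C).
Implicit Types (a b c d z w : C) (t : sphere) (f : C -> sphere) (g h : C -> C).

Lemma mobius_sph_div (W : 'M[C]_2) a b : (a, b) != (0, 0) ->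
  mobius W (sph_div a b) = sph_div (W ord0 ord0 * a + W ord0 ord_max * b)
    (W ord_max ord0 * a + W ord_max ord_max * b).
Proof.
rewrite xpair_eqE /sph_div; have [-> /=|b0 _ /=] := eqVneq b 0.
  rewrite andbT => a0; rewrite !mulr0 !addr0 /sph_div mulf_eq0 (negbTE a0) orbF.
  by case: eqP => // _; rewrite -mulf_div divff // mulr1.
rewrite /sph_div -[_ / b]/(a * b^-1).
have E (x y : C) : x * (a * b^-1) + y = (x * a + y * b) * b^-1 by field.
rewrite !E mulf_eq0 invr_eq0 (negbTE b0) orbF; case: eqP => // _.
by rewrite -mulf_div divff ?invr_eq0 // mulr1.
Qed.

Lemma sph_divE t : exists a b, (a, b) != (0, 0) /\ t = sph_div a b.
Proof.
case: t => [a|]; last by exists 1, 0; rewrite xpair_eqE oner_eq0 /sph_div eqxx.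
by exists a, 1; rewrite xpair_eqE oner_eq0 andbF /sph_div oner_eq0 divr1.
Qed.

(** A Moebius map with nonzero determinant maps homogeneous coordinates to
    homogeneous coordinates; this is what makes [mobiusM] hold at poles. *)
Definition mdet (W : 'M[C]_2) := W ord0 ord0 * W ord_max ord_max - W ord0 ord_max * W ord_max ord0.

Lemma mdet_pair (W : 'M[C]_2) a b : mdet W != 0 -> (a, b) != (0, 0) ->
  (W ord0 ord0 * a + W ord0 ord_max * b, W ord_max ord0 * a + W ord_max ord_max * b) != (0, 0).
Proof.
move=> W0; apply: contraNneq => -[e1 e2].
have h1 : mdet W * a = 0.
  have -> : mdet W * a = W ord_max ord_max * (W ord0 ord0 * a + W ord0 ord_max * b)
     - W ord0 ord_max * (W ord_max ord0 * a + W ord_max ord_max * b) by rewrite /mdet; ring.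
  by rewrite e1 e2 !mulr0 subrr.
have h2 : mdet W * b = 0.
  have -> : mdet W * b = W ord0 ord0 * (W ord_max ord0 * a + W ord_max ord_max * b)
     - W ord_max ord0 * (W ord0 ord0 * a + W ord0 ord_max * b) by rewrite /mdet; ring.
  by rewrite e1 e2 !mulr0 subrr.
by move/eqP: h1; move/eqP: h2; rewrite !mulf_eq0 (negbTE W0) /= => /eqP -> /eqP ->.
Qed.

Lemma mobiusM (A B : 'M[C]_2) t : mdet B != 0 -> mobius (A *m B) t = mobius A (mobius B t).
Proof.
move=> B0; have [a [b [ab ->]]] := sph_divE t.
rewrite !mobius_sph_div //; last exact: mdet_pair.
have E i j : (A *m B) i j = A i ord0 * B ord0 j + A i ord_max * B ord_max j.
  rewrite mxE big_ord_recl big_ord1; congr (_ + A i _ * B _ j); exact/val_inj.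
by rewrite !E; congr sph_div; ring.
Qed.

Lemma mx2E a b c d : [/\ mx2 a b c d ord0 ord0 = a, mx2 a b c d ord0 ord_max = b,
  mx2 a b c d ord_max ord0 = c & mx2 a b c d ord_max ord_max = d].
Proof. by split; rewrite mxE. Qed.

Lemma mobius_mx2 a b c d x y : (x, y) != (0, 0) ->
  mobius (mx2 a b c d) (sph_div x y) = sph_div (a * x + b * y) (c * x + d * y).
Proof. by move=> xy; rewrite mobius_sph_div //; have [-> -> -> ->] := mx2E a b c d. Qed.

Lemma mdet_mx2 a b c d : mdet (mx2 a b c d) = a * d - b * c.
Proof. by rewrite /mdet; have [-> -> -> ->] := mx2E a b c d. Qed.

Lemma hol_cst a z : holomorphic_at (fun=> a) z.
Proof.
apply/holomorphic_atP; exists 1 => // w _; apply/derivable_cdiff; exact: derivable_cst.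
Qed.

Lemma hol_id z : holomorphic_at id z.
Proof.
apply/holomorphic_atP; exists 1 => // w _; apply/derivable_cdiff; exact: derivable_id.
Qed.

Lemma holD g h z : holomorphic_at g z -> holomorphic_at h z ->
  holomorphic_at (fun w => g w + h w) z.
Proof.
move=> /holomorphic_atP[d d0 H] /holomorphic_atP[e e0 K]; apply/holomorphic_atP.
exists (Num.min d e); first by rewrite lt_min d0.
move=> w; rewrite lt_min => /andP[h1 h2]; apply/derivable_cdiff.
apply: derivableD; apply/derivable_cdiff; [exact: H|exact: K].
Qed.

Lemma holM g h z : holomorphic_at g z -> holomorphic_at h z ->
  holomorphic_at (fun w => g w * h w) z.
Proof.
move=> /holomorphic_atP[d d0 H] /holomorphic_atP[e e0 K]; apply/holomorphic_atP.
exists (Num.min d e); first by rewrite lt_min d0.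
move=> w; rewrite lt_min => /andP[h1 h2]; apply/derivable_cdiff.
apply: (@derivableM _ C^o g h); apply/derivable_cdiff; [exact: H|exact: K].
Qed.

Lemma hol_ccont g z : holomorphic_at g z -> ccont g z.
Proof.
move=> /holomorphic_atP[d d0 /(_ z)]; rewrite subrr cm0 => /(_ d0)[l].
exact: cdiff_ccont.
Qed.

Lemma holV g z : holomorphic_at g z -> g z != 0 -> holomorphic_at (fun w => (g w)^-1) z.
Proof.
move=> hg gz; have [e e0 K] := ccont_neq0 (hol_ccont hg) gz.
move: hg => /holomorphic_atP[d d0 H]; apply/holomorphic_atP.
exists (Num.min d e); first by rewrite lt_min d0.
move=> w; rewrite lt_min => /andP[h1 h2]; apply/derivable_cdiff.
apply: derivableV; first exact: K.
by apply/derivable_cdiff; exact: H.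
Qed.

Lemma holX g z n : holomorphic_at g z -> holomorphic_at (fun w => g w ^+ n) z.
Proof.
move=> hg; elim: n => [|n IH]; first exact: hol_cst.
rewrite (_ : (fun w => _) = fun w => g w * g w ^+ n); first exact: holM.
by apply/funext => w; rewrite exprS.
Qed.

Lemma hol_sub a z : holomorphic_at (fun w => w - a) z.
Proof. by apply: holD; [exact: hol_id|exact: hol_cst]. Qed.

Lemma hol_sum n (F : nat -> C -> C) z : (forall i, holomorphic_at (F i) z) ->
  holomorphic_at (fun w => \sum_(i < n) F i w) z.
Proof.
move=> H; elim: n => [|n IH].
  rewrite (_ : (fun w => _) = fun=> 0); first exact: hol_cst.
  by apply/funext => w; rewrite big_ord0.
rewrite (_ : (fun w => _) = fun w => \sum_(i < n) F i w + F n w).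
  by apply: holD; [exact: IH|exact: H].
by apply/funext => w; rewrite big_ord_recr.
Qed.

Lemma pevalE (p : {poly R}) w : peval p w = \sum_(i < size p) (p`_i)%:C * w ^+ i.
Proof.
rewrite /peval horner_coef size_map_poly.
by apply: eq_bigr => i _; rewrite coef_map.
Qed.

Lemma peval_hol (p : {poly R}) z : holomorphic_at (peval p) z.
Proof.
rewrite (_ : peval p = fun w => \sum_(i < size p) (p`_i)%:C * w ^+ i).
  apply: (@hol_sum _ (fun i w => (p`_i)%:C * w ^+ i)) => i.
  by apply: holM; [exact: hol_cst|apply: holX; exact: hol_id].
by apply/funext => w; rewrite pevalE.
Qed.

Definition locally_eq f z t := exists2 e : R, 0 < e & forall w, cm (w - z) < e -> f w = t.

(** The denominator may vanish identically, so that this class is stable under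
    Moebius maps; see [quot_mobius]. *)
Definition quot_at f z := exists a b : C -> C,
  [/\ holomorphic_at a z, holomorphic_at b z, (a z, b z) != (0, 0) &
   exists2 e : R, 0 < e & forall w, cm (w - z) < e -> f w = sph_div (a w) (b w)].

Lemma regular_quot f z : regular_at f z -> quot_at f z.
Proof.
case=> g hg /nearP[e e0 H]; exists g, (fun=> 1).
split; [exact: hg|exact: hol_cst|by rewrite xpair_eqE oner_eq0 andbF|].
by exists e => // w hw; rewrite H // /sph_div oner_eq0 divr1.
Qed.

Lemma pole_quot f z : pole_at f z -> quot_at f z.
Proof.
case=> fz [p [g [p0 hg gz /dnearP[e e0 H]]]].
exists g, (fun w => (w - z) ^+ p).
split; [exact: hg|by apply: holX; exact: hol_sub|by rewrite xpair_eqE (negbTE gz)|].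
exists e => // w hw; have [->|wz] := eqVneq w z.
  by rewrite fz /sph_div subrr expr0n eqn0Ngt p0 eqxx.
by rewrite H // /sph_div expf_eq0 p0 subr_eq0 (negbTE wz).
Qed.

Lemma regular_at_neq f z : regular_at f z -> f z != None.
Proof. by case=> g _ /nearP[e e0 /(_ z)]; rewrite subrr cm0 => /(_ e0) ->. Qed.

Lemma regular_not_loc f z : regular_at f z \/ pole_at f z -> ~ locally_eq f z None.
Proof.
case=> [/regular_at_neq h|]; first by case=> e e0 /(_ z); rewrite subrr cm0 => /(_ e0) fz; rewrite fz in h.
case=> fz [p [g [p0 hg gz /dnearP[e e0 H]]]] [d d0 K].
set m := Num.min d e / 2; have m0 : 0 < m by rewrite divr_gt0 ?lt_min ?d0.
have [md me] : m < d /\ m < e.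
  have : Num.min d e <= d by rewrite ge_min lexx.
  have : Num.min d e <= e by rewrite ge_min lexx orbT.
  by rewrite /m in m0 *; lra.
have mE : cm (z + m%:C - z) = m by rewrite addrAC subrr add0r cmR ger0_norm ?ltW.
have wz : z + m%:C != z by rewrite -subr_eq0 -cm_eq0 mE gt_eqF.
by have := H (z + m%:C); rewrite mE => /(_ me wz); rewrite K ?mE.
Qed.

(** If the denominator vanishes at [z], either it vanishes identically or its
    factorization exhibits the order of the pole. *)
Lemma quot_at_cases f z : quot_at f z -> locally_eq f z None \/
  (regular_at f z /\ f z != None) \/ pole_at f z.
Proof.
case=> a [b [ha hb ab [e e0 H]]].
have [bz|bz] := eqVneq (b z) 0; last first.
  right; left; have [d d0 K] := ccont_neq0 (hol_ccont hb) bz.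
  split; last by rewrite H ?subrr ?cm0 // /sph_div (negbTE bz).
  exists (fun w => a w * (b w)^-1); first by apply: holM; [exact: ha|exact: holV].
  apply/nearP; exists (Num.min d e); first by rewrite lt_min d0.
  by move=> w; rewrite lt_min => /andP[h1 h2]; rewrite H // /sph_div (negbTE (K w h1)).
have az : a z != 0 by move: ab; rewrite bz xpair_eqE eqxx andbT.
have [[d d0 K]|[p [h [hh hz [d d0 K]]]]] := holo_factor hb.
  left; exists (Num.min d e); first by rewrite lt_min d0.
  by move=> w; rewrite lt_min => /andP[h1 h2]; rewrite H // /sph_div K // eqxx.
right; right; split; first by rewrite H ?subrr ?cm0 // /sph_div bz eqxx.
have [r r0 hr] := ccont_neq0 (hol_ccont hh) hz.
exists p, (fun w => a w * (h w)^-1); split.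
- rewrite lt0n; apply: contraNneq hz => p0; have := K z.
  by rewrite subrr cm0 bz p0 expr0 mul1r => <- //.
- by apply: holM; [exact: ha|exact: holV].
- by rewrite mulf_eq0 invr_eq0 negb_or az.
apply/dnearP; exists (Num.min r (Num.min d e)); first by rewrite !lt_min r0 d0.
move=> w; rewrite !lt_min => /and3P[h0 h1 h2] wz; rewrite H // /sph_div K //.
have wz' : w - z != 0 by rewrite subr_eq0.
rewrite mulf_eq0 expf_eq0 (negbTE wz') andbF (negbTE (hr w h0)) /=.
by congr Some; rewrite invfM mulrA -mulrA [(w - z) ^- p * _]mulrC mulrA.
Qed.

Definition punctured f z (P : sphere -> Prop) := exists2 e : R, 0 < e & forall w,
  cm (w - z) < e -> w != z -> P (f w).

Lemma regpole_punctured f z : regular_at f z \/ pole_at f z -> punctured f z (fun t => t <> None).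
Proof.
case.
  case=> g _ /nearP[e e0 H]; exists e => // w hw _; by rewrite H.
by case=> _ [p [g [_ _ _ /dnearP[e e0 H]]]]; exists e => // w hw wz; rewrite H.
Qed.

Lemma quot_punctured f z : quot_at f z -> locally_eq f z None \/ punctured f z (fun t => t <> None).
Proof.
move=> /quot_at_cases[h|h]; [by left|right].
by apply: regpole_punctured; case: h => [[]|]; [left|right].
Qed.

Lemma punctured_not_locally f z t : punctured f z (fun u => u <> t) -> ~ locally_eq f z t.
Proof.
move=> [e e0 H] [d d0 K].
set m := Num.min d e / 2; have m0 : 0 < m by rewrite divr_gt0 ?lt_min ?d0.
have [md me] : m < d /\ m < e.
  have : Num.min d e <= d by rewrite ge_min lexx.
  have : Num.min d e <= e by rewrite ge_min lexx orbT.
  by rewrite /m in m0 *; lra.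
have mE : cm (z + m%:C - z) = m by rewrite addrAC subrr add0r cmR ger0_norm ?ltW.
have wz : z + m%:C != z by rewrite -subr_eq0 -cm_eq0 mE gt_eqF.
by apply: (H (z + m%:C)); rewrite ?mE // K ?mE.
Qed.

Lemma locally_eq_near f z t : locally_eq f z t -> exists2 e : R, 0 < e &
  forall w, cm (w - z) < e -> locally_eq f w t.
Proof.
case=> e e0 H; exists (e / 2); first by rewrite divr_gt0.
move=> w hw; exists (e / 2); first by rewrite divr_gt0.
by move=> v hv; apply: H; have := cmD3 v w z; lra.
Qed.

(** The identity theorem along a segment: being locally infinite is an open
    condition, and it is also closed because near any point a quotient is either
    identically infinite or finite away from that point. *)
Lemma locally_None_segment f z0 z1 :
  (forall s : R, 0 <= s <= 1 -> quot_at f (z0 + s%:C * (z1 - z0))) ->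
  locally_eq f z0 None -> locally_eq f z1 None.
Proof.
move=> Q h0; have [->//|z01] := eqVneq z1 z0.
pose g (s : R) := z0 + s%:C * (z1 - z0).
set L := cm (z1 - z0); have L0 : 0 < L by rewrite cm_gt0 subr_eq0.
have gd s u : cm (g s - g u) = `|s - u| * L.
  have -> : g s - g u = (s - u)%:C * (z1 - z0) by rewrite /g rmorphB /=; ring.
  by rewrite cmM cmR.
(* The supremum of S is attained and equal to 1. *)
pose S := [set s : R | 0 <= s <= 1 /\ forall u, 0 <= u <= s -> locally_eq f (g u) None].
have S0 : S 0.
  split=> [|u]; first by rewrite lexx ler01.
  by move=> h; rewrite (_ : u = 0); [rewrite /g mul0r addr0|lra].
have hS : has_sup S by split; [exists 0|exists 1 => s [/andP[]]].
set T := sup S.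
have T0 : 0 <= T by apply: ub_le_sup => //; exact: hS.2.
have T1 : T <= 1 by apply: ge_sup; [exact: hS.1|move=> s [/andP[]]].
have below u : 0 <= u -> u < T -> locally_eq f (g u) None.
  move=> u0 uT; have Tu : 0 < T - u by rewrite subr_gt0.
  have [s [s01 hs]] := sup_adherent Tu hS; rewrite -/T => us.
  by apply: hs; rewrite u0 /=; lra.
have hT : quot_at f (g T) by apply: Q; rewrite T0.
have {hT}[/locally_eq_near[e e0 H]|] := quot_punctured hT; last first.
  move=> [e e0 H]; exfalso; have [Tz|Tp] := leP T 0.
    have ET : T = 0 by apply/eqP; rewrite eq_le Tz.
    have E0 : g T = z0 by rewrite ET /g mul0r addr0.
    by apply: punctured_not_locally h0; exists e => // w; rewrite -E0; exact: H.
  pose u := Num.max 0 (T - e / (2 * L)).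
  have eL : 0 < e / (2 * L) by rewrite divr_gt0 ?mulr_gt0.
  have u0 : 0 <= u by rewrite le_max lexx.
  have uT : u < T by rewrite gt_max Tp /=; lra.
  have uT' : T - u <= e / (2 * L) by rewrite lerBlDr -lerBlDl le_max lexx orbT.
  have [d d0 /(_ (g u))] := below u u0 uT; rewrite subrr cm0 => /(_ d0).
  apply: H.
    rewrite gd distrC ger0_norm ?subr_ge0 ?(ltW uT) //.
    apply: le_lt_trans (_ : e / (2 * L) * L < e); first by rewrite ler_wpM2r ?(ltW L0).
    by rewrite invfM mulrA divfK ?gt_eqF // ltr_pdivrMr // ltr_pMr // ltr1n.
  by rewrite -subr_eq0 -cm_eq0 gd mulf_neq0 ?gt_eqF // normr_gt0 subr_eq0 lt_eqF.
have [Tl|Tg] := ltP T 1; last first.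
  have E1 : g T = z1.
    by rewrite (_ : T = 1); [rewrite /g mul1r addrC subrK|lra].
  by rewrite -E1; apply: H; rewrite subrr cm0.
exfalso; pose s := Num.min 1 (T + e / (2 * L)).
have eL : 0 < e / (2 * L) by rewrite divr_gt0 ?mulr_gt0.
have sT : T < s by rewrite lt_min Tl /=; lra.
have s1 : s <= 1 by rewrite ge_min lexx.
have s2 : s <= T + e / (2 * L) by rewrite ge_min lexx orbT.
suff Ss : S s by have := ub_le_sup hS.2 Ss; rewrite -/T; lra.
split; first by lra.
move=> u /andP[u0 us]; have [uT|Tu] := ltP u T; first exact: below.
apply: H; rewrite gd ger0_norm ?subr_ge0 //.
apply: le_lt_trans (_ : e / (2 * L) * L < e); first by rewrite ler_wpM2r ?(ltW L0) //; lra.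
by rewrite invfM mulrA divfK ?gt_eqF // ltr_pdivrMr // ltr_pMr // ltr1n.
Qed.

Lemma upper_segment z0 z1 (s : R) : upper z0 -> upper z1 -> 0 <= s <= 1 ->
  upper (z0 + s%:C * (z1 - z0)).
Proof.
rewrite /upper => h0 h1 /andP[s0 s1].
rewrite ImD ImM ImB /= mul0r addr0.
have [->|sp] := eqVneq s 0; first by rewrite mul0r addr0.
have : 0 < s by rewrite lt_def sp.
move=> sp'; have : 0 < s * complex.Im z1 by rewrite mulr_gt0.
have : 0 <= (1 - s) * complex.Im z0 by rewrite mulr_ge0 ?subr_ge0 // ltW.
nra.
Qed.

End Sphere.

(** * Negative squares of hermitian forms *)

Section Inertia.
Variable R : realType.
Local Notation C := (R[i]).

Definition adj m n (A : 'M[C]_(m, n)) : 'M[C]_(n, m) := map_mx (@conjc R) A^T.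

Lemma adjE m n (A : 'M[C]_(m, n)) i j : adj A i j = (A j i)^*.
Proof. by rewrite !mxE. Qed.

Lemma adjM m n p (A : 'M[C]_(m, n)) (B : 'M[C]_(n, p)) : adj (A *m B) = adj B *m adj A.
Proof. by rewrite /adj trmx_mul map_mxM. Qed.

Lemma adjK m n (A : 'M[C]_(m, n)) : adj (adj A) = A.
Proof. by apply/matrixP => i j; rewrite !mxE conjcK. Qed.

Lemma adjD m n (A B : 'M[C]_(m, n)) : adj (A + B) = adj A + adj B.
Proof. by apply/matrixP => i j; rewrite !mxE rmorphD. Qed.

Lemma adjN m n (A : 'M[C]_(m, n)) : adj (- A) = - adj A.
Proof. by apply/matrixP => i j; rewrite !mxE rmorphN. Qed.

Lemma adj0 m n : adj (0 : 'M[C]_(m, n)) = 0.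
Proof. by apply/matrixP => i j; rewrite !mxE rmorph0. Qed.

Lemma adj1 n : adj (1%:M : 'M[C]_n) = 1%:M.
Proof. by apply/matrixP => i j; rewrite !mxE eq_sym rmorph_nat. Qed.

Lemma adj_col m1 m2 n (A : 'M[C]_(m1, n)) (B : 'M[C]_(m2, n)) :
  adj (col_mx A B) = row_mx (adj A) (adj B).
Proof. by rewrite /adj tr_col_mx map_row_mx. Qed.

Lemma adj_row m n1 n2 (A : 'M[C]_(m, n1)) (B : 'M[C]_(m, n2)) :
  adj (row_mx A B) = col_mx (adj A) (adj B).
Proof. by rewrite /adj tr_row_mx map_col_mx. Qed.

Lemma adj_block m1 m2 n1 n2 (A : 'M[C]_(m1, n1)) (B : 'M[C]_(m1, n2)) (D : 'M[C]_(m2, n1)) (E : 'M[C]_(m2, n2)) :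
  adj (block_mx A B D E) = block_mx (adj A) (adj D) (adj B) (adj E).
Proof. by rewrite /adj tr_block_mx map_block_mx. Qed.

Definition herm n (H : 'M[C]_n) := adj H = H.

Definition hform n (H : 'M[C]_n) (x : 'rV[C]_n) : C := (x *m H *m adj x) 0 0.

Lemma hformE n (H : 'M[C]_n) x :
  hform H x = \sum_i \sum_j H i j * x ord0 i * (x ord0 j)^*.
Proof.
rewrite /hform mxE; under eq_bigr do rewrite mxE big_distrl /=.
rewrite exchange_big; apply: eq_bigr => i _; apply: eq_bigr => j _.
by rewrite !mxE; rewrite [x _ i * _]mulrC.
Qed.

Lemma hform_congr m n (H : 'M[C]_n) (X : 'M[C]_(m, n)) x :
  hform (X *m H *m adj X) x = hform H (x *m X).
Proof. by rewrite /hform adjM !mulmxA. Qed.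

Lemma hformD n (A B : 'M[C]_n) x : hform (A + B) x = hform A x + hform B x.
Proof. by rewrite /hform mulmxDr mulmxDl mxE. Qed.

Lemma herm_congr m n (H : 'M[C]_n) (X : 'M[C]_(m, n)) : herm H -> herm (X *m H *m adj X).
Proof. by move=> hH; rewrite /herm !adjM adjK hH mulmxA. Qed.

Definition negdef n (G : 'M[C]_n) := forall x, x != 0 -> hform G x < 0.

(** A subspace of dimension [q] on which the form is negative definite. Unlike a
    diagonalization, such a subspace survives small perturbations of the form, so
    the index is computed as the largest [q]. *)
Definition negdim n (H : 'M[C]_n) q := exists X : 'M[C]_(q, n), negdef (X *m H *m adj X).

Lemma negdim_congr m n (H : 'M[C]_n) (Y : 'M[C]_(m, n)) q :
  negdim (Y *m H *m adj Y) q -> negdim H q.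
Proof.
case=> X hX; exists (X *m Y) => x x0; rewrite adjM.
by have := hX x x0; rewrite !mulmxA.
Qed.

Lemma negdim0 n (H : 'M[C]_n) : negdim H 0.
Proof. by exists 0 => x; rewrite thinmx0 eqxx. Qed.

Lemma exists_in_kernel (K : fieldType) m n (Z : 'M[K]_(m, n)) : (n < m)%N ->
  exists2 x : 'rV_m, x != 0 & x *m Z = 0.
Proof.
move=> nm; have : kermx Z != 0.
  by rewrite -mxrank_eq0 mxrank_ker subn_eq0 -ltnNge; apply: leq_ltn_trans nm; exact: rank_leq_col.
move=> h; exists (nz_row (kermx Z)); first by rewrite nz_row_eq0.
by apply/sub_kermxP; exact: nz_row_sub.
Qed.

Lemma sqnorm_ge0 (z : C) : 0 <= `|z| ^+ 2. Proof. exact: exprn_ge0. Qed.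

Definition dform n (d : 'I_n -> R) (y : 'rV[C]_n) : C := \sum_p (d p)%:C * `|y ord0 p| ^+ 2.

Definition diagonalizes n (H : 'M[C]_n) (P : 'M[C]_n) (d : 'I_n -> R) :=
  P \in unitmx /\ forall x, hform H x = dform d (x *m P).

Lemma hnsP n (H : 'M[C]_n) q : has_negative_squares H q <->
  exists P d, diagonalizes H P d /\ #|[set p : 'I_n | d p < 0]%SET| = q.
Proof.
split; case=> P [d].
  by case=> uP h c; exists P, d; split=> //; split=> // x; rewrite hformE h.
by case=> -[uP h] c; exists P, d; split=> // x; rewrite -hformE h.
Qed.

Definition negidx n (d : 'I_n -> R) := [set p : 'I_n | d p < 0]%SET.

Lemma card_negidx n (d : 'I_n -> R) : #|negidx d| = (\sum_i (d i < 0)%R)%N.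
Proof.
rewrite -sum1_card big_mkcond; apply: eq_bigr => i _.
by rewrite inE; case: (d i < 0).
Qed.

(** The coordinates with a negative coefficient; where they vanish, the form is
    nonnegative. *)
Definition negcols n (d : 'I_n -> R) (P : 'M[C]_n) : 'M[C]_(n, #|negidx d|) :=
  colsub (fun k => enum_val k) P.

Lemma dform_ge0 n (d : 'I_n -> R) (P : 'M[C]_n) (y : 'rV[C]_n) :
  y *m negcols d P = 0 -> 0 <= dform d (y *m P).
Proof.
move=> h; apply: sumr_ge0 => p _; have [dp|dp] := ltP (d p) 0; last first.
  by rewrite mulr_ge0 ?sqnorm_ge0 // ler0c.
suff -> : (y *m P) ord0 p = 0 by rewrite normr0 expr0n mulr0.
have pn : p \in negidx d by rewrite inE.
have /rowP/(_ (enum_rank_in pn p)) := h; rewrite !mxE => {2}<-.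
by apply: eq_bigr => k _; rewrite mxE enum_rankK_in.
Qed.

(** A negative definite subspace of larger dimension would contain a nonzero
    vector all of whose negative coordinates vanish. *)
Lemma diag_negdim_le n (H : 'M[C]_n) P d q : diagonalizes H P d ->
  negdim H q -> (q <= #|negidx d|)%N.
Proof.
move=> [uP hP] [X hX]; rewrite leqNgt; apply/negP => /exists_in_kernel.
move=> /(_ _ (X *m negcols d P))[x x0 hx].
have := hX x x0; rewrite hform_congr hP => hlt.
have : 0 <= dform d (x *m X *m P) by apply: dform_ge0; rewrite -mulmxA.
by move=> /le_lt_trans /(_ hlt); rewrite ltxx.
Qed.

Lemma diag_negdim n (H : 'M[C]_n) P d : diagonalizes H P d -> negdim H #|negidx d|.
Proof.
move=> [uP hP]; exists (rowsub (fun k : 'I_#|negidx d| => enum_val k) (invmx P)) => x x0.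
rewrite hform_congr hP -mulmxA.
have -> : rowsub (fun k : 'I_#|negidx d| => enum_val k) (invmx P) *m P =
   rowsub (fun k => enum_val k) 1%:M by rewrite -(mulVmx uP) mul_rowsub_mx.
set y := x *m _.
have yN k : y ord0 (enum_val k) = x ord0 k.
  rewrite !mxE (bigD1 k) //= !mxE eqxx mulr1 big1 ?addr0 // => j jk.
  by rewrite !mxE (inj_eq enum_val_inj) (negbTE jk) mulr0.
have yP p : p \notin negidx d -> y ord0 p = 0.
  move=> pn; rewrite mxE big1 // => k _; rewrite !mxE.
  case: eqP => [kp|]; last by rewrite mulr0.
  by move: pn; rewrite -kp enum_valP.
rewrite /dform (bigID (mem (negidx d))) /= [X in _ + X]big1 ?addr0; last first.
  by move=> p pn; rewrite yP // normr0 expr0n mulr0.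
have [k xk] : exists k, x ord0 k != 0.
  apply/existsP; apply: contraR x0 => /existsPn h.
  by apply/eqP/rowP => k; rewrite mxE; apply/eqP; move: (h k); rewrite negbK.
rewrite (bigD1 (enum_val k)) ?enum_valP //=.
apply: ltr_wnDr.
  apply: sumr_le0 => p /andP[pn _]; rewrite mulr_le0_ge0 ?sqnorm_ge0 //.
  by move: pn; rewrite inE => /ltW; rewrite -lecR.
rewrite yN nmulr_rlt0 ?exprn_gt0 ?normr_gt0 //.
by have := enum_valP k; rewrite inE -ltcR.
Qed.

(** The law of inertia. *)
Lemma has_negative_squares_max n (H : 'M[C]_n) q : has_negative_squares H q ->
  negdim H q /\ forall p, negdim H p -> (p <= q)%N.
Proof.
move=> /hnsP[P [d [dH <-]]]; split; first exact: diag_negdim dH.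
by move=> p; exact: (diag_negdim_le dH).
Qed.

Lemma hns_uniq n (H : 'M[C]_n) p q :
  has_negative_squares H p -> has_negative_squares H q -> p = q.
Proof.
move=> /has_negative_squares_max[a1 b1] /has_negative_squares_max[a2 b2].
by apply/eqP; rewrite eqn_leq b1 // b2.
Qed.

Lemma herm_spectral n (H : 'M[C]_n) : herm H -> exists (P : 'M[C]_n) (d : 'I_n -> R),
  [/\ diagonalizes H P d, P *m adj P = 1%:M & char_poly H = \prod_i ('X - (d i)%:C%:P)].
Proof.
move=> hH.
have Hh : H \is hermsymmx.
  by rewrite is_hermitianmxE expr0 scale1r -{1}hH.
have hn := hermitian_normalmx Hh.
have E := orthomx_spectralP hn.
have sr := hermitian_spectral_diag_real Hh.
set P := spectralmx H in E; set D := spectral_diag H in E sr.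
have uP : P \in unitmx by exact: spectral_unit.
have iP : invmx P = adj P by exact/invmx_unitary/spectral_unitarymx.
exists (adj P), (fun i => complex.Re (D 0 i)).
have DE i : D 0 i = (complex.Re (D 0 i))%:C.
  by have /mxOverP/(_ 0 i)/complex_realP[k ->] := sr.
split; [|by rewrite adjK -iP mulVmx|].
  split; first by rewrite -iP unitmx_inv.
  move=> x; rewrite {1}E iP /hform /dform !mulmxA.
  rewrite -[x *m _ *m _ *m _ *m _]mulmxA.
  have -> : P *m adj x = adj (x *m adj P) by rewrite adjM adjK.
  move: (x *m adj P) => y.
  rewrite mxE; apply: eq_bigr => i _.
  rewrite mul_mx_diag !mxE -DE sqr_normc mulrAC [RHS]mulrC.
  by [].
rewrite /char_poly.
have -> : char_poly_mx H = map_mx polyC (invmx P) *m char_poly_mx (diag_mx D) *m map_mx polyC P.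
  rewrite /char_poly_mx {1}E mulmxBr mulmxBl !map_mxM; congr (_ - _).
  by rewrite -mulmxA -scalar_mxC mulmxA -map_mxM mulVmx // map_mx1 mul1mx.
rewrite !det_mulmx mulrAC -det_mulmx -map_mxM mulVmx // map_mx1 det1 mul1r.
rewrite -/(char_poly _) char_poly_trig ?diag_mx_is_trig //.
by apply: eq_bigr => i _; rewrite !mxE eqxx mulr1n -DE.
Qed.

Lemma herm_hns n (H : 'M[C]_n) : herm H -> exists q, has_negative_squares H q.
Proof.
move=> /herm_spectral[P [d [dH _ _]]].
by exists #|negidx d|; apply/hnsP; exists P, d.
Qed.

Lemma hns_maxP n (H : 'M[C]_n) q : herm H -> negdim H q ->
  (forall p, negdim H p -> (p <= q)%N) -> has_negative_squares H q.
Proof.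
move=> /herm_hns[r hr] h1 h2; have [r1 r2] := has_negative_squares_max hr.
by have -> : q = r by apply/eqP; rewrite eqn_leq h2 // r2.
Qed.

Lemma hns_congr n (H X : 'M[C]_n) q : X \in unitmx ->
  has_negative_squares H q -> has_negative_squares (X *m H *m adj X) q.
Proof.
move=> uX /hnsP[P [d [[uP hP] <-]]]; apply/hnsP; exists (X *m P), d; split=> //.
split; first by rewrite unitmx_mul uX.
by move=> x; rewrite hform_congr hP mulmxA.
Qed.

Lemma hns_block m n (A : 'M[C]_m) (B : 'M[C]_n) p q :
  has_negative_squares A p -> has_negative_squares B q ->
  has_negative_squares (block_mx A 0 0 B) (p + q).
Proof.
move=> /hnsP[P [d [[uP hP] <-]]] /hnsP[Q [e [[uQ hQ] <-]]]; apply/hnsP.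
exists (block_mx P 0 0 Q), (fun i => match fintype.split i with inl a => d a | inr b => e b end).
split.
  split; first by rewrite unitmxE det_ublock unitrM -!unitmxE uP.
  move=> x; rewrite -[x]hsubmxK.
  rewrite /hform /dform mul_row_block adj_row mul_row_block !mulmx0 !addr0 !add0r.
  rewrite mul_row_col mxE -/(hform A _) -/(hform B _) hP hQ big_split_ord /=.
  by congr (_ + _); apply: eq_bigr => i _;
    rewrite ?row_mxEl ?row_mxEr ?(unsplitK (inl i)) ?(unsplitK (inr i)).
rewrite -!/(negidx _) !card_negidx big_split_ord /=.
by congr (_ + _)%N; apply: eq_bigr => i _;
  rewrite ?(unsplitK (inl i)) ?(unsplitK (inr i)).
Qed.

(** A subspace of dimension larger than [a + b] contains a nonzero vector
    killed by the negative coordinates of both forms. *)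
Lemma negdim_add n (A B : 'M[C]_n) a b r : herm A -> herm B ->
  (forall q, negdim A q -> (q <= a)%N) -> (forall q, negdim B q -> (q <= b)%N) ->
  negdim (A + B) r -> (r <= a + b)%N.
Proof.
move=> /herm_spectral[P [d [dA _ _]]] /herm_spectral[Q [e [dB _ _]]] ha hb [X hX].
apply: leq_trans (leq_add (ha _ (diag_negdim dA)) (hb _ (diag_negdim dB))).
rewrite leqNgt; apply/negP => /exists_in_kernel.
move=> /(_ _ (X *m row_mx (negcols d P) (negcols e Q)))[x x0 hx].
have := hX x x0; rewrite hform_congr hformD => hlt.
rewrite mulmxA mul_mx_row in hx.
have := congr1 lsubmx hx; have := congr1 rsubmx hx.
rewrite row_mxKl row_mxKr linear0 linear0 => hB hA.
have : 0 <= hform A (x *m X) + hform B (x *m X).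
  by rewrite dA.2 dB.2 addr_ge0 // dform_ge0.
by move=> /le_lt_trans /(_ hlt); rewrite ltxx.
Qed.

Lemma hform_block m n (A : 'M[C]_m) (B : 'M[C]_n) x :
  hform (block_mx A 0 0 B) x = hform A (lsubmx x) + hform B (rsubmx x).
Proof.
rewrite -{1}[x]hsubmxK /hform mul_row_block adj_row mul_row_col !mulmx0 addr0 add0r.
by rewrite [LHS]mxE.
Qed.

Lemma hform0r n (H : 'M[C]_n) : hform H 0 = 0.
Proof. by rewrite /hform !mul0mx mxE. Qed.

Lemma negdef_block m n (A : 'M[C]_m) (B : 'M[C]_n) : negdef A -> negdef B ->
  negdef (block_mx A 0 0 B).
Proof.
move=> nA nB x x0; rewrite hform_block.
have [l0|l0] := eqVneq (lsubmx x) 0.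
  have r0 : rsubmx x != 0.
    by apply: contraNneq x0 => r0; rewrite -[x]hsubmxK l0 r0 row_mx0.
  by rewrite l0 hform0r add0r; exact: nB.
have [r0|r0] := eqVneq (rsubmx x) 0; first by rewrite r0 hform0r addr0; exact: nA.
by rewrite -[0]addr0; apply: ltrD; [exact: nA|exact: nB].
Qed.

Definition sqn n (x : 'rV[C]_n) : R := \sum_i cm (x ord0 i) ^+ 2.

Lemma sqnE n (x : 'rV[C]_n) : (sqn x)%:C = (x *m adj x) 0 0.
Proof.
rewrite mxE /sqn rmorph_sum; apply: eq_bigr => i _.
by rewrite !mxE -sqr_normc cmE rmorphXn.
Qed.

Lemma sqn_gt0 n (x : 'rV[C]_n) : x != 0 -> 0 < sqn x.
Proof.
move=> x0; have [k xk] : exists k, x ord0 k != 0.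
  apply/existsP; apply: contraR x0 => /existsPn h.
  by apply/eqP/rowP => k; rewrite mxE; apply/eqP; move: (h k); rewrite negbK.
rewrite /sqn (bigD1 k) //= ltr_wpDr ?exprn_gt0 ?cm_gt0 //.
by apply: sumr_ge0 => i _; rewrite exprn_ge0 ?cm_ge0.
Qed.

Lemma negdef_gap q (G : 'M[C]_q) : herm G -> negdef G ->
  exists2 c : R, 0 < c & forall x, hform G x <= (- c * sqn x)%:C.
Proof.
move=> /herm_spectral[P [d [[uP hP] PP _]]] nG.
have dn p : d p < 0.
  rewrite -ltcR; set x : 'rV[C]_q := delta_mx 0 p *m invmx P.
  have xP : x *m P = delta_mx 0 p by rewrite /x mulmxKV.
  have x0 : x != 0.
    apply: contra_eqN xP => /eqP ->; rewrite mul0mx; apply/eqP => /matrixP/(_ 0 p)/eqP.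
    by rewrite !mxE !eqxx eq_sym oner_eq0.
  have := nG x x0; rewrite hP xP /dform (bigD1 p) //= big1 ?addr0; last first.
    by move=> i ip; rewrite mxE (negbTE ip) andbF normr0 expr0n mulr0.
  by rewrite mxE !eqxx normr1 expr1n mulr1.
exists (\big[Num.min/1]_p (- d p)).
  by apply: lt_bigmin => // p _; rewrite oppr_gt0.
move=> x; have -> : sqn x = sqn (x *m P).
  apply: complexI; rewrite !sqnE adjM.
  by rewrite mulmxA -[x *m P *m _]mulmxA PP mulmx1.
rewrite hP /dform /sqn mulr_sumr rmorph_sum /=; apply: ler_sum => p _.
rewrite cmE -rmorphXn -rmorphM lecR ler_wpM2r ?exprn_ge0 ?cm_ge0 //.
by rewrite lerNr; apply: bigmin_le_cond.
Qed.

Lemma herm_form_le n (E : 'M[C]_n) x : herm E -> hform E x <= (cm (hform E x))%:C.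
Proof.
move=> hE; have : (hform E x)^* = hform E x.
  by rewrite /hform -adjE !adjM adjK hE mulmxA.
case: (hform E x) => a b [/eqP]; rewrite eq_sym -subr_eq0 opprK -mulr2n mulrn_eq0 /= => /eqP ->.
by rewrite complexr0 lecR cmR ler_norm.
Qed.

Lemma hform_bound n (E : 'M[C]_n) x e : (forall i j, cm (E i j) <= e) ->
  cm (hform E x) <= e * n%:R * sqn x.
Proof.
case: n E x => [|n] E x he.
  by rewrite hformE big_ord0 cm0 /sqn big_ord0 mulr0.
have e0 : 0 <= e := le_trans (cm_ge0 _) (he 0 0).
rewrite hformE; apply: le_trans (cm_sum _ _ _) _.
apply: le_trans (_ : \sum_i \sum_j e / 2 * (cm (x ord0 i) ^+ 2 + cm (x ord0 j) ^+ 2) <= _).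
  apply: ler_sum => i _; apply: le_trans (cm_sum _ _ _) _; apply: ler_sum => j _.
  rewrite !cmM cmJ -mulrA; apply: le_trans (_ : e * (cm (x ord0 i) * cm (x ord0 j)) <= _).
    by rewrite ler_wpM2r ?mulr_ge0 ?cm_ge0.
  have : 0 <= e * (cm (x ord0 i) - cm (x ord0 j)) ^+ 2 by rewrite mulr_ge0 ?sqr_ge0.
  by rewrite sqrrB; lra.
have -> : \sum_i \sum_j e / 2 * (cm (x ord0 i) ^+ 2 + cm (x ord0 j) ^+ 2) =
   e / 2 * (n.+1%:R * sqn x + n.+1%:R * sqn x).
  transitivity (\sum_i e / 2 * (n.+1%:R * cm (x ord0 i) ^+ 2 + sqn x)).
    apply: eq_bigr => i _; rewrite -mulr_sumr big_split /= sumr_const card_ord.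
    by rewrite -[_ ^+ 2 *+ _]mulr_natl.
  by rewrite -mulr_sumr big_split /= -mulr_sumr sumr_const card_ord -[sqn x *+ _]mulr_natl.
lra.
Qed.

(** A negative definite form stays below a negative multiple of the squared
    norm, which leaves room for a perturbation. *)
Lemma negdef_open q (G : 'M[C]_q) : herm G -> negdef G -> exists2 e : R, 0 < e &
  forall G', herm G' -> (forall i j, cm (G' i j - G i j) <= e) -> negdef G'.
Proof.
move=> hG nG; have [c c0 hc] := negdef_gap hG nG.
have q1 : 0 < (q%:R + 1 : R) by rewrite ltr_wpDl.
exists (c / 2 / (q%:R + 1)); first by rewrite !divr_gt0.
move=> G' hG' hE x x0; have s0 := sqn_gt0 x0.
have -> : G' = G + (G' - G) by rewrite subrKC.
rewrite hformD; have hE' : herm (G' - G) by rewrite /herm adjD adjN hG hG'.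
apply: le_lt_trans (lerD (hc x) (herm_form_le x hE')) _.
have := @hform_bound _ (G' - G) x (c / 2 / (q%:R + 1)) => hb.
have {}hb : cm (hform (G' - G) x) <= c / 2 / (q%:R + 1) * q%:R * sqn x.
  by apply: hb => i j; have := hE i j; rewrite !mxE.
rewrite -rmorphD /= -[0]/(0%:C) ltcR.
apply: le_lt_trans (_ : - c * sqn x + c / 2 * sqn x < 0); last by nra.
rewrite lerD2l; apply: le_trans hb _; rewrite ler_wpM2r ?(ltW s0) //.
rewrite -mulrA ler_piMr ?divr_ge0 ?(ltW c0) // mulrC ler_pdivrMr // mul1r lerDl.
by [].
Qed.

Lemma negdim_open n (H : 'M[C]_n) q : herm H -> negdim H q -> exists2 e : R, 0 < e &
  forall H', herm H' -> (forall i j, cm (H' i j - H i j) <= e) -> negdim H' q.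
Proof.
move=> hH [X nX]; have [c c0 hc] := negdef_open (herm_congr X hH) nX.
pose K : R := \sum_a \sum_i cm (X a i).
have K0 : 0 <= K by apply: sumr_ge0 => a _; apply: sumr_ge0 => i _; exact: cm_ge0.
have rowK a : \sum_i cm (X a i) <= K.
  rewrite /K [leRHS](bigD1 a) //= lerDl; apply: sumr_ge0 => b _; apply: sumr_ge0 => i _.
  exact: cm_ge0.
exists (c / (K * K + 1)); first by rewrite divr_gt0 // ltr_wpDl ?mulr_ge0.
move=> H' hH' hE; exists X; apply: hc; first exact: herm_congr.
move=> a b; have -> : (X *m H' *m adj X) a b - (X *m H *m adj X) a b = (X *m (H' - H) *m adj X) a b.
  by rewrite mulmxBr mulmxBl !mxE.
have -> : (X *m (H' - H) *m adj X) a b = \sum_j \sum_i X a i * (H' i j - H i j) * (X b j)^*.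
  by rewrite mxE; apply: eq_bigr => j _; rewrite mxE big_distrl /=;
    apply: eq_bigr => i _; rewrite !mxE.
apply: le_trans (cm_sum _ _ _) _.
set d := c / _ in hE *.
have d0 : 0 <= d by rewrite divr_ge0 ?(ltW c0) ?addr_ge0 ?mulr_ge0.
apply: le_trans (_ : \sum_j d * (K * cm (X b j)) <= _).
  apply: ler_sum => j _; apply: le_trans (cm_sum _ _ _) _.
  apply: le_trans (_ : \sum_i d * cm (X b j) * cm (X a i) <= _).
    apply: ler_sum => i _; rewrite !cmM cmJ [leRHS]mulrC mulrA ler_wpM2r ?cm_ge0 //.
    by rewrite ler_wpM2l ?cm_ge0.
  by rewrite -mulr_sumr -mulrA ler_wpM2l // [leLHS]mulrC ler_wpM2r ?cm_ge0.
rewrite -mulr_sumr -mulr_sumr; apply: le_trans (_ : d * (K * K) <= _).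
  by rewrite ler_wpM2l // ler_wpM2l.
rewrite /d -mulrA ler_piMr ?(ltW c0) // mulrC ler_pdivrMr ?mul1r ?lerDl //.
by rewrite ltr_wpDl ?mulr_ge0.
Qed.

End Inertia.

(** * Negative eigenvalues of real symmetric matrices *)

Section NuMinus.
Variable R : realType.
Local Notation C := (R[i]).

Definition cmx m n (S : 'M[R]_(m, n)) : 'M[C]_(m, n) := map_mx (real_complex R) S.

Lemma adj_cmx m n (S : 'M[R]_(m, n)) : adj (cmx S) = cmx S^T.
Proof. by apply/matrixP => i j; rewrite !mxE conjc_real. Qed.

Lemma herm_cmx n (S : 'M[R]_n) : S^T = S -> herm (cmx S).
Proof. by move=> h; rewrite /herm adj_cmx h. Qed.

Lemma sum_mup_neg (s : seq R) : let p := \prod_(y <- s) ('X - y%:P) in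
  (\sum_(x <- rootsR p | (x < 0)%R) mup x p)%N = count (fun x => (x < 0)%R) s.
Proof.
move=> p; have p0 : p != 0 by apply: monic_neq0; exact: monic_prod_XsubC.
under eq_bigr do rewrite mu_prod_XsubC -sum1_count big_mkcond /=.
rewrite exchange_big /= -sum1_count [RHS]big_mkcond /=.
apply: eq_big_seq => y ys.
have yr : y \in rootsR p.
  by rewrite -(roots_on_rootsR p0) in_itv /= root_prod_XsubC.
rewrite big_mkcond (bigD1_seq y) //=; last exact: uniq_roots.
rewrite eqxx big1 ?addn0 // => x xy.
by rewrite eq_sym (negbTE xy) if_same.
Qed.

(** The spectral theorem diagonalizes the form with the roots of the
    characteristic polynomial as coefficients. *)
Lemma nu_minus_hns n (S : 'M[R]_n) : S^T = S -> has_negative_squares (cmx S) (nu_minus S).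
Proof.
move=> hS; have [P [d [dH _ cp]]] := herm_spectral (herm_cmx hS).
apply/hnsP; exists P, d; split=> //.
have -> : nu_minus S = count (fun x => (x < 0)%R) [seq d i | i <- enum 'I_n].
  rewrite /nu_minus; have -> : char_poly S = \prod_(y <- [seq d i | i <- enum 'I_n]) ('X - y%:P).
    apply: (map_poly_inj (real_complex R)); rewrite map_char_poly -/(cmx S) cp.
    rewrite big_map big_enum rmorph_prod /=; apply: eq_bigr => i _.
    by rewrite rmorphB /= map_polyX map_polyC.
  exact: sum_mup_neg.
rewrite -/(negidx d) card_negidx count_map -sum1_count [RHS]big_mkcond [RHS]big_enum /=.
by apply: eq_bigr => i _; case: (d i < 0).
Qed.

Lemma nu_minusP n (S : 'M[R]_n) q : S^T = S -> has_negative_squares (cmx S) q ->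
  nu_minus S = q.
Proof. by move=> hS; apply: hns_uniq; exact: nu_minus_hns. Qed.

Lemma nu_minus_congr n (S X : 'M[R]_n) : S^T = S -> X \in unitmx ->
  nu_minus (X *m S *m X^T) = nu_minus S.
Proof.
move=> hS uX; apply: nu_minusP; first by rewrite !trmx_mul trmxK hS mulmxA.
rewrite /cmx !map_mxM -/(cmx X) -/(cmx S) -/(cmx X^T) -adj_cmx.
by apply: hns_congr; [rewrite map_unitmx|exact: nu_minus_hns].
Qed.

Lemma nu_minus_block m n (A : 'M[R]_m) (B : 'M[R]_n) : A^T = A -> B^T = B ->
  nu_minus (block_mx A 0 0 B) = (nu_minus A + nu_minus B)%N.
Proof.
move=> hA hB; apply: nu_minusP; first by rewrite tr_block_mx hA hB !trmx0.
by rewrite /cmx map_block_mx !map_mx0; apply: hns_block; exact: nu_minus_hns.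
Qed.

End NuMinus.

(** * The number of negative squares of a meromorphic function *)

Section Index.
Variable R : realType.
Local Notation C := (R[i]).
Local Notation sphere := (option C).
Implicit Types (f g : C -> sphere) (z w : C) (t : sphere) (P : {poly R}).

Lemma conjB (a b : C) : ((a - b)^* = a^* - b^*)%R.
Proof. exact: rmorphB. Qed.
Lemma conjD (a b : C) : ((a + b)^* = a^* + b^*)%R.
Proof. exact: rmorphD. Qed.
Lemma conjN (a : C) : ((- a)^* = - a^*)%R.
Proof. exact: rmorphN. Qed.
Lemma conjM (a b : C) : ((a * b)^* = a^* * b^*)%R.
Proof. exact: rmorphM. Qed.
Lemma conjX (a : C) n : ((a ^+ n)^* = a^* ^+ n)%R.
Proof. exact: rmorphXn. Qed.
Lemma conjV (a : C) : ((a^-1)^* = (a^*)^-1)%R.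
Proof. exact: fmorphV. Qed.
Lemma conj_sum (I : Type) (r : seq I) (Q : pred I) (F : I -> C) :
  ((\sum_(i <- r | Q i) F i)^* = \sum_(i <- r | Q i) (F i)^*)%R.
Proof. exact: rmorph_sum. Qed.
Lemma conjRC (x : R) : ((x%:C%C)^* = x%:C%C)%R.
Proof. exact: conjc_real. Qed.
Lemma conj_divc (a b : C) : ((a / b)^* = a^* / b^*)%R.
Proof. by rewrite conjM conjV. Qed.
Lemma conjcE z : conjc z = (z^*)%R.
Proof. by []. Qed.

Definition points f n (z : 'I_n -> C) := forall i, upper (z i) /\ regular_at f (z i).

(** [f] has at least [q] negative squares. Index computations are done with
    this predicate, which survives perturbation of the points; [nevanlinnaP]
    translates. *)
Definition neg_ge f q := exists n (z : 'I_n -> C),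
  points f z /\ negdim (nevanlinna_form f z) q.

Lemma nform_herm f n (z : 'I_n -> C) : herm (nevanlinna_form f z).
Proof.
apply/matrixP => i j; rewrite adjE !mxE !conjcE conj_divc. rewrite !conjB !conjCK.
have E (a b c d : C) : (a - b) / (c - d) = (b - a) / (d - c).
  by rewrite -[b - a]opprB -[d - c]opprB invrN mulrNN.
exact: E.
Qed.

Lemma neg_ge0 f : neg_ge f 0.
Proof. exists 0%N, (fun=> 0); split; [by case|exact: negdim0]. Qed.

Lemma nevanlinnaP q f : nevanlinna q f <->
  [/\ meromorphic_nonreal f, real_symmetric f, neg_ge f q &
    forall p, neg_ge f p -> (p <= q)%N].
Proof.
split=> [[mf sf hle [n [z [pz hz]]]]|[mf sf [n [z [pz hz]]] hle]].
  split=> [//|//||].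
    by exists n, z; split=> //; exact: (has_negative_squares_max hz).1.
  move=> p [m [w [inv_pow hw]]]; have [r rq hr] := hle m w inv_pow.
  exact: leq_trans ((has_negative_squares_max hr).2 _ hw) rq.
split=> [//|//||].
  move=> m w inv_pow; have [r hr] := herm_hns (nform_herm f w).
  by exists r => //; apply: hle; exists m, w; split=> //; exact: (has_negative_squares_max hr).1.
exists n, z; split=> //; apply: hns_maxP => //; first exact: nform_herm.
by move=> p hp; apply: hle; exists n, z.
Qed.

Lemma nevanlinna_uniq p q f : nevanlinna p f -> nevanlinna q f -> p = q.
Proof.
move=> /nevanlinnaP[_ _ p1 p2] /nevanlinnaP[_ _ q1 q2].
by apply/eqP; rewrite eqn_leq q2 // p2.
Qed.

Lemma nonreal_near z : nonreal z -> exists2 e : R, 0 < e & forall w, cm (w - z) < e -> nonreal w.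
Proof.
rewrite /nonreal => h; exists `|complex.Im z|; first by rewrite normr_gt0.
move=> w hw; apply: contraTneq hw => w0; rewrite -leNgt.
by apply: le_trans (cm_Im _); rewrite ImB w0 sub0r normrN.
Qed.

Lemma upper_near z : upper z -> exists2 e : R, 0 < e & forall w, cm (w - z) < e -> upper w.
Proof.
rewrite /upper => h; exists (complex.Im z) => //.
move=> w hw; have := cm_Im (w - z); rewrite ImB ler_norml => /andP[? _]; lra.
Qed.

Lemma upper_nonreal z : upper z -> nonreal z.
Proof. by rewrite /upper /nonreal => /gt_eqF ->. Qed.

Lemma regular_ext f g z : (exists2 e : R, 0 < e & forall w, cm (w - z) < e -> f w = g w) ->
  regular_at f z -> regular_at g z.
Proof.
case=> e e0 E [h hh /nearP[d d0 H]]; exists h; first exact: hh.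
apply/nearP; exists (Num.min e d); first by rewrite lt_min e0.
by move=> w; rewrite lt_min => /andP[h1 h2]; rewrite -E // H.
Qed.

Lemma pole_ext f g z : (exists2 e : R, 0 < e & forall w, cm (w - z) < e -> f w = g w) ->
  pole_at f z -> pole_at g z.
Proof.
case=> e e0 E [fz [p [h [p0 hh hz /dnearP[d d0 H]]]]].
split; first by rewrite -E // subrr cm0.
exists p, h; split; [exact: p0|exact: hh|exact: hz|].
apply/dnearP; exists (Num.min e d); first by rewrite lt_min e0.
by move=> w; rewrite lt_min => /andP[h1 h2] wz; rewrite -E // H.
Qed.

(** Values on the real line are arbitrary. *)
Definition eq_off_real f g := forall z, nonreal z -> f z = g z.

Lemma eq_off_real_near f g z : eq_off_real f g -> nonreal z ->
  exists2 e : R, 0 < e & forall w, cm (w - z) < e -> f w = g w.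
Proof. by move=> E /nonreal_near[e e0 H]; exists e => // w /H/E. Qed.

Lemma eq_off_real_sym f g : eq_off_real f g -> eq_off_real g f.
Proof. by move=> E z /E. Qed.

Lemma conj_nonreal z : nonreal z -> nonreal (z^*).
Proof. by case: z => a b; rewrite /nonreal /= oppr_eq0. Qed.

Lemma mero_ext f g : eq_off_real f g -> meromorphic_nonreal f -> meromorphic_nonreal g.
Proof.
move=> E mf z hz; case: (mf z hz) => h; [left|right].
  by apply: regular_ext h; exact: eq_off_real_near.
by apply: pole_ext h; exact: eq_off_real_near.
Qed.

Lemma sym_ext f g : eq_off_real f g -> real_symmetric f -> real_symmetric g.
Proof. by move=> E sf z hz; rewrite -!E ?sf //; exact: conj_nonreal. Qed.

Lemma neg_ge_ext f g q : eq_off_real f g -> neg_ge f q -> neg_ge g q.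
Proof.
move=> E [n [z [pz hz]]]; exists n, z; split.
  move=> i; have [u r] := pz i; split=> //.
  by apply: regular_ext r; apply: eq_off_real_near => //; exact: upper_nonreal.
suff <- : nevanlinna_form f z = nevanlinna_form g z by [].
have nr i : nonreal (z i) by apply: upper_nonreal; case: (pz i).
by apply/matrixP => i j; rewrite !mxE (E _ (nr i)) (E _ (nr j)).
Qed.

Lemma nevanlinna_ext q f g : eq_off_real f g -> nevanlinna q f -> nevanlinna q g.
Proof.
move=> E /nevanlinnaP[m s n1 n2]; apply/nevanlinnaP; split.
- exact: mero_ext E m.
- exact: sym_ext E s.
- exact: neg_ge_ext n1.
by move=> p hp; apply: n2; apply: neg_ge_ext hp; exact: eq_off_real_sym.
Qed.

Lemma mero_quot f z : meromorphic_nonreal f -> nonreal z -> quot_at f z.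
Proof. by move=> mf /mf[]; [exact: regular_quot|exact: pole_quot]. Qed.

Lemma mero_not_None f z : meromorphic_nonreal f -> nonreal z -> ~ locally_eq f z None.
Proof. by move=> mf /mf; exact: regular_not_loc. Qed.

Lemma mero_of_quot f : (forall z, nonreal z -> quot_at f z) ->
  (forall z, nonreal z -> ~ locally_eq f z None) -> meromorphic_nonreal f.
Proof.
move=> Q N z hz; have [h|[[h _]|h]] := quot_at_cases (Q z hz); [|by left|by right].
by have := N z hz h.
Qed.

Lemma mero_regular f z : meromorphic_nonreal f -> nonreal z -> f z <> None -> regular_at f z.
Proof. by move=> mf /mf[//|[fz _]] /(_ fz). Qed.

(** In homogeneous coordinates a Moebius map with holomorphic coefficients is
    linear, hence maps quotients to quotients. *)
Lemma quot_mobius f F z (p q r s : C -> C) : quot_at f z ->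
  holomorphic_at p z -> holomorphic_at q z -> holomorphic_at r z -> holomorphic_at s z ->
  p z * s z - q z * r z != 0 ->
  (exists2 e : R, 0 < e & forall w, cm (w - z) < e -> F w = mobius (mx2 (p w) (q w) (r w) (s w)) (f w)) ->
  quot_at F z.
Proof.
move=> [a [b [ha hb ab [e e0 H]]]] hp hq hr hs dt [d d0 K].
have [r0 r00 hab] : exists2 e : R, 0 < e & forall w, cm (w - z) < e -> (a w, b w) != (0, 0).
  move: ab; rewrite xpair_eqE negb_and => /orP[az|bz].
    have [e1 e10 H1] := ccont_neq0 (hol_ccont ha) az.
    by exists e1 => // w /H1 h; rewrite xpair_eqE (negbTE h).
  have [e1 e10 H1] := ccont_neq0 (hol_ccont hb) bz.
  by exists e1 => // w /H1 h; rewrite xpair_eqE (negbTE h) andbF.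
exists (fun w => p w * a w + q w * b w), (fun w => r w * a w + s w * b w); split.
- by apply: holD; apply: holM; [exact: hp|exact: ha|exact: hq|exact: hb].
- by apply: holD; apply: holM; [exact: hr|exact: ha|exact: hs|exact: hb].
- have D : mdet (mx2 (p z) (q z) (r z) (s z)) != 0 by rewrite mdet_mx2.
  by have := mdet_pair D ab; have [-> -> -> ->] := mx2E (p z) (q z) (r z) (s z).
exists (Num.min r0 (Num.min e d)); first by rewrite !lt_min r00 e0.
move=> w; rewrite !lt_min => /and3P[h1 h2 h3].
by rewrite K // H // mobius_mx2 // hab.
Qed.

(** [- 1 / f], as a Moebius map: the class of functions with a given number of
    negative squares is stable under this inversion. *)
Definition ninv f : C -> sphere := fun z => mobius (mx2 0 (-1) 1 0) (f z).
Definition padd P f : C -> sphere := fun z => mobius (mx2 1 (peval P z) 0 1) (f z).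

Lemma ninvE t : mobius (mx2 0 (-1) 1 0) t = if t is Some a then if a == 0 then None else Some (- a^-1) else Some 0.
Proof.
case: t => [a|]; last by rewrite /= !mxE /= /sph_div oner_eq0 mul0r.
rewrite /= !mxE /= /sph_div mul1r mul0r addr0 add0r; case: eqP => // _.
by rewrite mulN1r.
Qed.

Lemma paddE P z t : mobius (mx2 1 (peval P z) 0 1) t = omap (fun a => a + peval P z) t.
Proof.
case: t => [a|]; last by rewrite /= !mxE /= /sph_div eqxx.
by rewrite /= !mxE /= /sph_div mul0r add0r oner_eq0 mul1r divr1.
Qed.

Lemma ninvK f z : ninv (ninv f) z = f z.
Proof.
rewrite /ninv; case: (f z) => [a|]; last by rewrite (ninvE None) ninvE eqxx.
rewrite (ninvE (Some a)).
have [->|a0] := eqVneq a 0; first by rewrite ninvE.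
by rewrite ninvE oppr_eq0 invr_eq0 (negbTE a0) invrN invrK opprK.
Qed.

Lemma ninv_None f z : ninv f z = None <-> f z = Some 0.
Proof.
rewrite /ninv ninvE; case: (f z) => [a|]; last by split.
by case: eqP => [->|a0]; split=> // -[].
Qed.

Lemma ninv_Some0 f z : ninv f z = Some 0 <-> f z = None.
Proof. by rewrite -ninv_None ninvK. Qed.

Lemma ninv_quot f z : quot_at f z -> quot_at (ninv f) z.
Proof.
move=> Q; apply: (@quot_mobius f _ z (fun=> 0) (fun=> -1) (fun=> 1) (fun=> 0));
  [exact: Q|exact: hol_cst|exact: hol_cst|exact: hol_cst|exact: hol_cst| |by exists 1].
by rewrite mul0r sub0r mulN1r opprK oner_eq0.
Qed.

Lemma padd_quot P f z : quot_at f z -> quot_at (padd P f) z.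
Proof.
move=> Q; apply: (@quot_mobius f _ z (fun=> 1) (peval P) (fun=> 0) (fun=> 1));
  [exact: Q|exact: hol_cst|exact: peval_hol|exact: hol_cst|exact: hol_cst| |by exists 1].
by rewrite mul1r mulr0 subr0 oner_eq0.
Qed.

Lemma zmulE f z : nonreal z -> zmul f z = mobius (mx2 z 0 0 1) (f z).
Proof.
move=> hz; rewrite /zmul; case: (f z) => [a|]; rewrite /= !mxE /= /sph_div.
  by rewrite mul0r add0r oner_eq0 addr0 divr1.
by rewrite eqxx.
Qed.

Lemma nonreal_neq0 z : nonreal z -> z != 0.
Proof. by apply: contraNneq => ->. Qed.

Lemma zmul_quot f z : nonreal z -> quot_at f z -> quot_at (zmul f) z.
Proof.
move=> hz Q; apply: (@quot_mobius f _ z id (fun=> 0) (fun=> 0) (fun=> 1));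
  [exact: Q|exact: hol_id|exact: hol_cst|exact: hol_cst|exact: hol_cst| |].
  by rewrite mulr1 mulr0 subr0 nonreal_neq0.
by have [e e0 H] := nonreal_near hz; exists e => // w /H; exact: zmulE.
Qed.

Lemma padd_None P f z : padd P f z = None <-> f z = None.
Proof. by rewrite /padd paddE; case: (f z). Qed.

Lemma zmul_None f z : zmul f z = None <-> f z = None.
Proof. by rewrite /zmul; case: (f z). Qed.

Lemma locally_eq_iff f g z t u : (forall w, f w = t <-> g w = u) ->
  locally_eq f z t -> locally_eq g z u.
Proof. by move=> E [e e0 H]; exists e => // w /H /E. Qed.

Lemma padd_mero P f : meromorphic_nonreal f -> meromorphic_nonreal (padd P f).
Proof.
move=> mf; apply: mero_of_quot => z hz.
  by apply: padd_quot; exact: mero_quot.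
by move=> h; apply: (mero_not_None mf hz); apply: locally_eq_iff h => w; exact: padd_None.
Qed.

Lemma zmul_mero f : meromorphic_nonreal f -> meromorphic_nonreal (zmul f).
Proof.
move=> mf; apply: mero_of_quot => z hz.
  by apply: zmul_quot => //; exact: mero_quot.
by move=> h; apply: (mero_not_None mf hz); apply: locally_eq_iff h => w; exact: zmul_None.
Qed.

Lemma padd_padd P Q f z : padd Q (padd P f) z = padd (P + Q) f z.
Proof.
rewrite /padd !paddE; case: (f z) => //= a.
by rewrite /peval rmorphD hornerD addrA.
Qed.

Lemma padd0 f z : padd 0 f z = f z.
Proof. by rewrite /padd paddE; case: (f z) => //= a; rewrite /peval rmorph0 horner0 addr0. Qed.

Lemma paddK P f z : padd (- P) (padd P f) z = f z.
Proof. by rewrite padd_padd subrr padd0. Qed.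

Lemma peval_conj P z : peval P (z^*) = (peval P z)^*.
Proof.
rewrite !conjcE !pevalE conj_sum; apply: eq_bigr => i _.
by rewrite conjM conjX conjRC.
Qed.

Lemma padd_sym P f : real_symmetric f -> real_symmetric (padd P f).
Proof.
move=> sf z hz; rewrite /padd !paddE sf //; case: (f z) => //= a.
by rewrite peval_conj !conjcE conjD.
Qed.

Lemma ninv_sym f : real_symmetric f -> real_symmetric (ninv f).
Proof.
move=> sf z hz; rewrite /ninv !ninvE sf //; case: (f z) => [a|] /=; last by congr Some; exact/esym/conjc0.
by rewrite conjcE conjC_eq0; case: eqP => //= _; rewrite conjcE conjN conjV.
Qed.

(** The half-plane is convex, so the identity theorem along segments suffices. *)
Lemma None_upper f z0 z1 : (forall z, nonreal z -> quot_at f z) ->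
  upper z0 -> upper z1 -> locally_eq f z0 None -> locally_eq f z1 None.
Proof.
move=> Q u0 u1; apply: locally_None_segment => s hs.
by apply: Q; apply: upper_nonreal; exact: upper_segment.
Qed.

Lemma locally_conj f z : real_symmetric f -> nonreal z -> locally_eq f z None ->
  locally_eq f (z^*) None.
Proof.
move=> sf hz [e e0 H]; have [d d0 K] := nonreal_near (conj_nonreal hz).
exists (Num.min e d); first by rewrite lt_min e0.
move=> w; rewrite lt_min => /andP[h1 h2]; have nw := K w h2.
have := sf w nw; rewrite H; last by rewrite -cmJ conjcE conjB conjCK.
by case: (f w).
Qed.

Lemma upper_or z : nonreal z -> upper z \/ upper (z^*).
Proof.
case: z => a b; rewrite /nonreal /upper /= neq_lt => /orP[h|h]; [right|left] => //.
by rewrite oppr_gt0.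
Qed.

Lemma None_all f z0 : (forall z, nonreal z -> quot_at f z) -> real_symmetric f ->
  nonreal z0 -> locally_eq f z0 None -> forall z, nonreal z -> locally_eq f z None.
Proof.
move=> Q sf n0 h z hz.
have [u0 [u00 h0]] : exists u0, upper u0 /\ locally_eq f u0 None.
  by case: (upper_or n0) => u; [exists z0|exists (z0^*); split=> //; exact: locally_conj].
case: (upper_or hz) => u; first exact: None_upper h0.
have := None_upper Q u00 u h0 => /(locally_conj sf (conj_nonreal hz)).
by rewrite conjcK.
Qed.

(** A function that is everywhere locally a quotient is meromorphic as soon as
    it is finite at one point; symmetry carries the argument to the other
    half-plane. *)
Lemma mero_of_point f z0 : (forall z, nonreal z -> quot_at f z) -> real_symmetric f ->
  nonreal z0 -> f z0 <> None -> meromorphic_nonreal f.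
Proof.
move=> Q sf n0 f0; apply: mero_of_quot => // z hz h; apply: f0.
by have [e e0 H] := None_all Q sf hz h n0; apply: H; rewrite subrr cm0.
Qed.

End Index.

(** * Invariance of the index under inversion *)

Section Index2.
Variable R : realType.
Local Notation C := (R[i]).
Local Notation sphere := (option C).
Implicit Types (f g : C -> sphere) (z w : C) (t : sphere) (P : {poly R}).

Lemma quot_close (N D : C) (e : R) : D != 0 -> 0 < e -> exists2 r : R, 0 < r &
  forall N' D', cm (N' - N) <= r -> cm (D' - D) <= r -> cm (N' / D' - N / D) <= e.
Proof.
move=> D0 e0; have d0 : 0 < cm D by rewrite cm_gt0.
have n0 := cm_ge0 N.
have s0 : 0 < cm D + cm N + 1 by rewrite ltr_wpDl // addr_ge0 ?cm_ge0.
exists (Num.min (cm D / 2) (e * cm D ^+ 2 / 2 / (cm D + cm N + 1))).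
  by rewrite lt_min !divr_gt0 // mulr_gt0 ?exprn_gt0.
move=> N' D'; set r := Num.min _ _ => hN hD.
have r1 : r <= cm D / 2 by rewrite ge_min lexx.
have r2 : r * (cm D + cm N + 1) <= e * cm D ^+ 2 / 2.
  by rewrite -ler_pdivlMr // ge_min lexx orbT.
have r0 : 0 <= r := le_trans (cm_ge0 _) hN.
have D'2 : cm D / 2 <= cm D' by have := cmBr D D'; rewrite cmB; lra.
have D'0 : D' != 0 by rewrite -cm_gt0; lra.
have -> : N' / D' - N / D = ((N' - N) * D - N * (D' - D)) / (D' * D) by field; apply/andP.
rewrite cmM cmV cmM ler_pdivrMr ?mulr_gt0 ?cm_gt0 //.
have : cm ((N' - N) * D - N * (D' - D)) <= r * (cm D + cm N + 1).
  apply: le_trans (cmD _ _) _; rewrite cmN !cmM.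
  have : cm (N' - N) * cm D <= r * cm D by rewrite ler_wpM2r // ltW.
  have : cm N * cm (D' - D) <= cm N * r by rewrite ler_wpM2l.
  nra.
move=> /le_trans; apply; apply: le_trans r2 _.
have : e * (cm D / 2 * cm D) <= e * (cm D' * cm D).
  by rewrite ler_wpM2l ?(ltW e0) // ler_wpM2r ?(ltW d0).
by rewrite expr2; lra.
Qed.

Lemma upper_conjB_neq0 z w : upper z -> upper w -> z - (w^*)%R != 0.
Proof.
rewrite /upper => hz hw; apply/eqP => h.
have := congr1 (@complex.Im R) h; rewrite ImB /=.
by case: (w) hw => a b /= hb; lra.
Qed.

Lemma uniform_radius n (Q : 'I_n -> R -> Prop) :
  (forall i r s, 0 < r -> r <= s -> Q i s -> Q i r) ->
  (forall i, exists2 r : R, 0 < r & Q i r) -> exists2 r : R, 0 < r & forall i, Q i r.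
Proof.
move=> mono H; have /choice[r hr] : forall i, exists r, 0 < r /\ Q i r.
  by move=> i; have [r] := H i; exists r.
exists (\big[Num.min/1]_i r i); first by apply: lt_bigmin => // i _; have [] := hr i.
move=> i; have [r0 q] := hr i; apply: mono q; last exact: bigmin_le_cond.
by apply: lt_bigmin => // j _; have [] := hr j.
Qed.

(** The form depends continuously on the points, and negative definiteness is
    an open condition. This serves to move points away from zeros and poles. *)
Lemma negdim_perturb f n (z : 'I_n -> C) q (E : C -> Prop) : points f z ->
  negdim (nevanlinna_form f z) q ->
  (forall i r, 0 < r -> exists u, cm (u - z i) < r /\ E u) ->
  exists u : 'I_n -> C, [/\ points f u, forall i, E (u i) & negdim (nevanlinna_form f u) q].
Proof.
move=> pz hq near.
have [e e0 He] := negdim_open (nform_herm f z) hq.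
have /choice[g hg] : forall i, exists h : C -> C, holomorphic_at h (z i) /\
    exists2 r : R, 0 < r & forall w, cm (w - z i) < r -> f w = Some (h w).
  by move=> i; have [_ [g hg /nearP[r r0 H]]] := pz i; exists g; split=> //; exists r.
have [r r0 Hr] : exists2 r : R, 0 < r & forall i j, forall u v, cm (u - z i) < r -> cm (v - z j) < r ->
    [/\ upper u, f u = Some (g i u), regular_at f u & cm ((g i u - ((g j v)^*)%R) / (u - (v^*)%R) -
       (g i (z i) - ((g j (z j))^*)%R) / (z i - ((z j)^*)%R)) <= e].
  apply: (@uniform_radius n (fun i r => forall j u v, cm (u - z i) < r -> cm (v - z j) < r -> _)).
    by move=> i r s _ rs H j u v hu hv; apply: H; [exact: lt_le_trans rs|exact: lt_le_trans rs].
  move=> i; apply: (@uniform_radius n (fun j r => forall u v, cm (u - z i) < r -> cm (v - z j) < r -> _)).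
    by move=> j r s _ rs H u v hu hv; apply: H; [exact: lt_le_trans rs|exact: lt_le_trans rs].
  move=> j; have [ui _] := pz i; have [uj _] := pz j.
  have [hgi [ri ri0 Ei]] := hg i; have [hgj _] := hg j.
  have [s s0 Hs] := quot_close (g i (z i) - ((g j (z j))^*)%R) (upper_conjB_neq0 ui uj) e0.
  have s2 : 0 < s / 2 by rewrite divr_gt0.
  have [di di0 Ci] := hol_ccont hgi s2.
  have [dj dj0 Cj] := hol_ccont hgj s2.
  have [d3 d30 C3] := upper_near ui.
  have [d4 d40 C4] : exists2 d, 0 < d & forall w, cm (w - z i) < d -> regular_at f w.
    move/holomorphic_atP: hgi => [d d0 Hd].
    exists (Num.min (d / 2) (ri / 2)); first by rewrite lt_min !divr_gt0.
    move=> w; rewrite lt_min => /andP[h1 h2]; exists (g i).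
      apply/holomorphic_atP; exists (d / 2); first by rewrite divr_gt0.
      by move=> v hv; apply: Hd; have := cmD3 v w (z i); lra.
    apply/nearP; exists (ri / 2); first by rewrite divr_gt0.
    by move=> v hv; apply: Ei; have := cmD3 v w (z i); lra.
  exists (Num.min (Num.min (s / 2) (Num.min di dj)) (Num.min ri (Num.min d3 d4))).
    by rewrite !lt_min s2 di0 dj0 ri0 d30 d40.
  move=> u v; rewrite !lt_min => /andP[/and3P[u1 u2 u3] /and3P[u4 u5 u6]].
  move=> /andP[/and3P[v1 v2 v3] /and3P[v4 v5 v6]].
  split; [exact: C3|exact: Ei|exact: C4|].
  have cj (x y : C) : cm ((x^*)%R - (y^*)%R) = cm (x - y) by rewrite -conjB -conjcE cmJ.
  have bnd (a b c d : C) : a - b - (c - d) = (a - c) - (b - d) by ring.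
  apply: Hs; rewrite bnd; apply: le_trans (cmD _ _) _; rewrite cmN cj.
    by have := Ci u u2; have := Cj v v3; lra.
  by move: u1 v1; lra.
have /choice[u hu] : forall i, exists u, cm (u - z i) < r /\ E u.
  by move=> i; exact: near.
exists u; split.
- by move=> i; have [h1 _] := hu i; have [? _ ? _] := Hr i i (u i) (u i) h1 h1.
- by move=> i; have [] := hu i.
apply: He; first exact: nform_herm.
move=> i j; have [hi _] := hu i; have [hj _] := hu j.
have [_ fi _ K] := Hr i j _ _ hi hj; have [_ fj _ _] := Hr j i _ _ hj hi.
have [_ [d0i d0 /(_ (z i))]] := hg i; rewrite subrr cm0 => /(_ d0) zi.
have [_ [d1i d1 /(_ (z j))]] := hg j; rewrite subrr cm0 => /(_ d1) zj.
by rewrite !mxE fi fj zi zj /=.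
Qed.

Lemma punctured_near f z t (r : R) : punctured f z (fun u => u <> t) -> 0 < r ->
  exists u, cm (u - z) < r /\ f u <> t.
Proof.
move=> [e e0 H] r0; set m := Num.min e r / 2.
have m0 : 0 < m by rewrite divr_gt0 ?lt_min ?e0.
have [md me] : m < e /\ m < r.
  have : Num.min e r <= e by rewrite ge_min lexx.
  have : Num.min e r <= r by rewrite ge_min lexx orbT.
  by rewrite /m in m0 *; lra.
have mE : cm (z + m%:C - z) = m by rewrite addrAC subrr add0r cmR ger0_norm ?ltW.
exists (z + m%:C); rewrite mE; split=> //; apply: H; rewrite ?mE //.
by rewrite -subr_eq0 -cm_eq0 mE gt_eqF.
Qed.

(** After moving the points away from the zeros of [f], the form of [- 1 / f]
    is congruent to that of [f]. *)
Lemma neg_ge_ninv f q : meromorphic_nonreal (ninv f) -> neg_ge f q -> neg_ge (ninv f) q.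
Proof.
move=> mN [n [z [pz hq]]].
have [u [pu Eu hu]] : exists u : 'I_n -> C, [/\ points f u, forall i, f (u i) <> Some 0 & negdim (nevanlinna_form f u) q].
  apply: (@negdim_perturb f n z q (fun u => f u <> Some 0)) => // i r r0.
  have nz : nonreal (z i) by apply: upper_nonreal; case: (pz i).
  have := regpole_punctured (mN _ nz) => /punctured_near /(_ r0)[w [hw fw]].
  by exists w; split=> // h; apply: fw; apply/ninv_None.
exists n, u; split.
  move=> i; have [ui _] := pu i; split=> //.
  by apply: mero_regular => //; [exact: upper_nonreal|move=> /ninv_None; exact: Eu].
have /choice[a ha] : forall i, exists b : C, f (u i) = Some b /\ b != 0.
  move=> i; have [_ /regular_at_neq] := pu i; have := Eu i.
  by case: (f (u i)) => // a h _; exists a; split=> //; apply: contra_notN h => /eqP ->.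
(* The kernel of - 1 / f at (z, w) is that of f divided by f(z) conj(f(w)). *)
apply: (@negdim_congr _ _ _ _ (diag_mx (\row_i a i))).
suff -> : diag_mx (\row_i a i) *m nevanlinna_form (ninv f) u *m adj (diag_mx (\row_i a i))
    = nevanlinna_form f u by [].
have -> : adj (diag_mx (\row_i a i)) = diag_mx (\row_i ((a i)^*)%R).
  by apply/matrixP => i j; rewrite !mxE; case: eqVneq => [->|]; rewrite ?mulr1n ?mulr0n // -[RHS]conjC0.
apply/matrixP => i j; rewrite mul_mx_diag mul_diag_mx !mxE.
have [fi ai] := ha i; have [fj aj] := ha j.
rewrite /ninv !ninvE fi fj (negbTE ai) (negbTE aj) /= conjN conjV.
have cj : (a j)^*%R != 0 by rewrite conjC_eq0.
have uij : u i - ((u j)^*)%R != 0 by apply: upper_conjB_neq0; [case: (pu i)|case: (pu j)].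
move: cj uij; move: ((a j)^*)%R ((u j)^*)%R => b v cj uij.
by field; rewrite ai cj uij.
Qed.

Lemma neg_ge_ninv_eq f q : meromorphic_nonreal f -> meromorphic_nonreal (ninv f) ->
  neg_ge (ninv f) q <-> neg_ge f q.
Proof.
move=> m1 m2; split; last exact: neg_ge_ninv.
move=> h; apply: (@neg_ge_ext _ (ninv (ninv f))); first by move=> z _; rewrite ninvK.
apply: neg_ge_ninv h; apply: mero_ext m1 => z _; by rewrite ninvK.
Qed.

Lemma nevanlinna_ninv f q : meromorphic_nonreal (ninv f) -> nevanlinna q f -> nevanlinna q (ninv f).
Proof.
move=> mN /nevanlinnaP[mf sf n1 n2]; apply/nevanlinnaP.
split; [exact: mN|exact: ninv_sym|exact/neg_ge_ninv_eq|].
by move=> p /(neg_ge_ninv_eq _ mf mN); exact: n2.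
Qed.

End Index2.

(** * Adding a real polynomial *)

Section Index3.
Variable R : realType.
Local Notation C := (R[i]).
Local Notation sphere := (option C).
Implicit Types (f g : C -> sphere) (z w : C) (t : sphere) (P : {poly R}) (y : R).

(** The form of [P] is a Vandermonde congruence of this Hankel matrix, see
    [padd_form]. *)
Definition phankel P : 'M[R]_(size P) := \matrix_(a, b) P`_(a + b).+1.

Lemma phankel_sym P : (phankel P)^T = phankel P.
Proof. by apply/matrixP => i j; rewrite !mxE addnC. Qed.

Lemma poly_kernel P z w : peval P z - peval P w =
  (z - w) * \sum_(a < size P) \sum_(b < size P) (P`_(a + b).+1)%:C * z ^+ a * w ^+ b.
Proof.
set d := size P; pose t i j : C := (P`_(i + j))%:C * z ^+ i * w ^+ j.
have t0 i j : (d <= i + j)%N -> t i j = 0.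
  by move=> h; rewrite /t nth_default // mul0r mul0r.
have shift (F : nat -> C) : \sum_(a < d) F a.+1 = \sum_(a < d) F a + F d - F 0%N.
  have E : \sum_(a < d.+1) F a = \sum_(a < d) F a + F d by rewrite big_ord_recr.
  by rewrite -E big_ord_recl /= addrAC subrr add0r.
rewrite mulr_sumr; under eq_bigr do rewrite mulr_sumr.
have -> : \sum_(a < d) \sum_(b < d) (z - w) * ((P`_(a + b).+1)%:C * z ^+ a * w ^+ b) =
   \sum_(a < d) \sum_(b < d) t a.+1 b - \sum_(a < d) \sum_(b < d) t a b.+1.
  rewrite -sumrB; apply: eq_bigr => a _; rewrite -sumrB; apply: eq_bigr => b _.
  by rewrite /t addSn addnS !exprS; ring.
have -> : \sum_(a < d) \sum_(b < d) t a.+1 b = \sum_(a < d) \sum_(b < d) t a b - \sum_(b < d) t 0%N b.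
  rewrite exchange_big [in RHS]exchange_big -sumrB; apply: eq_bigr => b _.
  by rewrite (shift (fun a => t a b)) t0 ?leq_addr // addr0.
have -> : \sum_(a < d) \sum_(b < d) t a b.+1 = \sum_(a < d) \sum_(b < d) t a b - \sum_(a < d) t a 0%N.
  rewrite -sumrB; apply: eq_bigr => a _.
  by rewrite (shift (fun b => t a b)) t0 ?leq_addl // addr0.
have E (A B D : C) : (A - B) - (A - D) = D - B by ring.
rewrite E !pevalE -/d; congr (_ - _).
  by apply: eq_bigr => a _; rewrite /t addn0 expr0 mulr1.
by apply: eq_bigr => a _; rewrite /t add0n expr0 mulr1.
Qed.

Definition vdm P n (z : 'I_n -> C) : 'M[C]_(n, size P) := \matrix_(i, a) z i ^+ a.

Lemma padd_form P g n (z : 'I_n -> C) : points g z ->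
  nevanlinna_form (padd P g) z =
  nevanlinna_form g z + vdm P z *m cmx (phankel P) *m adj (vdm P z).
Proof.
move=> pz; apply/matrixP => i j; rewrite [RHS]mxE !mxE.
have [ui /regular_at_neq] := pz i; have [uj /regular_at_neq] := pz j.
rewrite /padd !paddE; case: (g (z i)) (g (z j)) => [a|//] [b|//] _ _ /=.
have h := upper_conjB_neq0 ui uj.
have -> : a + peval P (z i) - ((b + peval P (z j))^*)%R =
  (a - (b^*)%R) + (peval P (z i) - peval P ((z j)^*)%R).
  by rewrite conjD -[in RHS]conjcE peval_conj conjcE; ring.
rewrite poly_kernel mulrDl mulrAC divff // mul1r; congr (_ + _).
rewrite exchange_big /=; apply: eq_bigr => b' _.
rewrite mxE big_distrl /=; apply: eq_bigr => a' _.
by rewrite !mxE conjcE conjX; ring.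
Qed.

(** [g (iy) = o(y)]; in particular [g] is finite far up the imaginary axis. *)
Definition small g := forall e : R, 0 < e ->
  exists Y, forall y, Y < y -> exists2 v : C, g (0 +i* y) = Some v & cm v <= e * y.

Lemma points_padd P g n (z : 'I_n -> C) : meromorphic_nonreal g -> points g z -> points (padd P g) z.
Proof.
move=> mg pz i; have [u r] := pz i; split=> //.
apply: mero_regular; [exact: padd_mero|exact: upper_nonreal|].
by move/padd_None; apply/eqP; exact: regular_at_neq.
Qed.

Lemma mx_bound m n (A : 'M[C]_(m, n)) : exists2 M, 0 <= M & forall i j, cm (A i j) <= M.
Proof.
exists (\sum_i \sum_j cm (A i j)).
  by apply: sumr_ge0 => i _; apply: sumr_ge0 => j _; exact: cm_ge0.
move=> i j; rewrite (bigD1 i) //= (bigD1 j) //= -addrA lerDl addr_ge0 //.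
  by apply: sumr_ge0 => k _; exact: cm_ge0.
by apply: sumr_ge0 => k _; apply: sumr_ge0 => l _; exact: cm_ge0.
Qed.

Lemma cm_mulmx m n p (A : 'M[C]_(m, n)) (B : 'M[C]_(n, p)) a b :
  (forall i j, cm (A i j) <= a) -> (forall i j, cm (B i j) <= b) ->
  forall i j, cm ((A *m B) i j) <= n%:R * (a * b).
Proof.
move=> hA hB i j; rewrite mxE; apply: le_trans (cm_sum _ _ _) _.
apply: le_trans (_ : \sum_(k < n) a * b <= _).
  by apply: ler_sum => k _; rewrite cmM ler_pM ?cm_ge0.
by rewrite sumr_const card_ord mulr_natl.
Qed.

(** The points [i, 2 i, ..., d i] are distinct. *)
Lemma i_vdm_unit d : \matrix_(k < d, b < d) (0 +i* (k.+1%:R : R)) ^+ b \in unitmx.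
Proof.
rewrite -unitmx_tr.
have -> : (\matrix_(k < d, b < d) (0 +i* (k.+1%:R : R)) ^+ b)^T =
   Vandermonde d (\row_k (0 +i* (k.+1%:R : R))) by apply/matrixP => i j; rewrite !mxE.
rewrite unitmxE unitfE det_Vandermonde.
apply/prodf_neq0 => i _; apply/prodf_neq0 => j ij; rewrite !mxE subr_eq0 eq_complex /=.
by rewrite eqxx /= eqr_nat eqSS (gtn_eqF ij).
Qed.

(** Points that tend to infinity along the imaginary axis resolve the
    polynomial exactly, while their contribution to the kernel of a function of
    order [o(y)] disappears; the form then tends to a block diagonal one, and
    the negative squares of [g] and of [P] add up. *)
Lemma neg_ge_padd P g a b : meromorphic_nonreal g -> small g -> neg_ge g a ->
  negdim (cmx (phankel P)) b -> neg_ge (padd P g) (a + b).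
Proof.
move=> mg sg [n [z [pz [X nX]]]] [XP nP].
set d := size P in XP nP *.
pose HP := cmx (phankel P); pose K := nevanlinna_form g z.
have hK : herm K by exact: nform_herm.
have hHP : herm HP by apply: herm_cmx; exact: phankel_sym.
pose G0 := block_mx (X *m K *m adj X) 0 0 (XP *m HP *m adj XP).
have hG0 : herm G0.
  rewrite /herm adj_block !adj0 !adjM !adjK hK.
  by move: hHP; rewrite /herm => ->; rewrite !mulmxA.
have nG0 : negdef G0 by exact: negdef_block.
have [e e0 He] := negdef_open hG0 nG0.
pose V1 : 'M[C]_d := \matrix_(k < d, b < d) (0 +i* (k.+1%:R : R)) ^+ b.
have uV1 : V1 \in unitmx by exact: i_vdm_unit.
(* W y inverts the Vandermonde matrix of the points i y (k + 1), and its entries stay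
   bounded for y >= 1. *)
pose W y : 'M[C]_d := diag_mx (\row_(b < d) (y%:C ^- b)) *m invmx V1.
pose zi y (k : 'I_d) : C := 0 +i* (y * k.+1%:R).
have WV y : y != 0 -> W y *m vdm P (zi y) = 1%:M.
  move=> y0; have -> : vdm P (zi y) = V1 *m diag_mx (\row_(b < d) y%:C ^+ b).
    apply/matrixP => k l; rewrite mul_mx_diag !mxE -exprMn; congr (_ ^+ _).
    by rewrite /zi; apply/eqP; rewrite eq_complex /= !mul0r mulr0 subr0 add0r mulrC !eqxx.
  rewrite /W -mulmxA mulKmx // mulmx_diag; apply/matrixP => k l; rewrite !mxE.
  by rewrite mulVf ?expf_neq0 // fmorph_eq0.
(* The coefficients at the new points cancel the polynomial part of the rows of X and
   reproduce XP in the remaining rows. *)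
pose YY y : 'M[C]_(a + b, n + d) :=
  block_mx X (- (X *m vdm P z *m W y)) 0 (XP *m W y).
have [Mv Mv0 hMv] := mx_bound (invmx V1).
have [Mx Mx0 hMx] := mx_bound X.
have [Mp Mp0 hMp] := mx_bound XP.
have [Mz Mz0 hMz] := mx_bound (X *m vdm P z).
have hW y : 1 <= y -> forall i j, cm (W y i j) <= Mv.
  move=> y1 i j; rewrite /W mul_diag_mx !mxE cmM; apply: le_trans (hMv i j).
  have y0 : 0 < y by apply: lt_le_trans y1.
  rewrite ler_piMl ?cm_ge0 // cmV cmX cmR ger0_norm ?(ltW y0) //.
  by rewrite invf_le1 ?exprn_gt0 // exprn_ege1.
pose M := Mx + d%:R * (Mz * Mv) + d%:R * (Mp * Mv).
have M0 : 0 <= M by rewrite !addr_ge0 ?mulr_ge0.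
have hY y : 1 <= y -> forall i j, cm (YY y i j) <= M.
  move=> y1 i j; have hw := hW y y1.
  have t1 := cm_mulmx hMz hw; have t2 := cm_mulmx hMp hw.
  have p1 : 0 <= d%:R * (Mz * Mv) by rewrite !mulr_ge0.
  have p2 : 0 <= d%:R * (Mp * Mv) by rewrite !mulr_ge0.
  rewrite -(splitK i) -(splitK j); case: (fintype.split i) => i'; case: (fintype.split j) => j' /=.
  - by rewrite block_mxEul; have := hMx i' j'; rewrite /M; lra.
  - by rewrite block_mxEur [_ (- _)%R _ _]mxE cmN; have := t1 i' j'; rewrite /M; lra.
  - by rewrite block_mxEdl mxE cm0.
  - by rewrite block_mxEdr; have := t2 i' j'; rewrite /M; lra.
pose zz y : 'I_(n + d) -> C := fun i => match fintype.split i with inl i' => z i' | inr k => zi y k end.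
pose dz := e / ((n + d)%:R * ((n + d)%:R * (M * 1) * M) + 1).
have den0 : 0 <= (n + d)%:R * ((n + d)%:R * (M * 1) * M) by rewrite !mulr_ge0.
have dz0 : 0 < dz by rewrite divr_gt0 // ltr_wpDl.
have [Y1 HY1] := sg (dz / 4) ltac:(by rewrite divr_gt0).
have [Mg Mg0 hMg] : exists2 Mg : R, 0 <= Mg & forall i, cm (sph_fin (g (z i))) <= Mg.
  exists (\sum_i cm (sph_fin (g (z i)))); first by apply: sumr_ge0 => i _; exact: cm_ge0.
  by move=> i; rewrite (bigD1 i) //= lerDl; apply: sumr_ge0 => k _; exact: cm_ge0.
(* So far out that every kernel value of g at a pair with a new point is at most dz. *)
pose y := Num.max 1 (Num.max (Y1 + 1) (Mg * 2 / dz)).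
have y1 : 1 <= y by rewrite le_max lexx.
have yY : Y1 < y.
  have : Y1 + 1 <= y by rewrite !le_max lexx orbT.
  lra.
have yM : Mg <= dz / 2 * y.
  have : Mg * 2 / dz <= y by rewrite !le_max lexx !orbT.
  by rewrite ler_pdivrMr //; lra.
have y0 : 0 < y by apply: lt_le_trans y1.
have yk (k : 'I_d) : y <= y * k.+1%:R by rewrite ler_peMr ?(ltW y0) // ler1n.
have gk (k : 'I_d) : exists2 v : C, g (zi y k) = Some v & cm v <= dz / 4 * (y * k.+1%:R).
  by apply: HY1; apply: lt_le_trans (yk k).
have uk (k : 'I_d) : upper (zi y k) by rewrite /upper /= mulr_gt0.
have pzz : points g (zz y).
  move=> i; rewrite /zz; case: (fintype.split i) => [i'|k]; first exact: pz.
  split; first exact: uk.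
  apply: mero_regular; [exact: mg|exact/upper_nonreal/uk|].
  by have [v ->] := gk k.
exists (n + d)%N, (zz y); split; first exact: points_padd.
rewrite padd_form //.
exists (YY y); apply: He; first by apply: herm_congr; rewrite -padd_form //; exact: nform_herm.
have VE : vdm P (zz y) = col_mx (vdm P z) (vdm P (zi y)).
  apply/matrixP => i l; rewrite -(splitK i) !mxE.
  by case: (fintype.split i) => i' /=; rewrite /zz ?(unsplitK (inl i')) ?(unsplitK (inr i')) mxE.
have YV : YY y *m vdm P (zz y) = col_mx 0 XP.
  rewrite VE mul_block_col mul0mx add0r -[XP *m _ *m _]mulmxA.
  rewrite mulNmx -[X *m _ *m _ *m _]mulmxA WV ?gt_eqF //.
  by rewrite !mulmx1 subrr.
pose Z := nevanlinna_form g (zz y) - block_mx K 0 0 0.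
have -> : YY y *m (nevanlinna_form g (zz y) + vdm P (zz y) *m cmx (phankel P) *m adj (vdm P (zz y))) *m adj (YY y)
   = G0 + YY y *m Z *m adj (YY y).
  have -> : nevanlinna_form g (zz y) = Z + block_mx K 0 0 0 by rewrite subrK.
  rewrite !mulmxDr !mulmxDl [RHS]addrC -addrA; congr (_ + _).
  have -> : YY y *m (vdm P (zz y) *m cmx (phankel P) *m adj (vdm P (zz y))) *m adj (YY y)
     = block_mx 0 0 0 (XP *m HP *m adj XP).
    rewrite !mulmxA YV -[_ *m adj (vdm P (zz y)) *m _]mulmxA -adjM YV adj_col adj0.
    by rewrite mul_col_mx mul0mx mul_col_row !mulmx0 mul0mx.
  have -> : YY y *m block_mx K 0 0 0 *m adj (YY y) = block_mx (X *m K *m adj X) 0 0 0.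
    rewrite /YY mulmx_block adj_block adj0 mulmx_block !(mulmx0, mul0mx, addr0).
    by [].
  by rewrite add_block_mx !(addr0, add0r).
move=> i j; rewrite [X in cm X](_ : _ = (YY y *m Z *m adj (YY y)) i j); last first.
  by rewrite mxE addrAC subrr add0r.
have hZ : forall i j, cm (Z i j) <= dz.
  move=> {}i {}j; rewrite -(splitK i) -(splitK j).
  have kk (k k' : 'I_d) (u v : C) : cm u <= dz / 4 * (y * k.+1%:R) -> cm v <= dz / 4 * (y * k'.+1%:R) ->
      cm ((u - (v^*)%R) / (zi y k - ((zi y k')^*)%R)) <= dz.
    move=> hu hv; rewrite cmM cmV.
    have -> : zi y k - ((zi y k')^*)%R = 0 +i* (y * k.+1%:R + y * k'.+1%:R).
      by rewrite /zi /Num.conj /=; apply/eqP; rewrite eq_complex /= subr0 opprK !eqxx.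
    have -> : cm (0 +i* (y * k.+1%:R + y * k'.+1%:R)) = y * k.+1%:R + y * k'.+1%:R.
      rewrite /cm /Normc.normc expr0n add0r sqrtr_sqr ger0_norm //.
      by have := yk k; have := yk k'; lra.
    rewrite ler_pdivrMr; last by have := yk k; have := yk k'; lra.
    apply: le_trans (cmD _ _) _; rewrite cmN -conjcE cmJ.
    have := yk k; have := yk k'; move: hu hv y0 dz0; nra.
  have zk (i' : 'I_n) (k : 'I_d) (u v : C) : cm u <= Mg -> cm v <= dz / 4 * (y * k.+1%:R) ->
      cm ((u - (v^*)%R) / (z i' - ((zi y k)^*)%R)) <= dz.
    move=> hu hv; rewrite cmM cmV.
    have [ui _] := pz i'.
    have D : y * k.+1%:R <= cm (z i' - ((zi y k)^*)%R).
      apply: le_trans (cm_Im _); rewrite ImB /zi /Num.conj /= opprK.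
      by apply: le_trans (ler_norm _); move: ui; rewrite /upper; lra.
    have D0 : 0 < cm (z i' - ((zi y k)^*)%R) by apply: lt_le_trans D; apply: lt_le_trans (yk k).
    rewrite ler_pdivrMr //.
    apply: le_trans (cmD _ _) _; rewrite cmN -conjcE cmJ.
    apply: le_trans (_ : dz * (y * k.+1%:R) <= _); last by rewrite ler_wpM2l // ltW.
    have := yk k; move: hu hv y0 dz0 yM; nra.
  rewrite [Z _ _]mxE [X in _ + X]mxE.
  case: (fintype.split i) => i'; case: (fintype.split j) => j' /=.
  - rewrite block_mxEul !mxE /zz !(unsplitK (inl _)) subrr cm0; exact: ltW.
  - rewrite block_mxEur !mxE subr0 /zz (unsplitK (inl i')) (unsplitK (inr j')).
    have [v -> hv] := gk j'; exact: zk.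
  - rewrite block_mxEdl !mxE subr0 /zz (unsplitK (inl j')) (unsplitK (inr i')).
    have [v -> hv] := gk i'.
    have := zk j' i' _ v (hMg j') hv; rewrite -cmJ conjcE conj_divc !conjB !conjCK.
    by rewrite -[X in X / _]opprB -[X in _ / X]opprB invrN mulrNN.
  - rewrite block_mxEdr !mxE subr0 /zz (unsplitK (inr i')) (unsplitK (inr j')).
    have [v -> hv] := gk i'; have [v' -> hv'] := gk j'; exact: kk.
have hYa : forall i j, cm (adj (YY y) i j) <= M by move=> k l; rewrite adjE cmJ; exact: hY.
have := cm_mulmx (cm_mulmx (hY y y1) hZ) hYa i j => h; apply: le_trans h _.
have -> : (n + d)%:R * ((n + d)%:R * (M * dz) * M) = dz * ((n + d)%:R * ((n + d)%:R * (M * 1) * M)).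
  by ring.
rewrite /dz mulrAC ler_pdivrMr ?ltr_wpDl //.
by rewrite ler_wpM2l ?(ltW e0) // lerDl.
Qed.

End Index3.

(** * The index under an elementary transformation *)

Section Classes.
Variable R : realType.
Local Notation C := (R[i]).
Local Notation sphere := (option C).
Implicit Types (f g tau : C -> sphere) (z w : C) (t : sphere) (P m : {poly R}) (y : R).

(** The number [kappa_-(P)], see [kappa_minusE]. *)
Definition poly_index P := nu_minus (phankel P).

Lemma poly_index_max P : negdim (cmx (phankel P)) (poly_index P) /\
  forall p, negdim (cmx (phankel P)) p -> (p <= poly_index P)%N.
Proof. apply: has_negative_squares_max; apply: nu_minus_hns; exact: phankel_sym. Qed.

(** The kernel of [g + P] is the sum of the two kernels, and negative squares
    are subadditive. *)
Lemma neg_ge_padd_le P g a r : meromorphic_nonreal g ->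
  (forall p, neg_ge g p -> (p <= a)%N) -> neg_ge (padd P g) r -> (r <= a + poly_index P)%N.
Proof.
move=> mg ha [n [z [pz hr]]].
have pg : points g z.
  move=> i; have [u /regular_at_neq/eqP h] := pz i; split=> //.
  by apply: mero_regular; [exact: mg|exact: upper_nonreal|move/padd_None].
rewrite padd_form // in hr; apply: negdim_add hr.
- exact: nform_herm.
- by apply: herm_congr; apply: herm_cmx; exact: phankel_sym.
- by move=> q hq; apply: ha; exists n, z.
- by move=> q hq; apply: (poly_index_max P).2; exact: negdim_congr hq.
Qed.

Lemma nevanlinna_padd P g a : small g -> nevanlinna a g -> nevanlinna (a + poly_index P) (padd P g).
Proof.
move=> sg /nevanlinnaP[mg yg n1 n2]; apply/nevanlinnaP.
split; [exact: padd_mero|exact: padd_sym| |].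
  by apply: neg_ge_padd => //; exact: (poly_index_max P).1.
by move=> p; exact: neg_ge_padd_le.
Qed.

Lemma bounded_max_exists (Q : nat -> Prop) N : Q 0%N -> (forall p, Q p -> (p <= N)%N) ->
  exists a, Q a /\ forall p, Q p -> (p <= a)%N.
Proof.
move=> Q0; elim: N => [|N IH] H; first by exists 0%N.
have [q|q] := pselect (Q N.+1); first by exists N.+1.
apply: IH => p hp; have := H p hp; rewrite leq_eqVlt => /orP[/eqP pN|//].
by rewrite pN in hp.
Qed.

(** The index of [g] is bounded by that of [g + P], hence finite; its value is
    then forced by [nevanlinna_padd]. *)
Lemma nevanlinna_padd_inv P g Q : meromorphic_nonreal g -> real_symmetric g -> small g ->
  nevanlinna Q (padd P g) -> exists2 a, Q = (a + poly_index P)%N & nevanlinna a g.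
Proof.
move=> mg yg sg nQ; have /nevanlinnaP[_ _ q1 q2] := nQ.
have [a [a1 a2]] : exists a, neg_ge g a /\ forall p, neg_ge g p -> (p <= a)%N.
  apply: (@bounded_max_exists _ Q); first exact: neg_ge0.
  move=> p hp; apply: leq_trans (leq_addr (poly_index P) p) _; apply: q2.
  by apply: neg_ge_padd => //; exact: (poly_index_max P).1.
have na : nevanlinna a g by apply/nevanlinnaP.
by exists a => //; apply: nevanlinna_uniq nQ _; exact: nevanlinna_padd.
Qed.

Lemma zero_form_negdim n p : negdim (0 : 'M[C]_n) p -> p = 0%N.
Proof.
case: p => // p [X hX]; have := hX (const_mx 1).
rewrite mulmx0 mul0mx /hform mulmx0 mul0mx mxE ltxx => h; exfalso.
have : (const_mx 1 : 'rV[C]_p.+1) != 0.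
  by apply/eqP => /rowP/(_ 0)/eqP; rewrite !mxE oner_eq0.
by move/h.
Qed.

(** The zero function; adding [P] to it computes [kappa_-(P)]. *)
Definition const0 : C -> sphere := fun=> Some 0.

Lemma const0_mero : meromorphic_nonreal const0.
Proof.
move=> z _; left; exists (fun=> 0); first exact: hol_cst.
by apply/nearP; exists 1.
Qed.

Lemma nevanlinna_const0 : nevanlinna 0 const0.
Proof.
apply/nevanlinnaP; split; [exact: const0_mero| |exact: neg_ge0|].
  by move=> z _; rewrite /const0 /=; congr Some; exact/esym/conjc0.
move=> p [n [z [_]]].
suff -> : nevanlinna_form const0 z = 0 by move/zero_form_negdim => ->.
by apply/matrixP => i j; rewrite !mxE /= conjC0 subrr mul0r.
Qed.

Lemma small_const0 : small const0.
Proof.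
move=> e e0; exists 0 => y y0; exists 0 => //.
by rewrite cm0 mulr_ge0 ?ltW.
Qed.

Lemma kappa_minusE P : kappa_minus P = poly_index P.
Proof.
have H : nevanlinna (poly_index P) (fun z => Some (peval P z)).
  have := nevanlinna_padd P small_const0 nevanlinna_const0; rewrite add0n.
  by apply: nevanlinna_ext => z _; rewrite /padd paddE /= add0r.
rewrite /kappa_minus; case: xgetP => [q _ hq|/(_ (poly_index P))//].
exact: nevanlinna_uniq hq H.
Qed.

Lemma poly_indexC (c : R) : poly_index c%:P = 0%N.
Proof.
have [h _] := poly_index_max c%:P; apply: (@zero_form_negdim (size c%:P)).
suff <- : cmx (phankel c%:P) = 0 by [].
by apply/matrixP => i j; rewrite !mxE coefC.
Qed.

Lemma nevanlinna2E (a b : nat) f : nevanlinna2 a b f <->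
  (nevanlinna a f /\ nevanlinna b (zmul f)) \/
  [/\ a = 0%N, b = 0%N & forall z, nonreal z -> f z = None].
Proof. by []. Qed.

Lemma nevanlinna_sym a f : nevanlinna a f -> real_symmetric f.
Proof. by case. Qed.

Lemma nevanlinna_mero a f : nevanlinna a f -> meromorphic_nonreal f.
Proof. by case. Qed.

Lemma ninv_mero f z0 : meromorphic_nonreal f -> real_symmetric f -> nonreal z0 ->
  f z0 <> Some 0 -> meromorphic_nonreal (ninv f).
Proof.
move=> mf sf n0 f0; apply: (@mero_of_point _ _ z0); [| |exact: n0|].
- by move=> z hz; apply: ninv_quot; exact: mero_quot.
- exact: ninv_sym.
by move/ninv_None.
Qed.

Lemma zmul_Some0 f z : nonreal z -> zmul f z = Some 0 <-> f z = Some 0.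
Proof.
move=> /nonreal_neq0 z0; rewrite /zmul; case: (f z) => [a|] //=; split=> -[].
  by move/eqP; rewrite mulf_eq0 (negbTE z0) /= => /eqP ->.
by move=> ->; rewrite mulr0.
Qed.

(** For functions that are not identically 0 the adjoined constant infinity is
    no longer an exception once the condition is expressed by [- 1 / tau] and
    [- 1 / (z tau)]: both are then identically 0. *)
Lemma nevanlinna2_ninv a b tau z0 : nonreal z0 -> tau z0 <> Some 0 ->
  nevanlinna2 (Posz a) (Posz b) tau <->
  nevanlinna a (ninv tau) /\ nevanlinna b (ninv (zmul tau)).
Proof.
move=> n0 t0; have zt0 : zmul tau z0 <> Some 0 by move/(zmul_Some0 _ n0).
rewrite nevanlinna2E; split.
  case=> [[na nb]|[-> -> tN]].
    split; apply: nevanlinna_ninv; [|exact: na| |exact: nb].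
      exact: (ninv_mero (nevanlinna_mero na) (nevanlinna_sym na) n0).
    exact: (ninv_mero (nevanlinna_mero nb) (nevanlinna_sym nb) n0).
  split; apply: nevanlinna_ext nevanlinna_const0 => z /tN h; apply/esym/ninv_Some0 => //.
  exact/zmul_None.
case=> na nb.
have [[z1 n1 h1]|none] := pselect (exists2 z1, nonreal z1 & ninv tau z1 <> Some 0).
  left; have E : eq_off_real (ninv (ninv tau)) tau by move=> z _; rewrite ninvK.
  have E2 : eq_off_real (ninv (ninv (zmul tau))) (zmul tau) by move=> z _; rewrite ninvK.
  have mI := ninv_mero (nevanlinna_mero na) (nevanlinna_sym na) n1 h1.
  have mt := mero_ext E mI.
  split; first by apply: (nevanlinna_ext E); exact: nevanlinna_ninv.
  apply: (nevanlinna_ext E2); apply: nevanlinna_ninv; last exact: nb.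
  by apply: (mero_ext (eq_off_real_sym E2)); exact: zmul_mero.
right; have h z : nonreal z -> ninv tau z = Some 0.
  by move=> hz; apply: contrapT => h; apply: none; exists z.
have tN z : nonreal z -> tau z = None by move=> /h /ninv_Some0.
split=> //.
  apply: nevanlinna_uniq na _; apply: nevanlinna_ext nevanlinna_const0 => z hz.
  by rewrite h.
apply: nevanlinna_uniq nb _; apply: nevanlinna_ext nevanlinna_const0 => z hz.
by apply/esym/ninv_Some0/zmul_None; exact: tN.
Qed.

Lemma ninv_zmul tau z : nonreal z -> ninv (zmul tau) z = omap (fun a => a / z) (ninv tau z).
Proof.
move=> /nonreal_neq0 z0; rewrite /ninv /zmul; rewrite !ninvE; case: (tau z) => [a|] /=; last by rewrite mul0r.
rewrite mulf_eq0 (negbTE z0) /=; case: eqP => //= _.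
by rewrite invfM mulNr mulrC.
Qed.

Lemma iy_nonreal y : 0 < y -> nonreal (0 +i* y).
Proof. by rewrite /nonreal /= => /gt_eqF ->. Qed.

Lemma cm_iy y : 0 <= y -> cm (0 +i* y) = y.
Proof. by move=> y0; rewrite /cm /Normc.normc expr0n add0r sqrtr_sqr ger0_norm. Qed.

Lemma small_ninv_zmul tau : small (ninv tau) -> small (ninv (zmul tau)).
Proof.
move=> st e e0; have [Y H] := st e e0.
exists (Num.max Y 1) => y; rewrite gt_max => /andP[/H[v hv lv] y1].
have y0 : 0 < y by apply: lt_trans y1.
exists (v / (0 +i* y)); first by rewrite ninv_zmul ?hv //; exact: iy_nonreal.
rewrite cmM cmV cm_iy ?(ltW y0) //; apply: le_trans lv.
by rewrite ler_piMr ?cm_ge0 // invf_le1 // ltW.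
Qed.

(** [g (iy)] tends to 0. *)
Definition vanish g := forall e : R, 0 < e ->
  exists Y, forall y, Y < y -> exists2 v : C, g (0 +i* y) = Some v & cm v <= e.

Lemma vanish_small g : vanish g -> small g.
Proof.
move=> vg e e0; have [Y H] := vg e e0.
exists (Num.max Y 1) => y; rewrite gt_max => /andP[/H[v hv lv] y1]; exists v => //.
by apply: le_trans lv _; rewrite ler_peMr ?ltW.
Qed.

Lemma vanish_small_zmul g : vanish g -> small (zmul g).
Proof.
move=> vg e e0; have [Y H] := vg e e0.
exists (Num.max Y 1) => y; rewrite gt_max => /andP[/H[v hv lv] y1].
have y0 : 0 < y by apply: lt_trans y1.
exists ((0 +i* y) * v); first by rewrite /zmul hv.
by rewrite cmM cm_iy ?(ltW y0) // mulrC ler_wpM2r // ltW.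
Qed.

Lemma small_point g : small g -> exists2 z0, nonreal z0 & g z0 <> None.
Proof.
move=> sg; have [Y H] := sg 1 ltr01.
pose y := Num.max Y 0 + 1.
have y0 : 0 < y by rewrite ltr_wpDl // le_max lexx orbT.
have [|v hv _] := H y; first by rewrite ltr_pwDr // le_max lexx.
by exists (0 +i* y); [exact: iy_nonreal|rewrite hv].
Qed.

Definition T_M m tau : C -> sphere := fun z => mobius (mx2 1 0 (- (z * peval m z)) 1) (tau z).
Definition T_L (l : R) tau : C -> sphere := fun z => mobius (mx2 1 l%:C 0 1) (tau z).

Lemma mx2M (a b c d a' b' c' d' : C) : mx2 a b c d *m mx2 a' b' c' d' =
  mx2 (a * a' + b * c') (a * b' + b * d') (c * a' + d * c') (c * b' + d * d').
Proof.
apply/matrixP => i j; rewrite !mxE big_ord_recl big_ord1 !mxE.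
by case: i => [[|[|]]] // ?; case: j => [[|[|]]].
Qed.

Lemma mdet_lower (c : C) : mdet (mx2 1 0 c 1) != 0.
Proof. by rewrite mdet_mx2 mulr1 mul0r subr0 oner_eq0. Qed.

Lemma mdet_inv : mdet (mx2 0 (-1) 1 0 : 'M[C]_2) != 0.
Proof. by rewrite mdet_mx2 mulr0 mulr1 sub0r opprK oner_eq0. Qed.

Lemma mdet_scale z : z != 0 -> mdet (mx2 z 0 0 1) != 0.
Proof. by rewrite mdet_mx2 mulr1 mulr0 subr0. Qed.

Lemma ninv_T_M m tau z : ninv (T_M m tau) z = padd ('X * m) (ninv tau) z.
Proof.
rewrite /ninv /T_M /padd -(mobiusM _ _ (mdet_lower _)) -(mobiusM _ _ mdet_inv) !mx2M.
have -> : peval ('X * m) z = z * peval m z by rewrite /peval rmorphM /= map_polyX hornerM hornerX.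
by congr (mobius (mx2 _ _ _ _) _); ring.
Qed.

Lemma ninv_zmul_T_M m tau z : nonreal z ->
  ninv (zmul (T_M m tau)) z = padd m (ninv (zmul tau)) z.
Proof.
move=> hz; have z0 := nonreal_neq0 hz; have dz := mdet_scale z0.
rewrite /ninv /padd !zmulE // /T_M.
rewrite -(mobiusM (mx2 z 0 0 1) _ (mdet_lower _)) mx2M -mobiusM; last first.
  by rewrite mdet_mx2 !(mulr1, mulr0, mul0r, mul1r, addr0, add0r, subr0).
rewrite -(mobiusM _ (tau z) dz) -mobiusM; last first.
  by rewrite mx2M mdet_mx2 !(mulr1, mulr0, mul0r, mul1r, addr0, add0r, subr0, sub0r, mulN1r, opprK).
by rewrite !mx2M; congr (mobius (mx2 _ _ _ _) _); ring.
Qed.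

Lemma T_L_padd l tau z : T_L l tau z = padd l%:P tau z.
Proof. by rewrite /T_L /padd /peval map_polyC hornerC. Qed.

Lemma zmul_T_L l tau z : zmul (T_L l tau) z = padd (l *: 'X) (zmul tau) z.
Proof.
rewrite /zmul T_L_padd /padd !paddE; case: (tau z) => //= a.
by rewrite /peval map_polyC hornerC map_polyZ map_polyX hornerZ hornerX mulrDr mulrC [z * _]mulrC.
Qed.

Lemma nevanlinna2_ext (a b : nat) f g : eq_off_real f g -> nevanlinna2 a b f -> nevanlinna2 a b g.
Proof.
move=> E; rewrite !nevanlinna2E; case=> [[h1 h2]|[h1 h2 h3]]; [left|right].
  split; first exact: nevanlinna_ext E h1.
  by apply: nevanlinna_ext h2 => z hz; rewrite /zmul E.
by split=> // z hz; rewrite -E // h3.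
Qed.

(** Under inversion [T_M] becomes the addition of [z m] to [- 1 / tau] and of
    [m] to [- 1 / (z tau)]. Both directions are needed, so the growth condition
    is put on [tau]. *)
Lemma nevanlinna2_T_M m tau A B : small (ninv tau) ->
  nevanlinna2 (Posz A) (Posz B) (T_M m tau) <->
  exists a b, [/\ A = (a + poly_index ('X * m))%N, B = (b + poly_index m)%N & nevanlinna2 (Posz a) (Posz b) tau].
Proof.
move=> st; have sz := small_ninv_zmul st.
have [z0 n0 h0] := small_point st.
have t0 : tau z0 <> Some 0 by move/ninv_None.
have f0 : T_M m tau z0 <> Some 0.
  by move/ninv_None; rewrite ninv_T_M => /padd_None.
have E1 : eq_off_real (padd ('X * m) (ninv tau)) (ninv (T_M m tau)) by move=> z _; rewrite ninv_T_M.
have E2 : eq_off_real (padd m (ninv (zmul tau))) (ninv (zmul (T_M m tau))).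
  by move=> z hz; rewrite ninv_zmul_T_M.
rewrite (nevanlinna2_ninv _ _ n0 f0); split.
  case=> nA nB.
  have {}nA := nevanlinna_ext (eq_off_real_sym E1) nA; have {}nB := nevanlinna_ext (eq_off_real_sym E2) nB.
  have K P g Q : nevanlinna Q (padd P g) -> meromorphic_nonreal g /\ real_symmetric g.
    move=> nQ; have EP : eq_off_real (padd (- P) (padd P g)) g by move=> z _; rewrite paddK.
    split; first by apply: mero_ext EP _; apply: padd_mero; exact: nevanlinna_mero nQ.
    by apply: sym_ext EP _; apply: padd_sym; exact: nevanlinna_sym nQ.
  have [m1 s1] := K _ _ _ nA; have [m2 s2] := K _ _ _ nB.
  have [a aE na] := nevanlinna_padd_inv m1 s1 st nA.
  have [b bE nb] := nevanlinna_padd_inv m2 s2 sz nB.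
  by exists a, b; split=> //; apply/(nevanlinna2_ninv _ _ n0 t0).
case=> a [b [-> -> /(nevanlinna2_ninv _ _ n0 t0)[na nb]]].
split; first by apply: nevanlinna_ext E1 _; exact: nevanlinna_padd.
by apply: nevanlinna_ext E2 _; exact: nevanlinna_padd.
Qed.

(** Adding the real constant [l] leaves the kernel of [tau] unchanged, and
    [z tau] gains [l z]. *)
Lemma nevanlinna2_T_L l tau A B : vanish tau ->
  nevanlinna2 (Posz A) (Posz B) (T_L l tau) <->
  exists2 b, B = (b + poly_index (l *: 'X))%N & nevanlinna2 (Posz A) (Posz b) tau.
Proof.
move=> vt; have st := vanish_small vt; have sz := vanish_small_zmul vt.
have [z0 n0 h0] := small_point st.
have E1 : eq_off_real (padd l%:P tau) (T_L l tau) by move=> z _; rewrite T_L_padd.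
have E2 : eq_off_real (padd (l *: 'X) (zmul tau)) (zmul (T_L l tau)) by move=> z _; rewrite zmul_T_L.
have K P g Q : nevanlinna Q (padd P g) -> meromorphic_nonreal g /\ real_symmetric g.
  move=> nQ; have EP : eq_off_real (padd (- P) (padd P g)) g by move=> z _; rewrite paddK.
  split; first by apply: mero_ext EP _; apply: padd_mero; exact: nevanlinna_mero nQ.
  by apply: sym_ext EP _; apply: padd_sym; exact: nevanlinna_sym nQ.
split.
  rewrite nevanlinna2E; case=> [[nA nB]|[_ _ /(_ z0 n0)]]; last first.
    by rewrite T_L_padd => /padd_None.
  have {}nA := nevanlinna_ext (eq_off_real_sym E1) nA; have {}nB := nevanlinna_ext (eq_off_real_sym E2) nB.
  have [m1 s1] := K _ _ _ nA; have [m2 s2] := K _ _ _ nB.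
  have [a aE na] := nevanlinna_padd_inv m1 s1 st nA.
  have [b bE nb] := nevanlinna_padd_inv m2 s2 sz nB.
  by exists b => //; apply/nevanlinna2E; left; rewrite aE poly_indexC addn0.
case=> b -> /nevanlinna2E[[na nb]|[_ _ /(_ z0 n0)]]; last by [].
apply/nevanlinna2E; left; split.
  by apply: nevanlinna_ext E1 _; rewrite -[A]addn0 -(poly_indexC l); exact: nevanlinna_padd.
by apply: nevanlinna_ext E2 _; exact: nevanlinna_padd.
Qed.

End Classes.

(** * Nontangential growth *)

Section Nontangential.
Variable R : realType.
Local Notation C := (R[i]).
Local Notation sphere := (option C).
Implicit Types (f g tau : C -> sphere) (z w : C) (t : sphere) (y : R).

(** The kernel itself, for use at arguments outside a fixed list of points. *)
Definition kern g z w : C :=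
  (sph_fin (g z) - ((sph_fin (g w))^*)%R) / (z - (w^*)%R).

Lemma kern_conj g z w : ((kern g z w)^*)%R = kern g w z.
Proof.
rewrite /kern conj_divc !conjB !conjCK.
by rewrite -[X in X / _]opprB -[X in _ / X]opprB invrN mulrNN.
Qed.

Lemma sum_sqr_le n (b : 'I_n -> R) : (forall i, 0 <= b i) ->
  (\sum_i b i) ^+ 2 <= n%:R * \sum_i b i ^+ 2.
Proof.
move=> b0; have := @hform_bound R n (const_mx 1) (\row_i (b i)%:C) 1.
rewrite mul1r => h; have {h} := h _; rewrite /sqn.
have -> : \sum_i cm ((\row_i (b i)%:C) ord0 i) ^+ 2 = \sum_i b i ^+ 2.
  by apply: eq_bigr => i _; rewrite mxE cmR ger0_norm.
have -> : hform (const_mx 1) (\row_i (b i)%:C) = ((\sum_i b i) ^+ 2)%:C.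
  rewrite hformE expr2 mulr_suml rmorph_sum; apply: eq_bigr => i _.
  rewrite mulr_sumr rmorph_sum; apply: eq_bigr => j _.
  by rewrite !mxE mul1r conjRC rmorphM.
rewrite cmR ger0_norm ?sqr_ge0 //; apply=> i j.
by rewrite mxE cm1.
Qed.

Lemma negdef_unit q (G : 'M[C]_q) : negdef G -> G \in unitmx.
Proof.
move=> nG; rewrite -row_free_unit -kermx_eq0; apply/negPn/negP => h.
have := nG (nz_row (kermx G)); rewrite nz_row_eq0 => /(_ h).
have /sub_kermxP e := nz_row_sub (kermx G).
by rewrite /hform e mul0mx mxE ltxx.
Qed.

Lemma herm_real n (H : 'M[C]_n) x : herm H -> hform H x = (complex.Re (hform H x))%:C.
Proof.
move=> hH; have := herm_form_le x hH.
by case: (hform H x) => a b; rewrite lecE /= => /andP[/eqP <-].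
Qed.

Lemma herm_inv n (G : 'M[C]_n) : herm G -> G \in unitmx -> herm (invmx G).
Proof.
move=> hG uG; rewrite /herm; have uA : adj G \in unitmx by rewrite hG.
rewrite -[LHS](mulmxK uG) -[X in _ *m X *m _]hG -adjM mulmxV // adj1 mul1mx.
by [].
Qed.

(** The points [z i] already produce all negative squares, so the Schur
    complement of their block is nonnegative for any further points [u]. The
    correction it contains is bounded by the values of the kernel at the pairs
    [(u k, z i)]. *)
Lemma exhausted_kernel kappa g : nevanlinna kappa g ->
  exists2 B : R, 0 <= B & exists n (z : 'I_n -> C), points g z /\
    forall m (u : 'I_m -> C) (eta : 'rV[C]_m), points g u ->
      0 <= complex.Re (hform (nevanlinna_form g u) eta)
        + B * \sum_i cm (\sum_k eta ord0 k * kern g (u k) (z i)) ^+ 2.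
Proof.
move=> /nevanlinnaP[mg sg [n [z [pz [X nX]]]] hmax].
pose K := nevanlinna_form g z; pose G := X *m K *m adj X.
have hG : herm G by apply: herm_congr; exact: nform_herm.
have uG : G \in unitmx by exact: negdef_unit.
have hI := herm_inv hG uG.
have [e e0 he] := mx_bound (invmx G).
have [M M0 hM] := mx_bound X.
exists (e * kappa%:R * (kappa%:R * (M ^+ 2 * n%:R))); first by rewrite !mulr_ge0 ?exprn_ge0.
exists n, z; split=> // m u eta pu.
pose Q : 'M[C]_(m, n) := \matrix_(k, i) kern g (u k) (z i).
pose Ku := nevanlinna_form g u.
pose zz : 'I_(n + m) -> C := fun i => match fintype.split i with inl a => z a | inr b => u b end.
have pzz : points g zz.
  by move=> i; rewrite /zz; case: (fintype.split i) => k; [exact: pz|exact: pu].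
have HE : nevanlinna_form g zz = block_mx K (adj Q) Q Ku.
  apply/matrixP => i j; rewrite -(splitK i) -(splitK j).
  case: (fintype.split i) => i'; case: (fintype.split j) => j' /=.
  - by rewrite block_mxEul !mxE /zz !(unsplitK (inl _)).
  - by rewrite block_mxEur adjE conjcE [Q _ _]mxE kern_conj !mxE /zz (unsplitK (inl _)) (unsplitK (inr _)).
  - by rewrite block_mxEdl !mxE /zz (unsplitK (inl _)) (unsplitK (inr _)).
  - by rewrite block_mxEdr !mxE /zz !(unsplitK (inr _)).
(* Y eliminates the coupling with the block G; s is the Schur complement. *)
pose c := eta *m Q *m adj X.
pose E := - (c *m invmx G *m X).
pose Y : 'M[C]_(kappa + 1, n + m) := block_mx X 0 E eta.
pose s : 'M[C]_1 := eta *m Ku *m adj eta - c *m invmx G *m adj c.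
have adjc : adj c = X *m adj Q *m adj eta by rewrite /c !adjM adjK mulmxA.
have EK : E *m K *m adj X + eta *m Q *m adj X = 0.
  by rewrite /E !mulNmx -!mulmxA [X *m (K *m _)]mulmxA -/G mulVmx // mulmx1 /c mulmxA addNr.
have YE : Y *m nevanlinna_form g zz *m adj Y = block_mx G 0 0 s.
  have E21 : (E *m K + eta *m Q) *m adj X = 0 by rewrite mulmxDl.
  have E12 : X *m K *m adj E + X *m adj Q *m adj eta = 0.
    rewrite -adjc /E adjN !adjM hI mulmxN !mulmxA -/G mulmxV // mul1mx addNr.
    by [].
  rewrite HE /Y mulmx_block adj_block mulmx_block !(mul0mx, addr0) adj0 !mulmx0 !addr0.
  rewrite E21 E12; congr block_mx.
  have -> : (E *m K + eta *m Q) *m adj E = 0.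
    by rewrite /E adjN adjM mulmxN mulmxA -/E E21 mul0mx oppr0.
  rewrite add0r mulmxDl /s addrC; congr (_ + _).
  by rewrite adjc /E !mulNmx !mulmxA.
have s_ge : ~ (s 0 0 < 0).
  move=> s0; have : negdim (nevanlinna_form g zz) (kappa + 1).
    exists Y; rewrite YE; apply: negdef_block => // x x0.
    rewrite hformE !big_ord1 -mulrA nmulr_rlt0 //.
    have -> : x ord0 0 * ((x ord0 0)^*)%R = `|x ord0 0| ^+ 2 by rewrite sqr_normc.
    rewrite exprn_gt0 // normr_gt0; apply: contraNneq x0 => h.
    by apply/eqP/rowP => j; rewrite ord1 mxE.
  move=> h; have : (kappa + 1 <= kappa)%N by apply: hmax; exists (n + m)%N, zz.
  by rewrite addn1 ltnn.
have sE : s 0 0 = (complex.Re (hform Ku eta) - complex.Re (hform (invmx G) c))%:C.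
  rewrite /s [LHS]mxE [X in _ + X]mxE -!/(hform _ _) (herm_real c hI) rmorphB /=.
  by rewrite {1}(herm_real eta (nform_herm g u)).
have {}s_ge : 0 <= complex.Re (hform Ku eta) - complex.Re (hform (invmx G) c).
  by rewrite leNgt; apply/negP => h; apply: s_ge; rewrite sE ltcR.
have b1 : - complex.Re (hform (invmx G) c) <= e * kappa%:R * sqn c.
  apply: le_trans (hform_bound c he); apply: le_trans (cm_Re _).
  by rewrite -normrN ler_norm.
have b2 : sqn c <= kappa%:R * (M ^+ 2 * n%:R) * \sum_i cm (\sum_k eta ord0 k * kern g (u k) (z i)) ^+ 2.
  rewrite /sqn; apply: le_trans (_ : \sum_(a < kappa) M ^+ 2 * (n%:R * \sum_i cm (\sum_k eta ord0 k * kern g (u k) (z i)) ^+ 2) <= _); last first.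
    by rewrite sumr_const card_ord -[_ * _ *+ _]mulr_natl !mulrA.
  apply: ler_sum => a _.
  apply: le_trans (_ : (M * \sum_i cm (\sum_k eta ord0 k * kern g (u k) (z i))) ^+ 2 <= _); last first.
    rewrite exprMn ler_wpM2l ?exprn_ge0 //; apply: sum_sqr_le => i; exact: cm_ge0.
  rewrite lerXn2r ?nnegrE ?cm_ge0 ?mulr_ge0 ?sumr_ge0 //.
    by move=> i _; exact: cm_ge0.
  rewrite mxE; apply: le_trans (cm_sum _ _ _) _; rewrite mulr_sumr; apply: ler_sum => i _.
  rewrite cmM mulrC adjE cmJ; apply: ler_pM; rewrite ?cm_ge0 //.
  by rewrite mxE; under eq_bigr do rewrite [Q _ _]mxE.
have b3 : e * kappa%:R * sqn c <= e * kappa%:R * (kappa%:R * (M ^+ 2 * n%:R) * \sum_i cm (\sum_k eta ord0 k * kern g (u k) (z i)) ^+ 2).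
  by rewrite ler_wpM2l // mulr_ge0.
rewrite mulrA in b3; lra.
Qed.

(** The form of two points at the vector [(1, - t K(v, w))]; this is the
    Cauchy-Schwarz inequality for the corrected kernel before optimizing [t]. *)
Lemma kernel_two_points g (B : R) n (z : 'I_n -> C) :
  (forall m (u : 'I_m -> C) (eta : 'rV[C]_m), points g u ->
      0 <= complex.Re (hform (nevanlinna_form g u) eta)
        + B * \sum_i cm (\sum_k eta ord0 k * kern g (u k) (z i)) ^+ 2) ->
  0 <= B -> forall v w (t : R), upper v -> upper w -> regular_at g v -> regular_at g w -> 0 <= t ->
  2 * t * cm (kern g v w) ^+ 2 <= cm (kern g v v) + t ^+ 2 * cm (kern g v w) ^+ 2 * cm (kern g w w)
    + B * \sum_i (2 * cm (kern g v (z i)) ^+ 2 + 2 * (t ^+ 2 * cm (kern g v w) ^+ 2 * cm (kern g w (z i)) ^+ 2)).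
Proof.
move=> H B0 v w t uv uw rv rw t0.
pose u : 'I_2 -> C := fun k => if k == ord0 then v else w.
pose x := - t%:C * kern g v w.
pose eta : 'rV[C]_2 := \row_k (if k == ord0 then 1 else x).
have pu : points g u by move=> k; rewrite /u; case: ifP.
have := H 2 u eta pu; set S := B * _; rewrite hformE.
rewrite !big_ord_recl !big_ord0 !addr0 !mxE /u /= !conjC1 !mulr1.
rewrite -!/(kern _ _ _) => h.
have cx : cm x = t * cm (kern g v w) by rewrite /x cmM cmN cmR ger0_norm.
have Ex : kern g v w * (x^*)%R = (- (t * cm (kern g v w) ^+ 2))%:C.
  rewrite /x conjM conjN conjRC mulrCA -sqr_normc cmE -rmorphXn -rmorphN -rmorphM.
  by rewrite mulNr.
have Ey : kern g w v * x = (- (t * cm (kern g v w) ^+ 2))%:C.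
  by rewrite -[x]conjCK -kern_conj -conjM Ex conjRC.
have Ez : kern g w w * x * (x^*)%R = kern g w w * (cm x ^+ 2)%:C.
  by rewrite -mulrA -sqr_normc cmE -rmorphXn.
move: h; rewrite Ex Ey Ez !ReD ReMr /= => h.
have d1 := le_trans (ler_norm _) (cm_Re (kern g v v)).
have d2 := le_trans (ler_norm _) (cm_Re (kern g w w)).
have d3 : complex.Re (kern g w w) * cm x ^+ 2 <= cm (kern g w w) * cm x ^+ 2.
  by rewrite ler_wpM2r ?exprn_ge0 ?cm_ge0.
have d4 : S <=
    B * \sum_i (2 * cm (kern g v (z i)) ^+ 2 + 2 * (t ^+ 2 * cm (kern g v w) ^+ 2 * cm (kern g w (z i)) ^+ 2)).
  rewrite /S ler_wpM2l //; apply: ler_sum => i _.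
  rewrite !big_ord_recl big_ord0 addr0 !mxE /u /= mul1r.
  apply: le_trans (_ : (cm (kern g v (z i)) + cm x * cm (kern g w (z i))) ^+ 2 <= _).
    by rewrite lerXn2r ?nnegrE ?addr_ge0 ?mulr_ge0 ?cm_ge0 // -cmM; exact: cmD.
  rewrite cx; set a := cm (kern g v (z i)); set b := t * _ * _.
  have -> : t ^+ 2 * cm (kern g v w) ^+ 2 * cm (kern g w (z i)) ^+ 2 = b ^+ 2 by rewrite /b; ring.
  have := sqr_ge0 (a - b); rewrite !sqrrB !sqrrD; lra.
rewrite cx exprMn in h d3; lra.
Qed.

End Nontangential.

Section Nontangential2.
Variable R : realType.
Local Notation C := (R[i]).
Local Notation sphere := (option C).
Implicit Types (f g tau : C -> sphere) (z w : C) (t : sphere) (y : R).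

Lemma cm_kern_le g v w (a b d : R) : cm (sph_fin (g v)) <= a -> cm (sph_fin (g w)) <= b ->
  0 < d -> d <= complex.Im v + complex.Im w -> cm (kern g v w) <= (a + b) / d.
Proof.
move=> ha hb d0 hd; rewrite /kern cmM cmV.
have D : d <= cm (v - (w^*)%R).
  apply: le_trans (cm_Im _); apply: le_trans (ler_norm _).
  by rewrite ImB -conjcE; case: (w) hd => x1 x2 /=; rewrite opprK.
have D0 : 0 < cm (v - (w^*)%R) by apply: lt_le_trans D.
rewrite ler_pdivrMr //; apply: le_trans (cmD _ _) _; rewrite cmN -conjcE cmJ.
apply: le_trans (lerD ha hb) _; rewrite mulrAC ler_pdivlMr //.
rewrite ler_wpM2l // addr_ge0 //; [exact: le_trans (cm_ge0 _) ha|exact: le_trans (cm_ge0 _) hb].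
Qed.

(** Let [w = i |v|]. In a sector [|K(v, w)|] is at least of the order of
    [gam = |g(v)| / |v|], whereas [K(v, v)] is at most of that order and [K(w, w)] is
    small. For a suitable [t] the inequality of [kernel_two_points] then bounds
    [|K(v, w)|^2] by a small multiple of [gam^2], unless [gam <= delta]. *)
Lemma small_sector_regular kappa g (c delta : R) : nevanlinna kappa g -> small g ->
  0 < c -> 0 < delta -> exists r0, forall v, upper v -> regular_at g v -> r0 < cm v ->
    c * cm v <= complex.Im v -> cm (sph_fin (g v)) <= delta * cm v.
Proof.
move=> ng sg c0 d0; have mg := nevanlinna_mero ng.
have [B B0 [n [z [pz /kernel_two_points H2]]]] := exhausted_kernel ng.
have {}H2 := H2 B0.
have [Mg Mg0 hMg] : exists2 Mg : R, 0 <= Mg & forall i, cm (sph_fin (g (z i))) <= Mg.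
  exists (\sum_i cm (sph_fin (g (z i)))); first by apply: sumr_ge0 => i _; exact: cm_ge0.
  by move=> i; rewrite (bigD1 i) //= lerDl; apply: sumr_ge0 => k _; exact: cm_ge0.
pose bn := B * n%:R; have bn0 : 0 <= bn by rewrite mulr_ge0.
pose Q := (c * delta)^-1 + 8 * bn / c ^+ 2.
have Q0 : 0 < Q by rewrite ltr_pwDl ?invr_gt0 ?mulr_gt0 // divr_ge0 ?mulr_ge0 ?exprn_ge0 ?(ltW c0).
pose S := 1 + 8 * bn; have S0 : 0 < S by rewrite ltr_pwDl // mulr_ge0.
pose e1 := Num.min 1 (Num.min (delta / 2) (32 * S * Q)^-1).
have e0 : 0 < e1 by rewrite !lt_min ltr01 divr_gt0 //= invr_gt0 !mulr_gt0.
have e11 : e1 <= 1 by rewrite ge_min lexx.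
have e12 : e1 <= delta / 2 by rewrite !ge_min lexx orbT.
have e13 : e1 * S * Q <= 32^-1.
  have : e1 <= (32 * S * Q)^-1 by rewrite !ge_min lexx !orbT.
  rewrite -[(32 * S * Q)^-1]mul1r ler_pdivlMr ?mulr_gt0 // => h.
  by rewrite -[32^-1]mul1r ler_pdivlMr //; lra.
have [Y HY] := sg e1 e0.
exists (Num.max 1 (Num.max Y (Mg / e1))) => v uv rv; rewrite !gt_max => /and3P[r1 rY rM] hIm.
set r := cm v in r1 rY rM hIm *; have r0 : 0 < r by apply: lt_trans r1.
have {}rM : Mg < e1 * r by move: rM; rewrite ltr_pdivrMr // mulrC.
have [gw hgw lgw] := HY r rY.
pose w : C := 0 +i* r.
have uw : upper w by [].
have rw : regular_at g w.
  by apply: mero_regular; [exact: mg|exact: upper_nonreal|rewrite hgw].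
have fw : cm (sph_fin (g w)) <= e1 * r by rewrite hgw.
set G := cm (sph_fin (g v)).
(* From gam > delta the inequality yields P <= gam^2 / 32, against the lower bound
   P >= gam^2 / 16. *)
rewrite leNgt; apply/negP => hG.
have Gr : e1 * r <= G / 2.
  have : e1 * r <= delta / 2 * r by rewrite ler_wpM2r // ltW.
  lra.
have G0 : 0 < G by apply: lt_trans hG; rewrite mulr_gt0.
have cr0 : 0 < c * r by rewrite mulr_gt0.
have k1 : cm (kern g v v) <= (G + G) / (c * r + c * r).
  by apply: cm_kern_le => //; lra.
have k2 : cm (kern g w w) <= (e1 * r + e1 * r) / (r + r).
  by apply: cm_kern_le => //=; lra.
have k3 i : cm (kern g v (z i)) <= 2 * G / (c * r).
  apply: le_trans (_ : (G + Mg) / (c * r) <= _).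
    apply: cm_kern_le => //; have [ui _] := pz i; move: ui; rewrite /upper; lra.
  by rewrite ler_pM2r ?invr_gt0 //; lra.
have k4 i : cm (kern g w (z i)) <= 2 * e1.
  apply: le_trans (_ : (e1 * r + Mg) / r <= _).
    apply: cm_kern_le => //; have [ui _] := pz i; move: ui; rewrite /upper /=; lra.
  by rewrite ler_pdivrMr //; lra.
have k5 : G / (4 * r) <= cm (kern g v w).
  rewrite /kern cmM cmV.
  have D0 : 0 < cm (v - (w^*)%R) by rewrite cm_gt0 upper_conjB_neq0.
  have D : cm (v - (w^*)%R) <= 2 * r.
    apply: le_trans (cmD _ _) _; rewrite cmN -conjcE cmJ cm_iy ?(ltW r0) // -/r; lra.
  have N : G / 2 <= cm (sph_fin (g v) - ((sph_fin (g w))^*)%R).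
    by have := cmBr (sph_fin (g v)) ((sph_fin (g w))^*)%R; rewrite -[cm ((sph_fin (g w))^*)%R]/(cm (conjc _)) cmJ -/G; lra.
  rewrite ler_pdivlMr //; apply: le_trans N.
  rewrite mulrAC ler_pdivrMr ?mulr_gt0 //.
  have : G * cm (v - (w^*)%R) <= G * (2 * r) by rewrite ler_wpM2l // ltW.
  lra.
set P := cm (kern g v w) ^+ 2.
have P0 : 0 <= P by rewrite exprn_ge0 ?cm_ge0.
pose gam := G / r; have gam0 : 0 < gam by rewrite divr_gt0.
have gd : delta < gam by rewrite ltr_pdivlMr.
have P1 : gam ^+ 2 / 16 <= P.
  apply: le_trans (_ : (G / (4 * r)) ^+ 2 <= _).
    rewrite /gam le_eqVlt; apply/orP; left; apply/eqP; field; rewrite ?gt_eqF //.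
  by rewrite lerXn2r ?nnegrE ?cm_ge0 // divr_ge0 ?mulr_ge0 ?(ltW G0) ?(ltW r0).
have {}k1 : cm (kern g v v) <= gam / c.
  apply: le_trans k1 _; rewrite le_eqVlt; apply/orP; left; apply/eqP.
  by rewrite /gam; field; rewrite ?gt_eqF ?addr_gt0.
have {}k2 : cm (kern g w w) <= e1.
  apply: le_trans k2 _; rewrite le_eqVlt; apply/orP; left; apply/eqP.
  by field; rewrite ?gt_eqF ?addr_gt0.
have {}k3 i : cm (kern g v (z i)) ^+ 2 <= 4 * gam ^+ 2 / c ^+ 2.
  apply: le_trans (_ : (2 * G / (c * r)) ^+ 2 <= _).
    by rewrite lerXn2r ?nnegrE ?cm_ge0 // divr_ge0 ?mulr_ge0 ?(ltW G0) ?(ltW r0) ?(ltW c0).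
  rewrite /gam le_eqVlt; apply/orP; left; apply/eqP; field; rewrite ?gt_eqF //.
have {}k4 i : cm (kern g w (z i)) ^+ 2 <= 4 * e1 ^+ 2.
  have -> : 4 * e1 ^+ 2 = (2 * e1) ^+ 2 by ring.
  by rewrite lerXn2r ?nnegrE ?cm_ge0 // mulr_ge0 // ltW.
pose t := (e1 * S)^-1; have t0 : 0 < t by rewrite invr_gt0 mulr_gt0.
have := H2 v w t uv uw rv rw (ltW t0); rewrite -/P => h.
have tP : 0 <= t ^+ 2 * P by rewrite mulr_ge0 // exprn_ge0 // ltW.
have sB : B * \sum_i (2 * cm (kern g v (z i)) ^+ 2 + 2 * (t ^+ 2 * P * cm (kern g w (z i)) ^+ 2)) <=
    bn * (8 * gam ^+ 2 / c ^+ 2 + 8 * e1 ^+ 2 * (t ^+ 2 * P)).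
  apply: le_trans (_ : B * \sum_(i < n) (8 * gam ^+ 2 / c ^+ 2 + 8 * e1 ^+ 2 * (t ^+ 2 * P)) <= _).
    rewrite ler_wpM2l //; apply: ler_sum => i _.
    have : t ^+ 2 * P * cm (kern g w (z i)) ^+ 2 <= t ^+ 2 * P * (4 * e1 ^+ 2) by rewrite ler_wpM2l.
    by have := k3 i; lra.
  by rewrite sumr_const card_ord -[_ *+ n]mulr_natl /bn mulrA.
have k2' : t ^+ 2 * P * cm (kern g w w) <= t ^+ 2 * P * e1 by rewrite ler_wpM2l.
have A : P / (e1 * S) <= gam / c + bn * (8 * gam ^+ 2 / c ^+ 2).
  have e2 : bn * (8 * e1 ^+ 2 * (t ^+ 2 * P)) <= bn * (8 * e1 * (t ^+ 2 * P)).
    rewrite ler_wpM2l // ler_wpM2r // ler_wpM2l // expr2.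
    by rewrite ler_piMr // ltW.
  have tE : t ^+ 2 * P * e1 + bn * (8 * e1 * (t ^+ 2 * P)) = P * t.
    rewrite /t /S; field; rewrite ?gt_eqF //.
  rewrite -/t; lra.
have {}A : P <= e1 * S * (gam / c + bn * (8 * gam ^+ 2 / c ^+ 2)).
  by rewrite mulrC -ler_pdivrMr // mulr_gt0.
have Bd : gam / c + bn * (8 * gam ^+ 2 / c ^+ 2) <= gam ^+ 2 * Q.
  have : gam / c <= gam ^+ 2 / (c * delta).
    rewrite ler_pdivrMr // mulrAC ler_pdivlMr ?mulr_gt0 // expr2.
    have : gam * delta <= gam * gam by rewrite ler_wpM2l ?ltW.
    nra.
  rewrite /Q mulrDr -[gam ^+ 2 * (c * delta)^-1]/(gam ^+ 2 / (c * delta)); lra.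
have : e1 * S * (gam / c + bn * (8 * gam ^+ 2 / c ^+ 2)) <= e1 * S * (gam ^+ 2 * Q).
  by rewrite ler_wpM2l // mulr_ge0 ?ltW.
have : gam ^+ 2 * (e1 * S * Q) <= gam ^+ 2 * 32^-1 by rewrite ler_wpM2l ?exprn_ge0 // ltW.
have : 0 < gam ^+ 2 by rewrite exprn_gt0.
lra.
Qed.

(** Poles cannot lie far out in a sector: close to a pole the function exceeds
    the bound that holds at the regular points of a slightly larger sector. *)
Lemma small_sector kappa g (c delta : R) : nevanlinna kappa g -> small g ->
  0 < c -> 0 < delta -> exists r0, forall v, upper v -> r0 < cm v ->
    c * cm v <= complex.Im v -> exists2 u, g v = Some u & cm u <= delta * cm v.
Proof.
move=> ng sg c0 d0; have c2 : 0 < c / 2 by rewrite divr_gt0.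
have [r0 H] := small_sector_regular ng sg c2 d0.
exists (Num.max r0 1) => v uv; rewrite gt_max => /andP[vr v1] hI.
have v0 : 0 < cm v by apply: lt_trans v1.
have cI : c / 2 * cm v <= complex.Im v.
  by apply: le_trans hI; rewrite ler_wpM2r ?(ltW v0) // ler_pdivrMr // ler_peMr ?(ltW c0) // ler1n.
have [rv|[gv [p [h [p0 hh hv /dnearP[d dd0 Hd]]]]]] := nevanlinna_mero ng (upper_nonreal uv).
  have := H v uv rv vr cI; have := regular_at_neq rv.
  by case: (g v) => // u _ hu; exists u.
exfalso.
have h2 : 0 < cm (h v) / 2 by rewrite divr_gt0 ?cm_gt0.
have [e e0 He] := hol_ccont hh h2.
have [e1 e10 He1] := upper_near uv.
(* At distance s from the pole the modulus of g is at least |h(v)| / (2 s^p), and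
   s < |h(v)| / (4 M) makes this larger than the bound M; the other conditions on s
   keep the point in the sector of opening c / 2. *)
pose M := delta * (cm v + 1); have M0 : 0 < M by rewrite mulr_gt0 // addr_gt0.
have cv0 : 0 < c * cm v by rewrite mulr_gt0.
have cc : 0 < 1 + c by rewrite addr_gt0.
have [e2 e20 [e21 e22]] : exists2 e2 : R, 0 < e2 & e2 <= cm v - r0 /\ e2 * (2 * (1 + c)) <= c * cm v.
  exists (Num.min (cm v - r0) (c * cm v / (2 * (1 + c)))).
    by rewrite lt_min subr_gt0 vr /= divr_gt0 ?mulr_gt0.
  by rewrite -ler_pdivlMr ?mulr_gt0 // !ge_min !lexx orbT.
pose s := Num.min (Num.min (Num.min d e) (Num.min e1 e2)) (Num.min 1 (cm (h v) / (4 * M))) / 2.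
have hM : 0 < cm (h v) / (4 * M) by rewrite divr_gt0 ?cm_gt0 // mulr_gt0.
have s0 : 0 < s by rewrite /s divr_gt0 // !lt_min dd0 e0 e10 e20 ltr01 hM.
have [s1 s2 s3 s4 [s5 s6]] : [/\ s < d, s < e, s < e1, s < e2 & s < 1 /\ s < cm (h v) / (4 * M)].
  have sl (x : R) : Num.min (Num.min (Num.min d e) (Num.min e1 e2)) (Num.min 1 (cm (h v) / (4 * M))) <= x -> s < x.
    by move=> hx; apply: lt_le_trans hx; rewrite /s in s0 *; lra.
  by split; [..|split]; apply: sl; rewrite !ge_min lexx ?orbT.
pose w := v + s%:C.
have wv : w - v = s%:C by rewrite /w addrAC subrr add0r.
have cwv : cm (w - v) = s by rewrite wv cmR ger0_norm ?ltW.
have wnv : w != v by rewrite -subr_eq0 -cm_eq0 cwv gt_eqF.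
have gw : g w = Some (h w / (w - v) ^+ p) by apply: Hd => //; rewrite cwv.
have uw : upper w by apply: He1; rewrite cwv.
have Iw : complex.Im w = complex.Im v by rewrite /w ImD /= addr0.
have cw1 : cm w <= cm v + s by have := cmD v s%:C; rewrite cmR (ger0_norm (ltW s0)).
have cw2 : cm v - s <= cm w.
  by have := cmBr v w; rewrite cmB cwv; lra.
have cIw : c / 2 * cm w <= complex.Im w.
  rewrite Iw; apply: le_trans hI; have : c * cm w <= c * (cm v + s) by rewrite ler_wpM2l // ltW.
  have : c * s <= c * cm v; last by lra.
  have cs : c * s <= c * e2 by rewrite ler_wpM2l ?(ltW c0) // ltW.
  by have : 0 < c * e2 by [rewrite mulr_gt0]; have : e2 * (2 * (1 + c)) = 2 * e2 + 2 * (c * e2) by [ring]; lra.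
have rw : regular_at g w.
  by apply: mero_regular; [exact: nevanlinna_mero ng|exact: upper_nonreal|rewrite gw].
have rr : r0 < cm w by lra.
have := H w uw rw rr cIw; rewrite gw /= cmM cmV cmX cwv.
have hw : cm (h v) / 2 <= cm (h w).
  have := He w; rewrite cwv => /(_ s2); have := cmBr (h v) (h w); rewrite (cmB (h v)); lra.
have sp : s ^+ p <= s.
  by case: (p) p0 => // q _; rewrite exprS ler_piMr ?(ltW s0) // exprn_ile1 ?ltW.
rewrite ler_pdivrMr ?exprn_gt0 // => hle.
have a1 : delta * cm w * s ^+ p <= M * s.
  apply: ler_pM => //; rewrite ?mulr_ge0 ?cm_ge0 ?exprn_ge0 ?(ltW s0) ?(ltW d0) //.
  by rewrite /M ler_wpM2l ?(ltW d0) //; lra.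
have M4 : 0 < 4 * M by rewrite mulr_gt0.
move: s6; rewrite (ltr_pdivlMr _ _ M4) => s6.
have : 0 < cm (h v) by rewrite cm_gt0.
lra.
Qed.

End Nontangential2.

Section Sector.
Variable R : realType.
Local Notation C := (R[i]).
Local Notation sphere := (option C).
Implicit Types (f g tau : C -> sphere) (z w : C) (t : sphere) (y : R).

Lemma sin_sector (e theta : R) : 0 < e -> e < theta < pi - e -> sin e <= sin theta.
Proof.
move=> e0 /andP[h1 h2]; have p0 := pi_gt0 R.
have st : 0 < sin theta by apply: sin_gt0_pi; lra.
have se : 0 < sin e by apply: sin_gt0_pi; lra.
rewrite -(@ler_pXn2r _ 2) ?nnegrE ?(ltW st) ?(ltW se) // !sin2cos2.
have c1 : cos theta <= cos e.
  by apply: ltW; rewrite ltr_cos ?in_itv /=; lra.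
have c2 : - cos e <= cos theta.
  have -> : - cos e = cos (pi - e) by rewrite cosB cospi sinpi; ring.
  by apply: ltW; rewrite ltr_cos ?in_itv /=; lra.
have c3 : cos theta ^+ 2 <= cos e ^+ 2.
  have : 0 <= (cos e - cos theta) * (cos e + cos theta) by rewrite mulr_ge0 ?subr_ge0 //; lra.
  lra.
lra.
Qed.

Lemma cm_polar (r theta : R) : 0 <= r -> cm (r%:C * (cos theta +i* sin theta)) = r.
Proof.
move=> r0; rewrite cmM cmR ger0_norm // /cm /Normc.normc cos2Dsin2 sqrtr1.
by rewrite mulr1.
Qed.

Lemma sph_invE t : sph_inv t = omap -%R (mobius (mx2 0 (-1) 1 0) t).
Proof.
rewrite ninvE; case: t => [a|] /=; last by rewrite oppr0.
by rewrite /sph_div; case: eqP => //= _; rewrite opprK mul1r.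
Qed.

(** Applied to [- 1 / tau], which has finite index also when [tau] is
    identically infinite. *)
Lemma nontangential_of_small a b tau : nevanlinna2 (Posz a) (Posz b) tau -> small (ninv tau) ->
  inv_littleo_nontangential tau.
Proof.
move=> nt st e delta e0 d0.
have [z0 n0 h0] := small_point st.
have t0 : tau z0 <> Some 0 by move/ninv_None.
have [na _] := proj1 (nevanlinna2_ninv a b n0 t0) nt.
have p0 := pi_gt0 R.
have [ep|pe] := ltP e pi; last first.
  near=> r => theta; lra.
have s0 : 0 < sin e by apply: sin_gt0_pi; rewrite e0.
have [r0 H] := small_sector na st s0 d0.
exists (Num.max r0 0); split; first exact: num_real.
move=> r; rewrite gt_max => /andP[rr rp] theta ht /=.
have center_in_square := cm_polar theta (ltW rp).
set z := r%:C * _ in center_in_square *.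
have Iz : complex.Im z = r * sin theta by rewrite /z ImM /= mul0r addr0.
have ss := sin_sector e0 ht.
have uz : upper z by rewrite /upper Iz mulr_gt0 //; lra.
have [||u hu lu] := H z uz.
- by rewrite center_in_square.
- by rewrite center_in_square Iz mulrC ler_wpM2l // ltW.
exists (- u); first by rewrite sph_invE -/(ninv tau z) hu.
by rewrite !cmE cmN -rmorphM lecR.
Unshelve. all: by end_near.
Qed.

Lemma small_of_nontangential tau : inv_littleo_nontangential tau -> small (ninv tau).
Proof.
move=> H e e0; have p0 := pi_gt0 R.
have p4 : 0 < pi / 4 :> R by rewrite divr_gt0.
have [Y [_ HY]] := H (pi / 4) e p4 e0.
exists (Num.max Y 0) => y; rewrite gt_max => /andP[yY y0].
have hp1 : (pi : R) / 4 < pi / 2 by lra.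
have hp2 : (pi : R) / 2 < pi - pi / 4 by lra.
have := HY y yY (pi / 2); rewrite hp1 hp2 => /(_ isT); rewrite cos_pihalf sin_pihalf.
have -> : y%:C * (0 +i* 1) = 0 +i* y.
  by apply/eqP; rewrite eq_complex /= !(mulr0, mul0r, mulr1, subr0, addr0) !eqxx.
case=> v hv lv; exists (- v).
  by move: hv; rewrite sph_invE -/(ninv tau _); case: (ninv tau _) => //= u [<-]; rewrite opprK.
by move: lv; rewrite !cmE cmN cm_iy ?(ltW y0) // -rmorphM lecR.
Qed.

End Sector.

(** * Hankel matrices and reciprocal power series *)

Section HankelAlgebra.
Variable R : realType.
Implicit Types (c d s : nat -> R) (n nu : nat).

Definition conv c d k := \sum_(a < k.+1) c a * d (k - a)%N.

(** [Tz n c] represents multiplication by the power series [c] modulo [x^n], and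
    [Hk n c] is the coefficient matrix of the divided difference
    [(c(x) - c(y)) / (x - y)]. *)
Definition Tz n c : 'M[R]_n := \matrix_(i, j) if (i <= j)%N then c (j - i)%N else 0.
Definition Hk n c : 'M[R]_n := \matrix_(i, j) c (i + j).+1.

Lemma convC c d k : conv c d k = conv d c k.
Proof.
rewrite /conv (reindex_inj rev_ord_inj) /=; apply: eq_bigr => i _.
by rewrite subSS subKn 1?mulrC // -ltnS.
Qed.

Lemma sum_ord_le n (F : nat -> R) j : (j < n)%N ->
  \sum_(l < n) (if (l <= j)%N then F l else 0) = \sum_(l < j.+1) F l.
Proof.
move=> jn; rewrite -big_mkcond /= (big_ord_widen_cond n (fun=> true) F) //.
Qed.

Lemma TzM n c d : Tz n (conv c d) = Tz n c *m Tz n d.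
Proof.
apply/matrixP => i j; rewrite !mxE.
have [ij|ji] := leqP i j; last first.
  rewrite big1 // => l _; rewrite !mxE; have [il|] := leqP i l; last by rewrite mul0r.
  by have [lj|] := leqP l j; [have := leq_trans il lj; rewrite leqNgt ji|rewrite mulr0].
transitivity (\sum_(l < n) (if (l <= j)%N then (if (i <= l)%N then c (l - i)%N else 0) * d (j - l)%N else 0)); last first.
  apply: eq_bigr => l _; rewrite !mxE; case: (l <= j)%N => //; by rewrite mulr0.
rewrite (@sum_ord_le n (fun l => (if (i <= l)%N then c (l - i)%N else 0) * d (j - l)%N)) //.
have jE : j.+1 = (i + (j - i).+1)%N by rewrite addnS subnKC.
rewrite jE big_split_ord /= [X in _ = X + _]big1 ?add0r; last first.
  by move=> l _; rewrite leqNgt ltn_ord mul0r.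
by apply: eq_bigr => l _; rewrite leq_addr addKn subnDA.
Qed.

(** The product rule for divided differences. *)
Lemma HkM n c d : Hk n (conv c d) = (Tz n c)^T *m Hk n d + Hk n c *m Tz n d.
Proof.
apply/matrixP => i j; rewrite !mxE.
have -> : \sum_(l < n) (Tz n c)^T i l * Hk n d l j = \sum_(a < i.+1) c a * d ((i + j).+1 - a)%N.
  transitivity (\sum_(l < n) if (l <= i)%N then c (i - l)%N * d (l + j).+1 else 0).
    by apply: eq_bigr => l _; rewrite !mxE; case: ifP => // _; rewrite mul0r.
  rewrite (@sum_ord_le n (fun l => c (i - l)%N * d (l + j).+1)) //.
  rewrite (reindex_inj rev_ord_inj) /=; apply: eq_bigr => a _.
  have ai : (a <= i)%N by rewrite -ltnS.
  by rewrite subSS subKn //; congr (_ * d _); lia.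
have -> : \sum_(l < n) Hk n c i l * Tz n d l j = \sum_(a < j.+1) c (i + a).+1 * d (j - a)%N.
  transitivity (\sum_(l < n) if (l <= j)%N then c (i + l).+1 * d (j - l)%N else 0).
    by apply: eq_bigr => l _; rewrite !mxE; case: ifP => // _; rewrite mulr0.
  by rewrite (@sum_ord_le n (fun l => c (i + l).+1 * d (j - l)%N)).
rewrite /conv; have -> : (i + j).+2 = (i.+1 + j.+1)%N by rewrite addSn addnS.
rewrite big_split_ord /=; congr (_ + _).
by apply: eq_bigr => a _; rewrite addSn subSS subnDl.
Qed.

Lemma eq_Tz n c d : (forall k, (k < n)%N -> c k = d k) -> Tz n c = Tz n d.
Proof.
move=> H; apply/matrixP => i j; rewrite !mxE; case: leqP => // _; apply: H.
by apply: leq_ltn_trans (leq_subr _ _) _.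
Qed.

Definition series_one k : R := (k == 0%N)%:R.

Lemma Tz1 n : Tz n series_one = 1%:M.
Proof.
apply/matrixP => i j; rewrite !mxE /series_one; case: leqP => ij.
  by rewrite subn_eq0 -val_eqE /= eqn_leq ij.
by rewrite -val_eqE /= gtn_eqF.
Qed.

Lemma Tz_unit n c : c 0%N != 0 -> Tz n c \in unitmx.
Proof.
move=> c0; rewrite -unitmx_tr unitmxE unitfE det_trig.
  by apply/prodf_neq0 => i _; rewrite !mxE leqnn subnn.
by apply/is_trig_mxP => i j ij; rewrite !mxE leqNgt ij.
Qed.

Lemma conv_inv_uniq c d e K : c 0%N != 0 -> (forall k, (k <= K)%N -> conv c d k = series_one k) ->
  (forall k, (k <= K)%N -> conv c e k = series_one k) -> forall k, (k <= K)%N -> d k = e k.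
Proof.
move=> c0 hd he k kK.
have E x : (forall k, (k <= K)%N -> conv c x k = series_one k) -> Tz K.+1 c *m Tz K.+1 x = 1%:M.
  by move=> H; rewrite -TzM -Tz1; apply: eq_Tz => l; rewrite ltnS; exact: H.
have : Tz K.+1 d = Tz K.+1 e.
  have u := Tz_unit K.+1 c0.
  by rewrite -[Tz _ d](mulKmx u) (E d hd) -(E e he) mulKmx.
move/matrixP/(_ ord0 (inord k)); rewrite !mxE /= subn0 inordK //.
Qed.

(** [Hk n] of the power series [x^nu c]. *)
Definition Hc n nu c : 'M[R]_n :=
  \matrix_(i, j) if (nu <= (i + j).+1)%N then c ((i + j).+1 - nu)%N else 0.

Definition series_Xn nu k : R := (k == nu)%:R.

Lemma conv_Xn nu c k : conv c (series_Xn nu) k = if (nu <= k)%N then c (k - nu)%N else 0.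
Proof.
rewrite /conv /series_Xn; case: leqP => h.
  have lt : (k - nu < k.+1)%N by rewrite ltnS leq_subr.
  rewrite (bigD1 (Ordinal lt)) //= subKn // eqxx mulr1 big1 ?addr0 // => i ne.
  case: eqP => [E|]; last by rewrite mulr0.
  by case/eqP: ne; apply: val_inj => /=; have := ltn_ord i; lia.
by rewrite big1 // => i _; rewrite (_ : (k - i == nu)%N = false) ?mulr0 //; lia.
Qed.

Lemma Hk_conv_Xn n nu c : Hk n (conv c (series_Xn nu)) = Hc n nu c.
Proof. by apply/matrixP => i j; rewrite !mxE conv_Xn. Qed.

Lemma Tz_comm n c d : Tz n c *m Tz n d = Tz n d *m Tz n c.
Proof. by rewrite -!TzM; apply: eq_Tz => k _; exact: convC. Qed.

(** By the product rule, [Hk (x^nu c)] with [c d = 1] equals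
    [Tz c^T X Tz c] with [X = Hk (x^nu) Tz d - Hk d Tz (x^nu)], because
    [0 = Hk (c d) = Tz c^T Hk d + Hk c Tz d]. The two terms of [X] cancel outside
    two diagonal blocks. *)
Lemma hankel_congr_full n nu c d : (nu <= n)%N ->
  (forall k, (k < n.*2)%N -> conv c d k = series_one k) ->
  Hc n nu c = (Tz n c)^T *m (\matrix_(i, j)
    (if (i < nu)%N && (j < nu)%N then (if (nu <= (i + j).+1)%N then d ((i + j).+1 - nu)%N else 0)
     else if (nu <= i)%N && (nu <= j)%N then - d ((i + j).+1 - nu)%N else 0)) *m Tz n c.
Proof.
move=> nun H.
pose X := Hk n (series_Xn nu) *m Tz n d - Hk n d *m Tz n (series_Xn nu).
have XE : \matrix_(i < n, j < n)
    (if (i < nu)%N && (j < nu)%N then (if (nu <= (i + j).+1)%N then d ((i + j).+1 - nu)%N else 0)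
     else if (nu <= i)%N && (nu <= j)%N then - d ((i + j).+1 - nu)%N else 0) = X.
  apply/matrixP => i j; rewrite !mxE.
  have -> : \sum_l Hk n (series_Xn nu) i l * Tz n d l j =
      if (i < nu)%N && (nu <= (i + j).+1)%N then d ((i + j).+1 - nu)%N else 0.
    case: ifP => [/andP[h1 h2]|h].
      have lt : (nu - i.+1 < n)%N by have := ltn_ord i; lia.
      rewrite (bigD1 (Ordinal lt)) //= !mxE /series_Xn /= big1.
        have -> : ((i + (nu - i.+1)).+1 == nu)%N by lia.
        have -> : (nu - i.+1 <= j)%N by lia.
        by rewrite mul1r addr0; congr d; lia.
      move=> l ne; rewrite !mxE /series_Xn; case: eqP => [E|]; last by rewrite mul0r.
      by case/eqP: ne; apply: val_inj => /=; lia.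
    rewrite big1 // => l _; rewrite !mxE /series_Xn; case: eqP => [E|]; last by rewrite mul0r.
    case: leqP => [lj|]; last by rewrite mulr0.
    suff : false by []; rewrite -h; apply/andP; split; lia.
  have -> : \sum_l Hk n d i l * Tz n (series_Xn nu) l j = if (nu <= j)%N then d ((i + j).+1 - nu)%N else 0.
    case: leqP => h.
      have lt : (j - nu < n)%N by have := ltn_ord j; lia.
      rewrite (bigD1 (Ordinal lt)) //= !mxE /series_Xn /= big1.
        have -> : (j - nu <= j)%N by lia.
        have -> : (j - (j - nu) == nu)%N by lia.
        by rewrite mulr1 addr0; congr d; lia.
      move=> l ne; rewrite !mxE /series_Xn; case: leqP => [lj|]; last by rewrite mulr0.
      case: eqP => [E|]; last by rewrite mulr0.
      by case/eqP: ne; apply: val_inj => /=; lia.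
    rewrite big1 // => l _; rewrite !mxE /series_Xn; case: leqP => [lj|]; last by rewrite mulr0.
    by case: eqP => [E|]; rewrite ?mulr0 //; lia.
  case: (ltnP i nu) => hi /=; case: (ltnP j nu) => hj /=.
  - by rewrite subr0.
  - by rewrite (_ : (nu <= (i + j).+1)%N); [rewrite subrr|lia].
  - by rewrite subrr.
  - by rewrite sub0r.
rewrite XE /X.
have Tcd : Tz n c *m Tz n d = 1%:M.
  by rewrite -TzM -Tz1; apply: eq_Tz => k kn; apply: H; lia.
have Tdc : Tz n d *m Tz n c = 1%:M by rewrite Tz_comm.
have H0 : (Tz n c)^T *m Hk n d = - (Hk n c *m Tz n d).
  apply/eqP; rewrite -addr_eq0 -HkM; apply/eqP/matrixP => i j; rewrite !mxE H //.
  by have := ltn_ord i; have := ltn_ord j; lia.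
rewrite -Hk_conv_Xn HkM mulmxBr mulmxBl !mulmxA H0 !mulNmx opprK.
rewrite -[(Tz n c)^T *m Hk n (series_Xn nu) *m Tz n d *m Tz n c]mulmxA Tdc mulmx1; congr (_ + _).
rewrite -[Hk n c *m Tz n d *m Tz n (series_Xn nu) *m _]mulmxA [Tz n (series_Xn nu) *m _]Tz_comm.
by rewrite mulmxA -[Hk n c *m Tz n d *m _]mulmxA Tdc mulmx1.
Qed.

(** The reciprocal power series up to [x^K], read off the first row of the
    inverse Toeplitz matrix as in the Schur recursion; see [recipP]. *)
Definition recip K c : nat -> R := fun i => invmx (Tz K.+1 c) ord0 (inord i).

Lemma recipP K c : c 0%N != 0 -> forall k, (k <= K)%N -> conv c (recip K c) k = series_one k.
Proof.
move=> c0 k kK; have u := Tz_unit K.+1 c0.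
have := mulVmx u => /matrixP/(_ ord0 (inord k)); rewrite !mxE.
rewrite -[ord0 == _]val_eqE /= inordK // eq_sym -/(series_one k) => <-.
rewrite convC /conv.
transitivity (\sum_(l < K.+1) if (l <= k)%N then recip K c l * c (k - l)%N else 0); last first.
  apply: eq_bigr => l _; rewrite !mxE inordK // /recip inord_val.
  by case: ifP => // _; rewrite mulr0.
by rewrite (@sum_ord_le _ (fun l => recip K c l * c (k - l)%N)).
Qed.

(** Only the coefficients of [c] up to [x^K] enter, so [d] need only be a
    reciprocal up to that order. *)
Lemma hankel_congr n' nu c d K : c 0%N != 0 -> (forall k, (k <= K)%N -> conv c d k = series_one k) ->
  (nu + n'.*2 <= K.+1)%N ->
  Hc (nu + n') nu c = (Tz (nu + n') c)^T *m
    block_mx (Hc nu nu d) 0 0 (\matrix_(i, j) - d (nu + (i + j).+1)%N) *m Tz (nu + n') c.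
Proof.
move=> c0 hd hK; set n := (nu + n')%N.
pose e := recip n.*2 c.
have he k : (k <= n.*2)%N -> conv c e k = series_one k by exact: recipP.
have de k : (k <= minn K n.*2)%N -> d k = e k.
  apply: (@conv_inv_uniq c) => // l; rewrite leq_min => /andP[? ?]; [exact: hd|exact: he].
rewrite (@hankel_congr_full n nu c e) ?leq_addr //; last by move=> k /ltnW; exact: he.
congr (_ *m _ *m _); apply/matrixP => i j; rewrite -(splitK i) -(splitK j).
have K1 (a b : nat) : (a < nu)%N -> (b < nu)%N -> d ((a + b).+1 - nu)%N = e ((a + b).+1 - nu)%N.
  by move=> ha hb; apply: de; rewrite leq_min /n; lia.
case: (fintype.split i) => i'; case: (fintype.split j) => j' /=.
- by rewrite block_mxEul !mxE /= !ltn_ord /= K1.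
- rewrite block_mxEur !mxE /= ltn_ord /= [(nu + j' < nu)%N]ltnNge leq_addr /=.
  by rewrite leqNgt ltn_ord.
- rewrite block_mxEdl !mxE /= ltn_ord /= [(nu + i' < nu)%N]ltnNge leq_addr /=.
  by rewrite leqNgt ltn_ord.
- rewrite block_mxEdr !mxE /= [(nu + i' < nu)%N]ltnNge !leq_addr /= de.
    by congr (- e _); lia.
  by rewrite leq_min /n; have := ltn_ord i'; have := ltn_ord j'; lia.
Qed.

(** The matrix is triangular with respect to the antidiagonal, on which all
    entries are [c 0]. *)
Lemma det_anti n c : (\det (Hc n n c) != 0) = (n == 0%N) || (c 0%N != 0).
Proof.
case: n => [|n]; first by rewrite det_mx00 oner_eq0.
(* Reversing the columns makes the matrix triangular. *)
pose S := Hc n.+1 n.+1 c; pose Q := perm_mx (perm rev_ord_inj) : 'M[R]_n.+1.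
have dQ : \det Q != 0 by rewrite det_perm signr_eq0.
have -> : (\det S != 0) = (\det (S *m Q) != 0).
  by rewrite det_mulmx mulf_eq0 (negbTE dQ) orbF.
have SQ i j : (S *m Q) i j = S i (rev_ord j).
  rewrite mxE (bigD1 (rev_ord j)) //= !mxE permE rev_ordK eqxx mulr1.
  rewrite big1 ?addr0 // => k ne; rewrite !mxE permE; case: eqP => [E|]; last by rewrite mulr0.
  by case/eqP: ne; rewrite -[k]rev_ordK E.
rewrite det_trig; last first.
  by apply/is_trig_mxP => i j ij; rewrite SQ mxE /=; case: leqP => //; have := ltn_ord j; lia.
under eq_bigr => i _.
  rewrite SQ mxE /=.
  have -> : (n < (i + (n.+1 - i.+1)).+1)%N by have := ltn_ord i; lia.
  have -> : ((i + (n.+1 - i.+1)).+1 - n.+1)%N = 0%N by have := ltn_ord i; lia.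
  over.
by rewrite prodr_const card_ord expf_eq0.
Qed.

End HankelAlgebra.

(** * Hankel matrices under one Schur step *)

Section Padding.
Variable R : realType.
Implicit Types (P : {poly R}) (n d : nat).

Lemma nu_minus0 n : nu_minus (0 : 'M[R]_n) = 0%N.
Proof.
have := nu_minus_hns (trmx0 R n n); rewrite /cmx map_mx0 => /has_negative_squares_max[h _].
exact: zero_form_negdim h.
Qed.

(** The Hankel matrix of [P] padded to any size. *)
Definition phankel_size n P : 'M[R]_n := \matrix_(a, b) P`_(a + b).+1.

Lemma nu_minus_pad n d P : (size P <= n.+1)%N -> nu_minus (phankel_size (n + d) P) = nu_minus (phankel_size n P).
Proof.
move=> sP; have -> : phankel_size (n + d) P = block_mx (phankel_size n P) 0 0 0.
  apply/matrixP => i j; rewrite -(splitK i) -(splitK j).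
  case: (fintype.split i) => i'; case: (fintype.split j) => j' /=.
  - by rewrite block_mxEul !mxE.
  - by rewrite block_mxEur !mxE /= nth_default //; apply: leq_trans sP _; lia.
  - by rewrite block_mxEdl !mxE /= nth_default //; apply: leq_trans sP _; lia.
  - by rewrite block_mxEdr !mxE /= nth_default //; apply: leq_trans sP _; lia.
rewrite nu_minus_block ?trmx0 ?nu_minus0 ?addn0 //.
by apply/matrixP => i j; rewrite !mxE addnC.
Qed.

Lemma poly_index_size n P : (size P <= n.+1)%N -> poly_index P = nu_minus (phankel_size n P).
Proof.
move=> sP; have [h|h] := leqP n (size P).
  by rewrite -(nu_minus_pad (size P - n) sP) subnKC.
by rewrite -(subnKC (ltnW h)) nu_minus_pad.
Qed.

(** Reversal is a permutation congruence; it turns the low order coefficients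
    of a reciprocal, which come in decreasing powers of [z], into a
    polynomial. *)
Lemma nu_minus_rev n (B : 'M[R]_n) : B^T = B ->
  nu_minus (\matrix_(i, j) B (rev_ord i) (rev_ord j)) = nu_minus B.
Proof.
move=> sB; pose Q := perm_mx (perm (@rev_ord_inj n)) : 'M[R]_n.
have -> : \matrix_(i, j) B (rev_ord i) (rev_ord j) = Q *m B *m Q^T.
  rewrite /Q tr_perm_mx -row_permE -col_permE.
  by apply/matrixP => i j; rewrite !mxE !permE.
by rewrite nu_minus_congr // unitmx_perm.
Qed.

End Padding.

Section RowReplace.

Lemma det_replace_first_row (A : comNzRingType) v (S : 'M[A]_v.+1) (r : 'I_v.+1 -> A) :
  \det (\matrix_(i, p) if (i < v)%N then S (inord i.+1) p else r p) =
  (-1) ^+ v * \sum_p r p * cofactor S ord0 p.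
Proof.
rewrite (expand_det_row _ ord_max) mulr_sumr; apply: eq_bigr => p _.
rewrite !mxE /= ltnn [RHS]mulrCA; congr (_ * _); rewrite /cofactor [in LHS]exprD -[LHS]mulrA; congr (_ * (_ * \det _)).
apply/matrixP => i j; rewrite !mxE lift_max ltn_ord; congr (S _ _).
by apply: val_inj; rewrite /= inordK // ltnS.
Qed.

End RowReplace.

Section Step.
Variable R : realType.
Variables (v L : nat) (s : nat -> R).
Let nu := v.+1.
Hypotheses (s_low : forall i, (i < v)%N -> s i = 0) (s_lead : s v != 0) (hL : (v.*2 <= L)%N).

Let c i := s (v + i)%N.
Let K := (L - v)%N.
Let dd := recip K c.

Let c0 : c 0%N != 0. Proof. by rewrite /c addn0. Qed.
Let hd k : (k <= K)%N -> conv c dd k = series_one R k. Proof. exact: recipP. Qed.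

Lemma step_frakE i : step_frak nu L s i = - dd (nu + i)%N.
Proof. by []. Qed.

Lemma hankel_Hc n : hankel s n = Hc n nu c.
Proof.
apply/matrixP => i j; rewrite !mxE /c /nu ltnS; case: leqP => h.
  by rewrite subSS subnKC.
by rewrite s_low.
Qed.

Lemma hankel_plus_Hc n : hankel_plus s n = Hc n v c.
Proof.
apply/matrixP => i j; rewrite !mxE /c; case: leqP => h; last by rewrite s_low.
by rewrite subnKC.
Qed.

Lemma det_hankel_neq0 : \det (hankel s nu) != 0.
Proof. by rewrite hankel_Hc det_anti c0 orbT. Qed.

(** Expansion along the row of powers shows that [m] is the first column of the
    inverse Hankel matrix. *)
Lemma step_m_coef_cof (p : 'I_nu) :
  (step_m nu s)`_p = cofactor (hankel s nu) ord0 p / \det (hankel s nu).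
Proof.
rewrite /step_m; have -> : \matrix_(i < nu, p < nu) (if (i < nu.-1)%N then (s (i + p).+1)%:P else 'X^p)
   = \matrix_(i < nu, p < nu) if (i < v)%N then (map_mx polyC (hankel s nu)) (inord i.+1) p else 'X^p.
  apply/matrixP => i q; rewrite !mxE /=; case: ifP => // iv; congr (s _)%:P.
  by rewrite inordK.
rewrite det_replace_first_row coefZ -(rmorph_sign polyC) coefCM coef_sum.
rewrite (bigD1 p) //= big1 ?addr0.
  rewrite cofactor_map_mx coefMC coefXn eqxx mul1r mulrACA -exprD.
  rewrite (_ : (nu.+1 + v)%N = (v.+1).*2); last by rewrite /nu; lia.
  by rewrite -mul2n exprM sqrrN !expr1n mul1r mulrC.
move=> q qp; rewrite cofactor_map_mx coefMC coefXn eq_sym.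
by rewrite (inj_eq val_inj) (negbTE qp) mul0r.
Qed.

Lemma step_m_size : (size (step_m nu s) <= nu)%N.
Proof.
rewrite /step_m; apply: leq_trans (size_scale_leq _ _) _.
have -> : \matrix_(i < nu, p < nu) (if (i < nu.-1)%N then (s (i + p).+1)%:P else 'X^p)
   = \matrix_(i < nu, p < nu) if (i < v)%N then (map_mx polyC (hankel s nu)) (inord i.+1) p else 'X^p.
  apply/matrixP => i q; rewrite !mxE /=; case: ifP => // iv; congr (s _)%:P.
  by rewrite inordK.
rewrite det_replace_first_row -(rmorph_sign polyC) mul_polyC; apply: leq_trans (size_scale_leq _ _) _.
apply: leq_trans (size_sum _ _ _) _; apply/bigmax_leqP => p _.
rewrite cofactor_map_mx mulrC mul_polyC; apply: leq_trans (size_scale_leq _ _) _.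
by rewrite size_polyXn ltn_ord.
Qed.

Lemma hankel_mul_m (i : 'I_nu) : \sum_(p < nu) s (i + p)%N * (step_m nu s)`_p = (i == 0%N :> nat)%:R.
Proof.
have u : hankel s nu \in unitmx by rewrite unitmxE unitfE det_hankel_neq0.
have := mulmxV u => /matrixP/(_ i ord0); rewrite !mxE -val_eqE /= => <-.
apply: eq_bigr => p _; rewrite step_m_coef_cof !mxE; congr (_ * _).
by rewrite /invmx u !mxE mulrC.
Qed.

(** The first column of the inverse Hankel matrix solves the triangular
    system that defines the reciprocal [dd], so [z m(z)] is the leading part
    of the expansion of [- 1 / f]. *)
Lemma step_m_coef k : (k <= v)%N -> (step_m nu s)`_(v - k)%N = dd k.
Proof.
apply: (@conv_inv_uniq _ c (fun k => (step_m nu s)`_(v - k)%N) dd v c0) => // {}k kv; last first.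
  by apply: hd; rewrite /K; lia.
have kn : (k < nu)%N by rewrite ltnS.
rewrite /series_one -(hankel_mul_m (Ordinal kn)) /=.
have -> : \sum_(p < nu) s (k + p)%N * (step_m nu s)`_p =
   \sum_(p < (v - k) + k.+1) s (k + p)%N * (step_m nu s)`_p.
  by have -> : nu = (v - k + k.+1)%N by rewrite /nu; lia.
rewrite big_split_ord /= big1 ?add0r; last first.
  by move=> p _; rewrite s_low ?mul0r //; have := ltn_ord p; lia.
apply: eq_bigr => a _; have := ltn_ord a => ha.
by rewrite /c; congr (s _ * _`_ _); lia.
Qed.

Lemma step_m_lead : (step_m nu s)`_v = (s v)^-1.
Proof.
have := hd (leq0n K); rewrite /conv big_ord1 /= -(step_m_coef (leq0n v)) subn0 /c addn0 /series_one eqxx => h.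
by apply: (mulfI s_lead); rewrite h mulfV.
Qed.

Let m := step_m nu s.

(** The upper left block of [hankel_congr] is the Hankel matrix of [z m(z)] with
    rows and columns reversed. *)
Lemma nu_minus_low : nu_minus (Hc nu nu dd) = poly_index ('X * m).
Proof.
rewrite (@poly_index_size _ nu); last first.
  by apply: leq_trans (size_polyMleq _ _) _; rewrite size_polyX /=; exact: step_m_size.
rewrite -[RHS]nu_minus_rev; last by apply/matrixP => i j; rewrite !mxE addnC.
congr nu_minus; apply/matrixP => i j; rewrite [LHS]mxE [RHS]mxE [RHS]mxE coefXM /=.
have := ltn_ord i; have := ltn_ord j; rewrite /nu => hj hi.
case: leqP => h.
  by rewrite nth_default //; apply: leq_trans step_m_size _; lia.
by rewrite -step_m_coef /m; [congr (_`_ _)|]; lia.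
Qed.

Lemma nu_minus_low_plus : nu_minus (Hc v v dd) = poly_index m.
Proof.
rewrite (@poly_index_size _ v); last exact: step_m_size.
rewrite -[RHS]nu_minus_rev; last by apply/matrixP => i j; rewrite !mxE addnC.
congr nu_minus; apply/matrixP => i j; rewrite [LHS]mxE [RHS]mxE [RHS]mxE /=.
have := ltn_ord i; have := ltn_ord j => hj hi.
case: leqP => h.
  by rewrite -step_m_coef /m; [congr (_`_ _)|]; lia.
by rewrite nth_default //; apply: leq_trans step_m_size _; lia.
Qed.

Lemma Hc_sym n k (e : nat -> R) : (Hc n k e)^T = Hc n k e.
Proof. by apply/matrixP => i j; rewrite !mxE addnC. Qed.

Lemma hankel_sym n (e : nat -> R) : (hankel e n)^T = hankel e n.
Proof. by apply/matrixP => i j; rewrite !mxE addnC. Qed.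

Lemma hankel_plus_sym n (e : nat -> R) : (hankel_plus e n)^T = hankel_plus e n.
Proof. by apply/matrixP => i j; rewrite !mxE addnC. Qed.

Lemma nu_minus_Tcongr n (e : nat -> R) (B : 'M[R]_n) : e 0%N != 0 -> B^T = B ->
  nu_minus ((Tz n e)^T *m B *m Tz n e) = nu_minus B.
Proof.
move=> e0 sB; rewrite -{2}[Tz n e]trmxK; apply: nu_minus_congr => //.
by rewrite unitmx_tr; exact: Tz_unit.
Qed.

Lemma det_Tcongr n (e : nat -> R) (B : 'M[R]_n) : e 0%N != 0 ->
  (\det ((Tz n e)^T *m B *m Tz n e) != 0) = (\det B != 0).
Proof.
move=> e0; have := Tz_unit n e0; rewrite unitmxE unitfE => u.
by rewrite !det_mulmx det_tr !mulf_eq0 (negbTE u) orbF.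
Qed.

(** At the last level the lower right block of [hankel_congr] is empty. The
    coefficients are known exactly as far as the upper left block needs them. *)
Lemma last_nu_minus : nu_minus (hankel s nu) = poly_index ('X * m).
Proof.
rewrite hankel_Hc -nu_minus_low.
have hE : Hc nu nu c = (Tz nu c)^T *m Hc nu nu dd *m Tz nu c.
  rewrite (@hankel_congr_full R nu nu c (recip nu.*2 c)) //; last first.
    by move=> k /ltnW; exact: recipP.
  congr (_ *m _ *m _); apply/matrixP => i j; rewrite !mxE !ltn_ord /=.
  case: leqP => // h; apply: (@conv_inv_uniq _ c _ _ v c0) => //.
  - by move=> k kv; apply: recipP => //; rewrite /nu; lia.
  - by move=> k kv; apply: hd; rewrite /K; lia.
  - by have := ltn_ord i; have := ltn_ord j; rewrite /nu; lia.
by rewrite hE nu_minus_Tcongr // Hc_sym.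
Qed.

Lemma last_nu_minus_plus : nu_minus (hankel_plus s v) = poly_index m.
Proof.
rewrite hankel_plus_Hc -nu_minus_low_plus.
have hE : Hc v v c = (Tz v c)^T *m Hc v v dd *m Tz v c.
  rewrite (@hankel_congr_full R v v c (recip v.*2 c)) //; last first.
    by move=> k /ltnW; exact: recipP.
  congr (_ *m _ *m _); apply/matrixP => i j; rewrite !mxE !ltn_ord /=.
  case: leqP => // h; apply: (@conv_inv_uniq _ c _ _ v c0) => //.
  - by move=> k kv; apply: recipP => //; lia.
  - by move=> k kv; apply: hd; rewrite /K; lia.
  - by have := ltn_ord i; have := ltn_ord j; lia.
by rewrite hE nu_minus_Tcongr // Hc_sym.
Qed.

Section Inner.
Hypothesis hL2 : (nu.*2 <= L)%N.

Let fr := step_frak nu L s.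
Let K' := (L - nu.*2).+1.
Let ee := recip K' fr.
Let s' := step_seq nu L s.

Lemma step_seqE i : s' i = - ee i.+1.
Proof. by []. Qed.

(** The upper left block of [hankel_congr] is always invertible, so a minor is
    nonzero if and only if the lower right block is. *)
Lemma det_hankel_fr n' : ((nu + n').*2 <= L.+2)%N ->
  (\det (hankel s (nu + n')) != 0) = (\det (Hc n' 0 fr) != 0).
Proof.
move=> hn; rewrite hankel_Hc (@hankel_congr R n' nu c dd K c0 hd); last by (move: hL2 hn; rewrite /K /nu; lia).
rewrite det_Tcongr // det_ublock mulf_eq0 negb_or det_anti.
have -> : dd 0%N != 0 by rewrite -(step_m_coef (leq0n v)) subn0 step_m_lead invr_eq0.
by rewrite orbT.
Qed.

Lemma det_hankel_plus_fr n' : ((v + n').*2 <= L.+1)%N ->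
  (\det (hankel_plus s (v + n')) != 0) = (\det (Hc n' 1 fr) != 0).
Proof.
move=> hn; rewrite hankel_plus_Hc (@hankel_congr R n' v c dd K c0 hd); last by (move: hL2 hn; rewrite /K /nu; lia).
rewrite det_Tcongr // det_ublock mulf_eq0 negb_or det_anti.
have -> : dd 0%N != 0 by rewrite -(step_m_coef (leq0n v)) subn0 step_m_lead invr_eq0.
rewrite orbT /=; congr (\det _ != 0).
apply/matrixP => i j; rewrite !mxE /= subSS subn0 /fr step_frakE.
by congr (- dd _); rewrite /nu; lia.
Qed.

Hypothesis fr0 : fr 0%N != 0.

Let he k : (k <= K')%N -> conv fr ee k = series_one R k. Proof. exact: recipP. Qed.

(** A second reciprocal, now with [nu = 0], leads from [fr] to the next
    sequence [s']. *)
Lemma fr_congr n' : (n'.*2 <= K'.+1)%N -> Hc n' 0 fr = (Tz n' fr)^T *m hankel s' n' *m Tz n' fr.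
Proof.
move=> hn; rewrite (@hankel_congr R n' 0 fr ee K' fr0 he) //; congr (_ *m _ *m _).
apply/matrixP => i j.
have E (k : 'I_n') : rshift 0 k = k :> 'I_(0 + n') by apply: val_inj.
have := block_mxEdr (Hc 0 0 ee) 0 0 (\matrix_(i < n', j < n') - ee (0 + (i + j).+1)%N) i j.
by rewrite !E => ->; rewrite !mxE.
Qed.

(** For the shifted matrices the second reciprocal is taken with [nu = 1]; the
    block of size 1 holds the constant [l]. *)
Lemma fr_congr_plus n' : (1 + n'.*2 <= K'.+1)%N ->
  Hc (1 + n') 1 fr = (Tz (1 + n') fr)^T *m block_mx (const_mx (ee 0%N)) 0 0 (hankel_plus s' n') *m Tz (1 + n') fr.
Proof.
move=> hn; rewrite (@hankel_congr R n' 1 fr ee K' fr0 he) //; congr (_ *m block_mx _ _ _ _ *m _).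
by apply/matrixP => i j; rewrite !ord1 !mxE.
Qed.

Lemma ee0 : ee 0%N = (fr 0%N)^-1.
Proof.
have := he (leq0n _); rewrite /conv big_ord1 /= /series_one eqxx => h.
by apply: (mulfI fr0); rewrite h mulfV.
Qed.

(** The determinant formula for [l] gives the constant term of the second
    reciprocal, as the Toeplitz equation of the recursion requires. *)
Lemma step_lE : step_l nu s = ee 0%N.
Proof.
have cm : \sum_(p < nu) s (nu + p)%N * m`_p = fr 0%N * s v.
  have hK : (nu <= K)%N by move: hL2; rewrite /K /nu; lia.
  have := hd hK; rewrite /series_one /= /conv big_ord_recl /= subn0 => h.
  rewrite /fr step_frakE addn0 mulNr [dd _ * _]mulrC.
  have -> : s v * dd nu = c 0%N * dd nu by rewrite /c addn0.
  apply/eqP; rewrite -subr_eq0 opprK addrC; apply/eqP; rewrite -[RHS]h; congr (_ + _).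
  apply: eq_bigr => p _; rewrite /bump /= add1n subSS /m.
  rewrite -step_m_coef; last by lia.
  rewrite /c; have := ltn_ord p; rewrite /nu => hp.
  by congr (s _ * _`_ _); lia.
(* All rows but the last of the shifted matrix are rows of hankel s nu, so expanding
   along the last row brings out the cofactors, that is, m. *)
have dp : \det (hankel_plus s nu) = (-1) ^+ v * (\det (hankel s nu) * (fr 0%N * s v)).
  have -> : hankel_plus s nu = \matrix_(i, p) if (i < v)%N then hankel s nu (inord i.+1) p else s (nu + p)%N.
    apply/matrixP => i p; rewrite !mxE; case: ltnP => iv; first by rewrite inordK.
    by have -> : (i : nat) = v by [apply/eqP; rewrite eqn_leq iv andbT -ltnS ltn_ord].
  rewrite det_replace_first_row -cm [X in _ = _ * X]mulr_sumr; congr (_ * _).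
  apply: eq_bigr => p _; rewrite step_m_coef_cof; field; exact: det_hankel_neq0.
rewrite ee0 /step_l dp exprS exprS; have D := det_hankel_neq0.
have e1 : (-1) ^+ v * (-1) ^+ v = 1 :> R by rewrite -expr2 sqrr_sign.
have e2 : (-1) ^+ v != 0 :> R by rewrite signr_eq0.
have -> : nu.-1 = v by [].
by field; rewrite e2 D fr0 s_lead.
Qed.

Lemma inner_det n' : ((nu + n').*2 <= L.+2)%N ->
  (\det (hankel s (nu + n')) != 0) = (\det (hankel s' n') != 0).
Proof.
move=> hn; rewrite det_hankel_fr // fr_congr ?det_Tcongr //.
by move: hL2 hn; rewrite /K' /nu; lia.
Qed.

Lemma inner_det_plus n' : ((nu + n').*2 <= L.+1)%N ->
  (\det (hankel_plus s (nu + n')) != 0) = (\det (hankel_plus s' n') != 0).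
Proof.
move=> hn; rewrite (_ : (nu + n')%N = (v + n'.+1)%N); last by rewrite /nu; lia.
rewrite det_hankel_plus_fr; last by (move: hn; rewrite /nu; lia).
rewrite -add1n fr_congr_plus ?det_Tcongr //; last by (move: hL2 hn; rewrite /K' /nu; lia).
rewrite det_ublock mulf_eq0 negb_or; have -> : const_mx (ee 0%N) = (ee 0%N)%:M :> 'M[R]_1.
  by apply/matrixP => i j; rewrite !ord1 !mxE eqxx mulr1n.
by rewrite det_scalar1 ee0 invr_eq0 fr0.
Qed.

Lemma inner_nu_minus n' : ((nu + n').*2 <= L.+2)%N ->
  nu_minus (hankel s (nu + n')) = (poly_index ('X * m) + nu_minus (hankel s' n'))%N.
Proof.
move=> hn; rewrite hankel_Hc (@hankel_congr R n' nu c dd K c0 hd); last by (move: hL2 hn; rewrite /K /nu; lia).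
have -> : \matrix_(i < n', j < n') - dd (nu + (i + j).+1)%N = Hc n' 0 fr.
  by apply/matrixP => i j; rewrite !mxE.
rewrite nu_minus_Tcongr //; last by rewrite tr_block_mx !trmx0 !Hc_sym.
rewrite nu_minus_block ?Hc_sym // nu_minus_low fr_congr; last by (move: hL2 hn; rewrite /K' /nu; lia).
by rewrite nu_minus_Tcongr // hankel_sym.
Qed.

(** The two successive reciprocals split off the Hankel matrix of [m] and the
    number [l], that is, the Hankel matrix of [l z]. *)
Lemma inner_nu_minus_plus n' : ((nu + n').*2 <= L.+1)%N ->
  nu_minus (hankel_plus s (nu + n')) =
    (poly_index m + (poly_index (step_l nu s *: 'X) + nu_minus (hankel_plus s' n')))%N.
Proof.
move=> hn; rewrite (_ : (nu + n')%N = (v + n'.+1)%N); last by rewrite /nu; lia.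
rewrite hankel_plus_Hc (@hankel_congr R n'.+1 v c dd K c0 hd); last by (move: hL2 hn; rewrite /K /nu; lia).
have -> : \matrix_(i < n'.+1, j < n'.+1) - dd (v + (i + j).+1)%N = Hc n'.+1 1 fr.
  apply/matrixP => i j; rewrite !mxE /= subSS subn0 /fr step_frakE.
  by congr (- dd _); rewrite /nu; lia.
rewrite nu_minus_Tcongr //; last by rewrite tr_block_mx !trmx0 !Hc_sym.
rewrite nu_minus_block ?Hc_sym // nu_minus_low_plus -add1n fr_congr_plus; last first.
  by move: hL2 hn; rewrite /K' /nu; lia.
have sc : (const_mx (ee 0%N) : 'M[R]_1)^T = const_mx (ee 0%N) by rewrite trmx_const.
rewrite nu_minus_Tcongr //; last by rewrite tr_block_mx !trmx0 hankel_plus_sym sc.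
rewrite nu_minus_block ?hankel_plus_sym //; congr (_ + (_ + _))%N.
rewrite (@poly_index_size _ 1); last by apply: leq_trans (size_scale_leq _ _) _; rewrite size_polyX.
by congr nu_minus; apply/matrixP => i j; rewrite !ord1 !mxE coefZ coefX mulr1 step_lE.
Qed.

End Inner.
End Step.

(** * Hankel matrices along the Schur recursion *)

Section Levels.
Variable R : realType.

(** As long as the sequence vanishes, its Hankel matrices are antitriangular. *)
Lemma hankel_leading (t : nat -> R) v :
  (forall p, (1 <= p <= v)%N -> \det (hankel t p) = 0) -> \det (hankel t v.+1) != 0 ->
  (forall i, (i < v)%N -> t i = 0) /\ t v != 0.
Proof.
move=> H D.
have lead p : (forall i, (i < p)%N -> t i = 0) -> (\det (hankel t p.+1) != 0) = (t p != 0).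
  move=> low; have -> : hankel t p.+1 = Hc p.+1 p.+1 (fun i => t (p + i)%N).
    apply/matrixP => i j; rewrite !mxE ltnS; case: leqP => h; last by rewrite low.
    by rewrite subSS subnKC.
  by rewrite det_anti addn0.
have low : forall i, (i < v)%N -> t i = 0.
  elim/ltn_ind => i IH iv; apply/eqP/negPn; rewrite -lead.
    by rewrite H ?eqxx // iv.
  by move=> j ji; apply: IH => //; apply: ltn_trans iv.
by split=> //; rewrite -lead.
Qed.

Lemma det_row0 n (A : 'M[R]_n.+1) : (forall j, A ord0 j = 0) -> \det A = 0.
Proof. by move=> h; rewrite (expand_det_row _ ord0) big1 // => j _; rewrite h mul0r. Qed.

(** Since [v.+1 + p] is the next normal index, the entries of [fr] with
    indices 1 to [p - 1] vanish. If [fr 0] vanished too, so would the first row of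
    the matrix that decides whether the shifted minor of size [v + p] is
    nonzero, contrary to regularity. *)
Lemma step_frak0_neq0 (s : nat -> R) v L p : (forall i, (i < v)%N -> s i = 0) -> s v != 0 ->
  (v.+1.*2 <= L)%N -> (0 < p)%N -> ((v.+1 + p).*2 <= L.+2)%N ->
  (forall q, (1 <= q < p)%N -> \det (hankel s (v.+1 + q)) = 0) ->
  \det (hankel s (v.+1 + p)) != 0 -> \det (hankel_plus s (v + p)) != 0 ->
  step_frak v.+1 L s 0%N != 0.
Proof.
move=> low lead hL p0 hp H D Dp; set fr := step_frak v.+1 L s.
have hv : (v.*2 <= L)%N by lia.
have E q : Hc q 0 fr = hankel (fun i => fr i.+1) q.
  by apply/matrixP => i j; rewrite !mxE.
case: p p0 hp H D Dp => // p _ hp H D Dp.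
have [|| lowf _] := @hankel_leading (fun i => fr i.+1) p.
- move=> q /andP[q1 qp]; rewrite -E; apply/eqP/negPn.
  rewrite -(det_hankel_fr low lead hv hL); last by lia.
  by rewrite H ?eqxx // q1.
- by rewrite -E -(det_hankel_fr low lead hv hL).
rewrite (det_hankel_plus_fr low lead hv hL) in Dp; last by lia.
apply: contraNneq Dp => f0; apply/eqP/det_row0 => j.
rewrite mxE /= -/fr; case: (nat_of_ord j) (ltn_ord j) => [|k] hk; first by rewrite f0.
by rewrite add0n subn1 /= lowf.
Qed.

Variables (N : nat) (n : nat -> nat) (s : nat -> R).
Hypotheses (hN : (0 < N)%N) (hn : normal_indices s N n) (hreg : regular_seq s N n).
Let ell := (2 * n N - 2)%N.
Let sq := schur_seq s n ell.
Let m := schur_m s n ell.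
Let l := schur_l s n ell.
Definition level j := (ell - (n j).*2)%N.

Lemma n_mono i j : (i < j)%N -> (j <= N)%N -> (n i < n j)%N.
Proof. by case: hn => _ h _; exact: h. Qed.

Lemma n_monoW i j : (i <= j)%N -> (j <= N)%N -> (n i <= n j)%N.
Proof. by rewrite leq_eqVlt => /orP[/eqP ->//|h1 h2]; apply/ltnW/n_mono. Qed.

(** What the sequence of level [j] inherits: its normal indices are the
    differences [n i - n j], its shifted minors there are nonzero, and the
    inertia lost so far is that of [m_1, l_1, ..., m_j, l_j]. *)
Record level_invariant j : Prop := LevelInvariant {
  level_det : forall p, (1 <= p <= n N - n j)%N -> \det (hankel (sq j) p) != 0 <->
    exists2 i, (j < i <= N)%N & p = (n i - n j)%N;
  level_plus : forall i, (j < i <= N)%N -> \det (hankel_plus (sq j) (n i - n j).-1) != 0;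
  level_kappa : nu_minus (hankel s (n N)) =
    (\sum_(1 <= i < j.+1) poly_index ('X * m i) + nu_minus (hankel (sq j) (n N - n j)))%N;
  level_k : nu_minus (hankel_plus s (n N).-1) =
    (\sum_(1 <= i < j.+1) (poly_index (m i) + poly_index (l i *: 'X)) + nu_minus (hankel_plus (sq j) (n N - n j).-1))%N }.

Lemma level_invariant0 : level_invariant 0.
Proof.
have [n0 _ hd] := hn.
split; rewrite ?n0 ?subn0 ?big_geq ?add0n //.
  move=> p hp; rewrite /sq /= hd //; split=> [[i hi ->]|[i hi ->]]; exists i => //; by rewrite subn0.
by move=> i hi; rewrite subn0; exact: hreg.
Qed.

Section Level.
Variable j : nat.
Hypotheses (jN : (j < N)%N) (gj : level_invariant j).
Let nu := (n j.+1 - n j)%N.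

Lemma nu_gt0 : (0 < nu)%N.
Proof. by rewrite subn_gt0; apply: n_mono. Qed.

Lemma level_lead : (forall i, (i < nu.-1)%N -> sq j i = 0) /\ sq j nu.-1 != 0.
Proof.
have hm : (n j.+1 <= n N)%N by apply: n_monoW.
have nu0 := nu_gt0.
apply: hankel_leading.
  move=> p /andP[p1 p2]; apply/eqP/negPn/negP => D.
  have [|i /andP[i1 i2] pE] := (level_det gj (p := p) _).1 D.
    by rewrite p1 /=; move: p2 hm; rewrite /nu; lia.
  have : (n j.+1 <= n i)%N by apply: n_monoW.
  by move: p2 pE nu0; rewrite /nu; lia.
rewrite prednK //; apply/(level_det gj).
  by move: nu0 hm; rewrite /nu; lia.
by exists j.+1 => //; rewrite ltnSn.
Qed.

End Level.

Lemma level_last j : j.+1 = N -> level j = (n N - n j).-1.*2.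
Proof.
move=> jN; have h : (n j < n N)%N by apply: n_mono => //; rewrite -jN.
by rewrite /level /ell; lia.
Qed.

Section Inner.
Variable j : nat.
Hypotheses (jN : (j.+1 < N)%N) (gj : level_invariant j).
Let nu := (n j.+1 - n j)%N.
Let jN' : (j < N)%N := ltnW jN.

Lemma level_inner : (nu.*2 <= level j)%N.
Proof.
have hm : (n j.+1 < n N)%N by apply: n_mono.
have hm2 : (n j < n j.+1)%N by apply: n_mono => //; apply: ltnW.
by rewrite /level /ell /nu; lia.
Qed.

(** Regularity at the normal index after the next makes [l] well defined. *)
Lemma level_frak0 : step_frak nu (level j) (sq j) 0%N != 0.
Proof.
have nu0 := nu_gt0 jN'; have [low lead] := level_lead jN' gj.
have hm : (n j.+1 < n j.+2)%N by apply: n_mono.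
have hm2 : (n j < n j.+1)%N by apply: n_mono => //; apply: ltnW.
have hm3 : (n j.+2 <= n N)%N by apply: n_monoW.
have hi := level_inner.
rewrite -[nu](prednK nu0); apply: (@step_frak0_neq0 _ _ _ (n j.+2 - n j.+1)) => //.
- by rewrite prednK.
- by rewrite subn_gt0.
- by rewrite prednK // /level /ell; move: nu0; rewrite /nu; lia.
- move=> q /andP[q1 q2]; rewrite prednK //; apply/eqP/negPn/negP => D.
  have [|i /andP[i1 i2] pE] := (level_det gj (p := (nu + q)%N) _).1 D.
    by move: q1 q2; rewrite /nu; lia.
  case: (ltngtP i j.+2) => ij.
  - have ij1 : i = j.+1 by apply/eqP; rewrite eqn_leq i1 -ltnS ij.
    by move: pE; rewrite ij1 /nu; lia.
  - have : (n j.+2 < n i)%N by apply: n_mono.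
    by move: pE q2; rewrite /nu; lia.
  - by move: pE q2; rewrite ij /nu; lia.
- rewrite prednK //; apply/(level_det gj); first by rewrite /nu; lia.
  by exists j.+2; [rewrite jN ltnW|rewrite /nu; lia].
have -> : (nu.-1 + (n j.+2 - n j.+1))%N = (n j.+2 - n j).-1 by rewrite /nu; lia.
by apply: (level_plus gj); rewrite jN ltnW.
Qed.

Lemma sqS : sq j.+1 = step_seq nu (level j) (sq j).
Proof. by []. Qed.

Lemma mS : m j.+1 = step_m nu (sq j).
Proof. by []. Qed.

Lemma lS : l j.+1 = step_l nu (sq j).
Proof. by []. Qed.

Lemma level_invariantS : level_invariant j.+1.
Proof.
have nu0 := nu_gt0 jN'; have [low lead] := level_lead jN' gj.
have fr0 := level_frak0; have hi := level_inner.
have hm2 : (n j < n j.+1)%N by apply: n_mono => //; apply: ltnW.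
have hm : (n j.+1 < n N)%N by apply: n_mono.
have nuE : nu = nu.-1.+1 by rewrite prednK.
have hL : (nu.-1.*2 <= level j)%N by lia.
have hL2 : (nu.-1.+1.*2 <= level j)%N by rewrite prednK.
have fr0' : step_frak nu.-1.+1 (level j) (sq j) 0%N != 0 by rewrite prednK.
have lev : (level j).+2 = (n N - n j).*2 by rewrite /level /ell; lia.
split.
- move=> p /andP[p1 p2].
  have := @inner_det _ _ _ _ low lead hL hL2 fr0' p; rewrite -nuE => D.
  rewrite sqS -D; last by rewrite lev leq_double; move: p2; rewrite /nu; lia.
  rewrite (level_det gj); last by move: p2; rewrite /nu; lia.
  split=> -[i /andP[i1 i2] E]; exists i.
  - rewrite i2 andbT ltn_neqAle i1 andbT; apply/eqP => ij.
    by move: E; rewrite -ij /nu; lia.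
  - by move: E; rewrite /nu; lia.
  - by rewrite i2 andbT ltnW.
  - have : (n j.+1 < n i)%N by apply: n_mono.
    by move: E; rewrite /nu; lia.
- move=> i /andP[i1 i2].
  have hi2 : (n j.+1 < n i)%N by apply: n_mono.
  have hi3 : (n i <= n N)%N by apply: n_monoW.
  have := @inner_det_plus _ _ _ _ low lead hL hL2 fr0' (n i - n j.+1).-1; rewrite -nuE => D.
  rewrite sqS -D; last by rewrite -ltnS lev; move: hi2 hi3; rewrite /nu; lia.
  have -> : (nu + (n i - n j.+1).-1)%N = (n i - n j).-1 by rewrite /nu; lia.
  by apply: (level_plus gj); rewrite i2 andbT ltnW.
- rewrite (level_kappa gj) (big_nat_recr j.+1) //= -addnA; congr (_ + _)%N.
  have := @inner_nu_minus _ _ _ _ low lead hL hL2 fr0' (n N - n j.+1); rewrite -nuE => E.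
  rewrite sqS mS -E; last by rewrite lev leq_double /nu; lia.
  by congr (nu_minus (hankel _ _)); rewrite /nu; lia.
rewrite (level_k gj) (big_nat_recr j.+1) //= -!addnA; congr (_ + _)%N.
have := @inner_nu_minus_plus _ _ _ _ low lead hL hL2 fr0' (n N - n j.+1).-1; rewrite -nuE => E.
rewrite sqS mS lS -E; last by rewrite -ltnS lev /nu; lia.
by congr (nu_minus (hankel_plus _ _)); rewrite /nu; lia.
Qed.
End Inner.

Lemma level_invariant_all j : (j < N)%N -> level_invariant j.
Proof.
elim: j => [|j IH] h; first exact: level_invariant0.
by apply: level_invariantS => //; apply: IH; exact: ltnW.
Qed.

Lemma index_sums :
  nu_minus (hankel s (n N)) = (\sum_(1 <= i < N.+1) poly_index ('X * m i))%N /\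
  nu_minus (hankel_plus s (n N).-1) =
    (\sum_(1 <= i < N.+1) poly_index (m i) + \sum_(1 <= i < N) poly_index (l i *: 'X))%N.
Proof.
have NE : N = N.-1.+1 by rewrite prednK.
have jN : (N.-1 < N)%N by rewrite prednK.
have g := level_invariant_all jN; have [low lead] := level_lead jN g.
have nu0 := nu_gt0 jN.
rewrite -NE in low lead nu0.
have nuE := prednK nu0.
have hL : ((n N - n N.-1).-1.*2 <= level N.-1)%N by rewrite level_last.
have hm : m N = step_m (n N - n N.-1) (sq N.-1) by [].
split.
  rewrite (level_kappa g) -NE (big_nat_recr N) //=; congr (_ + _)%N.
  by have := last_nu_minus low lead hL; rewrite nuE.
rewrite (level_k g) -NE big_split /= (big_nat_recr N) //=.
by rewrite addnAC; congr (_ + _ + _)%N; have := last_nu_minus_plus low lead hL; rewrite nuE.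
Qed.

End Levels.

(** * Asymptotic expansions on the imaginary axis *)

Section Expansions.
Variable R : realType.
Local Notation C := (R[i]).
Local Notation sphere := (option C).
Implicit Types (f g tau : C -> sphere) (F G : R -> sphere) (P Q r : {poly R}) (w : R -> R) (y : R).

Definition for_large (A : R -> Prop) := exists Y, forall y, Y < y -> A y.

Lemma for_large_gt (a : R) : for_large (fun y => a < y). Proof. by exists a. Qed.

Lemma for_large_and (A B : R -> Prop) : for_large A -> for_large B -> for_large (fun y => A y /\ B y).
Proof.
case=> Y1 h1 [Y2 h2]; exists (Num.max Y1 Y2) => y; rewrite gt_max => /andP[/h1 ? /h2 ?]; by split.
Qed.

Lemma for_large_mono (A B : R -> Prop) : (forall y, 1 < y -> A y -> B y) -> for_large A -> for_large B.
Proof.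
move=> H hA; have [Y h] := for_large_and (for_large_gt 1) hA; exists Y => y /h[]; exact: H.
Qed.

Definition inv_iy y : C := (0 +i* y)^-1.

Lemma iy_neq0 y : 0 < y -> (0 +i* y : C) != 0.
Proof. by move=> y0; rewrite -cm_gt0 cm_iy // ltW. Qed.

Lemma cm_inv_iy y : 0 < y -> cm (inv_iy y) = y^-1.
Proof. by move=> y0; rewrite /inv_iy cmV cm_iy // ltW. Qed.

(** [F y = P (1 / (i y)) + o(w y)], where [F y] has to be finite for large [y]. *)
Definition has_expansion w P F := forall e : R, 0 < e ->
  for_large (fun y => exists2 v : C, F y = Some v & cm (v - peval P (inv_iy y)) <= e * w y).

(** An affine change of the unknown function, with [b] and [d] depending on [y],
    transports an expansion in both directions provided [d] does not vanish.
    This covers multiplication by powers of [z] and the subtraction of known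
    terms. *)
Lemma expansion_affine w w' P P' F G :
  (forall y, 1 < y -> exists b d : C, [/\ d != 0, G y = omap (fun a => (a + b) * d) (F y),
     peval P' (inv_iy y) = (peval P (inv_iy y) + b) * d & cm d * w y = w' y]) ->
  has_expansion w P F <-> has_expansion w' P' G.
Proof.
move=> H; split=> h e e0; apply: for_large_mono (h e e0) => y /H[b [d [d0 E1 E2 E3]]].
  case=> v Fv lv; exists ((v + b) * d); first by rewrite E1 Fv.
  rewrite E2 -mulrBl cmM -E3 (_ : v + b - _ = v - peval P (inv_iy y)); last by ring.
  by rewrite mulrC mulrCA ler_wpM2l ?cm_ge0.
rewrite E1; case: (F y) => [a|] /= [v Gv]; last by [].
case: Gv => <-; rewrite E2 -E3 -mulrBl cmM.
rewrite (_ : a + b - _ = a - peval P (inv_iy y)); last by ring.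
by rewrite mulrCA [leLHS]mulrC ler_pM2l ?cm_gt0 // => l; exists a.
Qed.

Lemma peval_bound P : exists2 A : R, 1 <= A & forall y, 1 < y -> cm (peval P (inv_iy y)) <= A.
Proof.
exists (1 + \sum_(i < size P) `|P`_i|) => [|y y1]; first by rewrite lerDl sumr_ge0.
have y0 : 0 < y by apply: lt_trans y1.
rewrite pevalE; apply: le_trans (cm_sum _ _ _) _; apply: le_trans (_ : \sum_(i < size P) `|P`_i| <= _).
  apply: ler_sum => i _; rewrite cmM cmX cmR cm_inv_iy // ler_piMr //.
  by rewrite exprn_ile1 ?invr_ge0 ?(ltW y0) // invf_le1 // ltW.
by rewrite lerDr.
Qed.

Lemma pevalM P Q z : peval (P * Q) z = peval P z * peval Q z.
Proof. by rewrite /peval rmorphM hornerM. Qed.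
Lemma pevalD P Q z : peval (P + Q) z = peval P z + peval Q z.
Proof. by rewrite /peval rmorphD hornerD. Qed.
Lemma pevalN P z : peval (- P) z = - peval P z.
Proof. by rewrite /peval rmorphN hornerN. Qed.
Lemma peval1 z : peval (1 : {poly R}) z = 1.
Proof. by rewrite /peval rmorph1 hornerC. Qed.
Lemma pevalC (c : R) z : peval c%:P z = c%:C.
Proof. by rewrite /peval map_polyC hornerC. Qed.
Lemma pevalXn n z : peval ('X^n : {poly R}) z = z ^+ n.
Proof. by rewrite /peval map_polyXn hornerXn. Qed.
Lemma pevalX z : peval ('X : {poly R}) z = z.
Proof. by rewrite /peval map_polyX hornerX. Qed.

Definition inv_pow n : R -> R := fun y => (y ^+ n)^-1.

(** If [v = P + o(y^-n)] and [P Q = 1 + O(y^-(n+1))], then [v Q = 1 + o(y^-n)] and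
    [- 1 / v + Q = (v Q - 1) / v = o(y^-n)], as [v] is bounded away from 0. *)
Lemma expansion_inv n P Q r F : P * Q = 1 + 'X^(n.+1) * r ->
  has_expansion (inv_pow n) P F -> has_expansion (inv_pow n) (- Q) (fun y => mobius (mx2 0 (-1) 1 0) (F y)).
Proof.
move=> E h e e0.
have [A A1 hA] := peval_bound Q; have [B B1 hB] := peval_bound r.
have A0 : 0 < A by apply: lt_le_trans A1. have B0 : 0 < B by apply: lt_le_trans B1.
(* |v q - 1| <= d / y^n with d <= 1 / 2 gives |v| >= 1 / (2 A), and then the error
   is at most 2 A d / y^n <= e / y^n. *)
pose d := Num.min 2^-1 (e / (2 * A)).
have d0 : 0 < d by rewrite lt_min !divr_gt0 ?invr_gt0 ?mulr_gt0 ?ltr0n.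
have dh : d <= 2^-1 by rewrite ge_min lexx.
have dA : d * (2 * A) <= e by rewrite -ler_pdivlMr ?mulr_gt0 ?ltr0n // ge_min lexx orbT.
have e1 : 0 < d / (2 * A) by rewrite divr_gt0 ?mulr_gt0 ?ltr0n.
apply: for_large_mono (for_large_and (for_large_gt (2 * B / d)) (h _ e1)) => y y1 [yB [v Fv lv]].
have y0 : 0 < y by apply: lt_trans y1.
have wn : 0 < inv_pow n y by rewrite invr_gt0 exprn_gt0.
have wn1 : inv_pow n y <= 1 by rewrite invf_le1 ?exprn_gt0 // exprn_ege1 // ltW.
set x := inv_iy y in lv *; set q := peval Q x.
have vq : cm (v * q - 1) <= d * inv_pow n y.
  have -> : v * q - 1 = (v - peval P x) * q + x ^+ n.+1 * peval r x.
    have := congr1 (fun p => peval p x) E; rewrite pevalM pevalD pevalM peval1 pevalXn -/q => h1.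
    by rewrite mulrBl h1; ring.
  apply: le_trans (cmD _ _) _; rewrite !cmM cmX cm_inv_iy //.
  have t1 : cm (v - peval P x) * cm q <= d / 2 * inv_pow n y.
    have -> : d / 2 * inv_pow n y = d / (2 * A) * inv_pow n y * A by field; rewrite gt_eqF.
    by apply: ler_pM; rewrite ?cm_ge0 // hA.
  have t2 : y^-1 ^+ n.+1 * cm (peval r x) <= d / 2 * inv_pow n y.
    have -> : y^-1 ^+ n.+1 = inv_pow n y * y^-1 by rewrite exprVn /inv_pow exprSr invfM mulrC.
    rewrite -[leLHS]mulrA [leRHS]mulrC ler_pM2l // mulrC ler_pdivrMr //.
    apply: le_trans (hB _ y1) _; move: yB; rewrite ltr_pdivrMr // => yB; nra.
  lra.
have vq2 : cm (v * q - 1) <= 2^-1 by apply: le_trans vq _; rewrite -[leRHS]mulr1 ler_pM // ltW.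
have vq3 : 2^-1 <= cm (v * q).
  have := cmBr 1 (1 - v * q); rewrite cm1 (_ : 1 - (1 - v * q) = v * q); last by ring.
  by rewrite cmB; lra.
have vA : 1 <= cm v * (2 * A).
  have := hA _ y1; rewrite -/x -/q; move: vq3; rewrite cmM => h1 h2.
  have : cm v * cm q <= cm v * A by rewrite ler_wpM2l ?cm_ge0.
  lra.
have v0 : v != 0 by apply: contraTneq vA => ->; rewrite cm0 mul0r -ltNge ltr01.
exists (- v^-1); first by rewrite Fv ninvE (negbTE v0).
rewrite pevalN -/q (_ : - v^-1 - - q = (v * q - 1) * v^-1); last by field.
rewrite cmM cmV ler_pdivrMr ?cm_gt0 //; apply: le_trans vq _.
rewrite mulrAC ler_pM2r //; apply: le_trans (_ : d * (cm v * (2 * A)) <= _).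
  by rewrite ler_peMr // ltW.
by rewrite mulrCA mulrC ler_pM2r ?cm_gt0.
Qed.

Lemma expansion_ext w P F G : (forall y, 1 < y -> F y = G y) -> has_expansion w P F -> has_expansion w P G.
Proof. by move=> E h e e0; apply: for_large_mono (h e e0) => y /E ->. Qed.

Lemma mobius_ninvK t : mobius (mx2 0 (-1) 1 0) (mobius (mx2 0 (-1) 1 0) t) = t :> sphere.
Proof. exact: (ninvK (fun=> t) 0). Qed.

(** Inversion is an involution on functions, and [P], [Q] play symmetric
    roles. *)
Lemma expansion_invP n P Q r F : P * Q = 1 + 'X^(n.+1) * r ->
  has_expansion (inv_pow n) P F <-> has_expansion (inv_pow n) (- Q) (fun y => mobius (mx2 0 (-1) 1 0) (F y)).
Proof.
move=> E; split; first exact: (expansion_inv E).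
have E2 : (- Q) * (- P) = 1 + 'X^(n.+1) * r by rewrite mulrNN mulrC.
move/(expansion_inv E2); rewrite opprK; apply: expansion_ext => y _; exact: mobius_ninvK.
Qed.

Lemma expansion_small n P g : has_expansion (inv_pow n) P (fun y => g (0 +i* y)) -> small g.
Proof.
move=> h e e0; have [A A1 hA] := peval_bound P.
apply: for_large_mono (for_large_and (for_large_gt ((A + 1) / e)) (h 1 ltr01)) => y y1 [yA [v gv lv]].
have y0 : 0 < y by apply: lt_trans y1.
exists v => //; have := cmD (v - peval P (inv_iy y)) (peval P (inv_iy y)); rewrite subrK => h1.
apply: le_trans h1 _; move: yA; rewrite ltr_pdivrMr // => yA.
have wn1 : inv_pow n y <= 1 by rewrite invf_le1 ?exprn_gt0 // exprn_ege1 // ltW.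
by have := hA _ y1; rewrite mulrC; lra.
Qed.

Lemma expansion_vanish n Q g : has_expansion (inv_pow n) ('X * Q) (fun y => g (0 +i* y)) -> vanish g.
Proof.
move=> h e e0; have [A A1 hA] := peval_bound Q.
have e2 : 0 < e / 2 by rewrite divr_gt0 ?ltr0n.
apply: for_large_mono (for_large_and (for_large_gt (A / (e / 2))) (h _ e2)) => y y1 [yA [v gv lv]].
have y0 : 0 < y by apply: lt_trans y1.
exists v => //; have := cmD (v - peval ('X * Q) (inv_iy y)) (peval ('X * Q) (inv_iy y)); rewrite subrK => h1.
apply: le_trans h1 _.
have wn1 : inv_pow n y <= 1 by rewrite invf_le1 ?exprn_gt0 // exprn_ege1 // ltW.
have t1 : e / 2 * inv_pow n y <= e / 2 by rewrite ler_piMr // ltW.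
have t2 : cm (peval ('X * Q) (inv_iy y)) <= e / 2.
  rewrite pevalM pevalX cmM cm_inv_iy // mulrC ler_pdivrMr //; apply: le_trans (hA _ y1) _.
  by move: yA; rewrite ltr_pdivrMr // mulrC => /ltW.
lra.
Qed.

Lemma small_expansion g : small g <-> has_expansion id 0 (fun y => g (0 +i* y)).
Proof.
split=> h e e0; apply: for_large_mono (h e e0) => y _ [v gv lv]; exists v => //.
  by rewrite -polyC0 pevalC subr0.
by move: lv; rewrite -polyC0 pevalC subr0.
Qed.

Lemma poly_recip K (c d : nat -> R) : (forall k, (k <= K)%N -> conv c d k = series_one R k) ->
  exists r, (\poly_(i < K.+1) c i) * (\poly_(i < K.+1) d i) = 1 + 'X^(K.+1) * r.
Proof.
move=> H; set P := _ * _; exists (drop_poly K.+1 P).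
rewrite -[LHS](poly_take_drop K.+1) [X in _ + X]mulrC; congr (_ + _).
apply/polyP => i; rewrite coef_take_poly coef1; case: ltnP => hi; last first.
  by case: i hi.
have := H i hi; rewrite /series_one => <-; rewrite /P coefM /conv.
apply: eq_bigr => j _; rewrite !coef_poly.
by rewrite !ifT //; [lia | have := ltn_ord j; lia].
Qed.

(** The moment condition, as an expansion in powers of [x = 1 / (i y)]. *)
Definition moment_expansion (s : nat -> R) ell f :=
  has_expansion (inv_pow ell.+1) (- ('X * \poly_(i < ell.+1) s i)) (fun y => f (0 +i* y)).

Lemma moment_expansion_vanish s ell f : moment_expansion s ell f -> vanish f.
Proof. by rewrite /moment_expansion -mulrN; exact: expansion_vanish. Qed.

Lemma peval_poly n (c : nat -> R) z : peval (\poly_(i < n) c i) z = \sum_(i < n) (c i)%:C * z ^+ i.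
Proof.
rewrite /peval map_polyE.
rewrite (horner_coef_wide z (n := n)); last first.
  by rewrite -map_polyE size_map_poly size_poly.
apply: eq_bigr => i _; rewrite -map_polyE coef_map coef_poly ltn_ord //.
Qed.

Lemma moment_solutionE a b s ell f :
  moment_solution a b s ell f <-> nevanlinna2 (Posz a) (Posz b) f /\ moment_expansion s ell f.
Proof.
have E y : \sum_(i < ell.+1) (s i)%:C / (0 +i* y) ^+ i.+1 = peval ('X * \poly_(i < ell.+1) s i) (inv_iy y).
  rewrite pevalM pevalX peval_poly mulr_sumr; apply: eq_bigr => i _.
  by rewrite -exprVn -/(inv_iy y) exprS mulrCA.
split.
  case=> nf nN /eqoP ho; split=> // e e0.
  have eC : 0 < e%:C by rewrite ltcR.
  have [Y [_ hY]] := ho _ eC; have [Y2 [_ hY2]] := nN.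
  apply: for_large_mono (for_large_and (for_large_gt Y) (for_large_gt Y2)) => y y1 [/hY h /hY2].
  case: (f (0 +i* y)) h => //= v h _; exists v => //.
  have y0 : 0 < y by apply: lt_trans y1.
  move: h; rewrite /= E /sph_fin /= !cmE -[_%:C * _]rmorphM lecR cmV cmX cm_iy ?(ltW y0) //.
  by rewrite pevalN opprK.
case=> nf ha; split=> //.
  have [Y hY] := ha 1 ltr01; exists Y; split; first by rewrite num_real.
  by move=> y /hY[v -> _].
apply/eqoP => e0; case: e0 => e e1; rewrite ltcE /= => /andP[/eqP -> e0].
have [Y hY] := for_large_and (for_large_gt 1) (ha e e0); exists Y; split; first by rewrite num_real.
move=> y /hY[y1 [v -> lv]]; have y0 : 0 < y by apply: lt_trans y1.
rewrite /= E /sph_fin /= !cmE -[_%:C * _]rmorphM lecR cmV cmX cm_iy ?(ltW y0) //.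
by move: lv; rewrite pevalN opprK.
Qed.

End Expansions.

(** * Asymptotic expansions under one Schur step *)

Section StepAsymptotics.
Variable R : realType.
Local Notation C := (R[i]).
Local Notation sphere := (option C).
Implicit Types (f g tau : C -> sphere) (y : R).
Variables (v L : nat) (s : nat -> R).
Let nu := v.+1.
Hypotheses (s_low : forall i, (i < v)%N -> s i = 0) (s_lead : s v != 0) (hL : (v.*2 <= L)%N).
Let c i := s (v + i)%N.
Let K := (L - v)%N.
Let dd := recip K c.
Let c0 : c 0%N != 0. Proof. by rewrite /c addn0. Qed.
Let m := step_m nu s.
Let sigma := \poly_(i < K.+1) c i.
Let mu := \poly_(i < K.+1) dd i.

(** The first [v] moments vanish, so [z^nu f] has an expansion with nonzero
    constant term. *)
Lemma moment_expansion_lead f : moment_expansion s L f <->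
  has_expansion (inv_pow K) (- sigma) (fun y => omap (fun a => a * (0 +i* y) ^+ nu) (f (0 +i* y))).
Proof.
apply: expansion_affine => y y1; have y0 : 0 < y by apply: lt_trans y1.
have z0 := iy_neq0 y0.
exists 0, ((0 +i* y) ^+ nu); split.
- by rewrite expf_neq0.
- by case: (f _) => //= a; rewrite addr0.
- rewrite addr0 !pevalN mulNr; congr (- _).
  rewrite pevalM pevalX !peval_poly.
  have -> : L.+1 = (v + K.+1)%N by rewrite /K; lia.
  rewrite big_split_ord /= [X in _ * (X + _)]big1 ?add0r; last first.
    by move=> i _; rewrite s_low ?mul0r.
  rewrite -mulrA mulr_suml mulr_sumr; apply: eq_bigr => i _.
  have h : (0 +i* y) ^+ nu * (inv_iy y * inv_iy y ^+ v) = 1.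
    by rewrite -exprS -exprMn /inv_iy mulfV // expr1n.
  by rewrite -[LHS]mulr1 -h /c exprD; ring.
rewrite cmX cm_iy ?(ltW y0) // /inv_pow.
have -> : L.+1 = (nu + K)%N by rewrite /K /nu; lia.
by rewrite exprD invfM mulrA mulfV ?mul1r // expf_neq0 // gt_eqF.
Qed.

Lemma moment_expansion_ninv f : moment_expansion s L f <->
  has_expansion (inv_pow K) mu (fun y => omap (fun a => a / (0 +i* y) ^+ nu) (ninv f (0 +i* y))).
Proof.
have [r E] := poly_recip (recipP c0 (K := K)).
have E2 : (- sigma) * (- mu) = 1 + 'X^(K.+1) * r by rewrite mulrNN.
rewrite moment_expansion_lead (expansion_invP _ E2) opprK.
have H y : 1 < y -> mobius (mx2 0 (-1) 1 0) (omap (fun a => a * (0 +i* y) ^+ nu) (f (0 +i* y))) =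
    omap (fun a => a / (0 +i* y) ^+ nu) (ninv f (0 +i* y)).
  move=> y1; have z0 : (0 +i* y : C) ^+ nu != 0 by rewrite expf_neq0 // iy_neq0 // (lt_trans ltr01).
  rewrite /ninv !ninvE; case: (f _) => [a|] /=; last by rewrite mul0r.
  by rewrite mulf_eq0 (negbTE z0) orbF; case: eqP => //= _; rewrite invfM mulNr.
by split; apply: expansion_ext => y /H.
Qed.

Lemma zm_peval y : 0 < y ->
  \sum_(i < nu) (dd i)%:C * inv_iy y ^+ i * (0 +i* y) ^+ nu = peval ('X * m) (0 +i* y).
Proof.
move=> y0; have z0 := iy_neq0 y0.
rewrite pevalM pevalX (_ : m = \poly_(i < nu) m`_i); last first.
  apply/polyP => i; rewrite coef_poly; case: ltnP => // h.
  by rewrite nth_default // (leq_trans (step_m_size v s)).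
rewrite peval_poly [in RHS](reindex_inj rev_ord_inj) /= mulr_sumr.
apply: eq_bigr => i _; have iv : (i <= v)%N by rewrite -ltnS.
rewrite subSS (step_m_coef s_low s_lead hL iv) mulrCA -exprS -mulrA.
congr (_ * _); have -> : (0 +i* y) ^+ nu = (0 +i* y) ^+ (i + (v - i).+1) by rewrite addnS subnKC.
by rewrite exprD mulrA -exprMn [inv_iy y * _]mulVf // expr1n mul1r.
Qed.

(** The terms of [z^nu] times the reciprocal expansion that involve
    nonnegative powers of [z] are exactly [z m(z)]; they drop out when [- 1 / f] is
    replaced by [- 1 / tau]. *)
Lemma moment_expansion_T_M tau w P' : 
  (forall y, 1 < y -> inv_pow K y = inv_pow nu y * w y) ->
  (forall y, 1 < y -> \sum_(i < K.+1 | (nu <= i)%N) (dd i)%:C * (inv_iy y) ^+ (i - nu) = peval P' (inv_iy y)) ->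
  moment_expansion s L (T_M m tau) <-> has_expansion w P' (fun y => ninv tau (0 +i* y)).
Proof.
move=> hw hP; rewrite moment_expansion_ninv; apply: iff_sym; apply: expansion_affine => y y1.
have y0 : 0 < y by apply: lt_trans y1.
have z0 := iy_neq0 y0; have zn0 : (0 +i* y : C) ^+ nu != 0 by rewrite expf_neq0.
exists (peval ('X * m) (0 +i* y)), (((0 +i* y) ^+ nu)^-1); split.
- by rewrite invr_neq0.
- by rewrite ninv_T_M /padd paddE; case: (ninv tau _).
- rewrite -hP // peval_poly; apply/(mulIf zn0); rewrite mulfVK //.
  rewrite (bigID (fun i : 'I_K.+1 => (nu <= i)%N)) /= mulrDl; congr (_ + _).
    rewrite mulr_suml; apply: eq_bigr => i ni.
    have -> : inv_iy y ^+ i = inv_iy y ^+ (i - nu) * inv_iy y ^+ nu by rewrite -exprD subnK.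
    by rewrite -!mulrA -exprMn [inv_iy y * _]mulVf // expr1n mulr1.
  rewrite -zm_peval // mulr_suml.
  rewrite [RHS](big_ord_widen K.+1 (fun i => (dd i)%:C * inv_iy y ^+ i * (0 +i* y) ^+ nu)); last by rewrite /nu /K; lia.
  by apply: eq_bigl => i; rewrite -ltnNge.
by rewrite hw // cmV cmX cm_iy ?(ltW y0).
Qed.

(** All coefficients that the data determine are used up by [m], and the error
    term [o(z)] is what remains. *)
Lemma moment_expansion_last tau : L = v.*2 -> moment_expansion s L (T_M m tau) <-> small (ninv tau).
Proof.
move=> LE; have KE : K = v by rewrite /K LE; lia.
rewrite small_expansion; apply: moment_expansion_T_M => y y1.
  have y0 : y != 0 by rewrite gt_eqF // (lt_trans ltr01).
  by rewrite /inv_pow KE /nu exprS invfM mulrAC mulVf // mul1r.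
rewrite -polyC0 pevalC big1 // => i ni; exfalso; move: ni; apply/negP.
by rewrite -ltnNge; apply: leq_trans (ltn_ord i) _; rewrite KE.
Qed.

Section Inner.
Hypothesis hL2 : (nu.*2 <= L)%N.
Let fr := step_frak nu L s.
Let K' := (L - nu.*2).+1.
Let ee := recip K' fr.
Let s' := step_seq nu L s.
Let l := step_l nu s.
Hypothesis fr0 : fr 0%N != 0.
Let phi := \poly_(i < K'.+1) fr i.
Let lambda := \poly_(i < K'.+1) ee i.

Lemma moment_expansion_inner_M tau : moment_expansion s L (T_M m tau) <-> has_expansion (inv_pow K') (- phi) (fun y => ninv tau (0 +i* y)).
Proof.
apply: moment_expansion_T_M => y y1.
  by rewrite /inv_pow -invfM -exprD; congr (_ ^+ _)^-1; rewrite /K /K' /nu; lia.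
rewrite pevalN peval_poly -sumrN.
have KE : K.+1 = (nu + K'.+1)%N by rewrite /K /K' /nu; lia.
rewrite KE big_split_ord /= big_pred0 ?add0r; last by move=> i; rewrite leqNgt ltn_ord.
apply: eq_big => i; first by rewrite leq_addr.
by move=> _; rewrite addKn /fr step_frakE rmorphN mulNr opprK.
Qed.

(** Two inversions: from [f] to [- 1 / tau] by [moment_expansion_inner_M], and
    from there to [tau], whose constant term is [l]. *)
Lemma moment_expansion_inner f : moment_expansion s L (T_M m (T_L l f)) <-> moment_expansion s' (L - nu.*2) f.
Proof.
have [r E] := poly_recip (recipP fr0 (K := K')).
have E2 : lambda * phi = 1 + 'X^(K'.+1) * r by rewrite mulrC.
rewrite moment_expansion_inner_M -(expansion_invP (fun y => T_L l f (0 +i* y)) E2); apply: iff_sym.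
apply: expansion_affine => y y1; exists l%:C, 1; split.
- exact: oner_neq0.
- by rewrite T_L_padd /padd paddE pevalC; case: (f _) => //= a; rewrite mulr1.
- rewrite pevalN pevalM pevalX !peval_poly -/K' big_ord_recl /= expr0 mulr1 mulr1 /l (step_lE s_low s_lead hL hL2 fr0) addrC; congr (_ + _).
  rewrite mulr_sumr -sumrN; apply: eq_bigr => i _.
  by rewrite /s' step_seqE /bump /= add1n rmorphN mulNr mulrN opprK exprS mulrCA.
by rewrite cm1 mul1r.
Qed.

Lemma small_inner f : moment_expansion s' (L - nu.*2) f -> small (ninv (T_L l f)).
Proof. by move/moment_expansion_inner/moment_expansion_inner_M; exact: expansion_small. Qed.

End Inner.
End StepAsymptotics.

(** * Continued fractions *)

Section Fractions.
Variable R : realType.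
Local Notation C := (R[i]).
Local Notation sphere := (option C).
Implicit Types (z : C) (t : sphere) (m : nat -> {poly R}) (l : nat -> R).

Lemma mobius_M m j z t :
  mobius (M_mx m j z) t = sph_inv (sph_shift (- (z * peval (m j) z)) (sph_inv t)).
Proof.
rewrite /M_mx; set p := z * _; case: t => [a|]; last first.
  by rewrite /= /sph_shift /= addr0 !mxE.
rewrite /= !mxE /= mul1r addr0 /sph_div; have [->|a0] := eqVneq a 0.
  by rewrite mulr0 add0r oner_eq0 mul0r.
rewrite /= -[- p * a + 1](_ : a * (- p + 1 / a) = _); last by field.
rewrite mulf_eq0 (negbTE a0) /= /sph_div; case: eqP => // /eqP b0.
by congr Some; rewrite invfM mulrA mulfV // mul1r.
Qed.

Lemma mobius_L l j t : mobius (L_mx l j) t = sph_shift (l j)%:C t.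
Proof.
case: t => [a|]; rewrite /= !mxE /= /sph_div ?eqxx //.
by rewrite mul0r add0r oner_eq0 mul1r divr1 addrC.
Qed.

Lemma mdetM (A B : 'M[C]_2) : mdet (A *m B) = mdet A * mdet B.
Proof.
have E : lift ord0 (ord0 : 'I_1) = ord_max by exact/val_inj.
by rewrite /mdet !mxE !big_ord_recl !big_ord0 !E; ring.
Qed.

Lemma mdet_M m j z : mdet (M_mx m j z) = 1.
Proof. by rewrite mdet_mx2; ring. Qed.
Lemma mdet_L l j : mdet (L_mx l j) = 1.
Proof. by rewrite mdet_mx2; ring. Qed.
Lemma mobius1 t : mobius (1 : 'M[C]_2) t = t.
Proof.
case: t => [a|]; rewrite /= !mxE /= /sph_div ?eqxx //.
by rewrite mul0r add0r oner_eq0 mul1r addr0 divr1.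
Qed.

Lemma mobius_ML m l j z (W : 'M[C]_2) t : mdet W != 0 ->
  mobius (M_mx m j z * L_mx l j * W) t = mobius (M_mx m j z) (mobius (L_mx l j) (mobius W t)).
Proof. by move=> W0; rewrite !(mobiusM, mulmxE) //= mdet_L oner_eq0. Qed.

(** Each level of the fraction is the composition of the maps of [M] and [L];
    the determinant is carried along because composition of Moebius maps asks
    for it. *)
Lemma cfracE m l z t d j : let W := (\prod_(j <= i < j + d) (M_mx m i z * L_mx l i)) * M_mx m (j + d) z in
  mdet W = 1 /\ cfrac m l z t j d = mobius W t.
Proof.
elim: d j => [|d IH] j /=.
  by rewrite addn0 big_geq // mul1r mdet_M mobius_M.
have [dW E] := IH j.+1.
rewrite big_ltn; last by rewrite addnS ltnS leq_addr.
rewrite -addSnnS -mulrA; split; first by rewrite mdetM dW mulr1 mdetM mdet_M mdet_L mulr1.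
by rewrite E mobius_ML ?dW ?oner_eq0 // mobius_M mobius_L.
Qed.

End Fractions.

(** * Functions with prescribed indices *)

Section Existence.
Variable R : realType.
Local Notation C := (R[i]).
Local Notation sphere := (option C).
Implicit Types (tau : C -> sphere) (y : R).

Lemma nu_minus1 (S : 'M[R]_1) : nu_minus S = (S 0 0 < 0)%R.
Proof.
apply: nu_minusP; first by apply/matrixP => i j; rewrite !mxE !ord1.
exists 1%:M, (fun=> S 0 0); split; first exact: unitmx1.
  by move=> xi; rewrite !big_ord1 mulmx1 mxE normCK mulrA.
case: (S 0 0 < 0).
  by rewrite (_ : [set _ | _]%SET = [set: 'I_1]%SET) ?cardsT ?card_ord //; apply/setP => i; rewrite !inE.
by apply/eqP; rewrite cards_eq0; apply/eqP/setP => i; rewrite !inE.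
Qed.

Lemma poly_index_linear (P : {poly R}) : (size P <= 2)%N -> poly_index P = (P`_1 < 0)%R.
Proof. by move=> h; rewrite (poly_index_size h) nu_minus1 mxE. Qed.

Definition parameter_with_indices a b := exists2 tau : C -> sphere,
  nevanlinna2 (Posz a) (Posz b) tau & small (ninv tau).

(** One step with constant [m = c] adds the index of [c z] to the first number
    and that of [l z] to the second, so the signs of [c] and [l] decide. Since
    [- 1 / tau + c z] grows linearly, the intermediate function vanishes at
    infinity, and adding [l] makes it bounded away from 0. *)
Lemma parameter_step a b (c l : R) : c != 0 -> l != 0 -> parameter_with_indices a b ->
  parameter_with_indices (a + (c < 0)%R) (b + (l < 0)%R).
Proof.
move=> c0 l0 [tau nt st].
have cp : 0 < `|c| by rewrite normr_gt0.
have lp : 0 < `|l| by rewrite normr_gt0.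
have vt : vanish (T_M c%:P tau).
  move=> e e0; have cc : 0 < `|c| / 2 by rewrite divr_gt0 ?normr_gt0.
  apply: for_large_mono (for_large_and (for_large_gt (2 / (`|c| * e))) (st _ cc)) => y y1 [yA [v hv lv]].
  have y0 : 0 < y by apply: lt_trans y1.
  have := ninv_T_M c%:P tau (0 +i* y); rewrite /padd paddE hv /= pevalM pevalX pevalC.
  set w := v + _ => hw.
  have lw : `|c| / 2 * y <= cm w.
    have := cmBr ((0 +i* y) * c%:C) (- v); rewrite cmM cm_iy ?(ltW y0) // cmR cmN opprK addrC.
    rewrite [(0 +i* y) * _ + v]addrC -/w => h; move: lv h; rewrite [y * _]mulrC; lra.
  have w0 : w != 0 by rewrite -cm_gt0; apply: lt_le_trans lw; rewrite mulr_gt0.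
  exists (- w^-1); first by rewrite -(ninvK (T_M c%:P tau)) (_ : ninv (ninv (T_M c%:P tau)) _ = mobius (mx2 0 (-1) 1 0) (ninv (T_M c%:P tau) (0 +i* y))) // hw ninvE (negbTE w0).
  rewrite cmN cmV; apply: le_trans (_ : (`|c| / 2 * y)^-1 <= _).
    by rewrite lef_pV2 ?posrE ?(mulr_gt0 cc y0) ?cm_gt0.
  rewrite invf_ple ?posrE ?mulr_gt0 //.
  move: yA; rewrite ltr_pdivrMr ?mulr_gt0 ?normr_gt0 // => yA.
  rewrite -[e^-1]mul1r ler_pdivrMr //; nra.
have i1 : poly_index ('X * c%:P) = (c < 0)%R.
  rewrite poly_index_linear; first by rewrite mulrC coefMX coefC.
  by rewrite mulrC -alg_polyC -scalerAl mul1r; apply: leq_trans (size_scale_leq _ _) _; rewrite size_polyX.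
have i2 : poly_index (l *: 'X) = (l < 0)%R.
  rewrite poly_index_linear; first by rewrite coefZ coefX mulr1.
  by apply: leq_trans (size_scale_leq _ _) _; rewrite size_polyX.
exists (T_L l (T_M c%:P tau)).
  apply/(nevanlinna2_T_L _ _ _ vt); exists b; first by rewrite i2.
  apply/(nevanlinna2_T_M _ _ _ st); exists a, b; split=> //; first by rewrite i1.
  by rewrite poly_indexC addn0.
have ll : 0 < `|l| / 2 by rewrite divr_gt0 ?normr_gt0.
move=> e e0; apply: for_large_mono (for_large_and (for_large_gt (2 / (`|l| * e))) (vt _ ll)) => y y1 [yA [v hv lv]].
have y0 : 0 < y by apply: lt_trans y1.
have lw : `|l| / 2 <= cm (v + l%:C).
  have := cmBr l%:C (- v); rewrite cmR cmN opprK addrC [l%:C + v]addrC => h; lra.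
have w0 : v + l%:C != 0 by rewrite -cm_gt0; apply: lt_le_trans lw.
exists (- (v + l%:C)^-1).
  by rewrite /ninv ninvE T_L_padd /padd paddE hv /= pevalC (negbTE w0).
rewrite cmN cmV; apply: le_trans (_ : (`|l| / 2)^-1 <= _).
  by rewrite lef_pV2 ?posrE ?cm_gt0.
move: yA; rewrite ltr_pdivrMr ?mulr_gt0 ?normr_gt0 // => yA.
rewrite -[_^-1]mul1r ler_pdivrMr //; lra.
Qed.

Lemma parameter_exists a b : parameter_with_indices a b.
Proof.
have base : parameter_with_indices 0 0.
  exists (fun=> None); first by right.
  move=> e e0; exists 0 => y y0; exists 0; first by rewrite /ninv ninvE.
  by rewrite cm0 mulr_ge0 // ltW.
have n1 : (-1 : R) < 0 by rewrite oppr_lt0.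
have n10 : (-1 : R) != 0 by rewrite oppr_eq0 oner_eq0.
have H : parameter_with_indices a 0.
  elim: a => // a IH; have := parameter_step n10 (oner_neq0 R) IH.
  by rewrite n1 ltr10 addn1 addn0.
elim: b => // b IH; have := parameter_step (oner_neq0 R) n10 IH.
by rewrite n1 ltr10 addn1 addn0.
Qed.

End Existence.

(** * Iterating the Schur step *)

Section Chain.
Variable R : realType.
Local Notation C := (R[i]).
Local Notation sphere := (option C).
Implicit Types (f g tau : C -> sphere).

Lemma moment_expansion_ext s L f g : eq_off_real f g -> moment_expansion s L f -> moment_expansion s L g.
Proof.
by move=> E; apply: expansion_ext => y y1; apply: E; apply: iy_nonreal; exact: lt_trans y1.
Qed.

(** The inverse transformations recover the next function from the given
    one. *)
Definition T_M_inv (m : {poly R}) g : C -> sphere := fun z => mobius (mx2 1 0 (z * peval m z) 1) (g z).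
Definition T_L_inv (l : R) g : C -> sphere := fun z => mobius (mx2 1 (- l%:C) 0 1) (g z).

Lemma T_MK m g z : T_M m (T_M_inv m g) z = g z.
Proof.
rewrite /T_M /T_M_inv -mobiusM ?mdet_lower // mx2M -[RHS]mobius1.
congr (mobius _ _); apply/matrixP => i j; rewrite !mxE.
by case: i => [[|[|]]] // ?; case: j => [[|[|]]] // ? /=; ring.
Qed.

Lemma T_LK l g z : T_L l (T_L_inv l g) z = g z.
Proof.
rewrite /T_L /T_L_inv -mobiusM; last by rewrite mdet_mx2 mulr1 mulr0 subr0 oner_eq0.
rewrite mx2M -[RHS]mobius1.
congr (mobius _ _); apply/matrixP => i j; rewrite !mxE.
by case: i => [[|[|]]] // ?; case: j => [[|[|]]] // ? /=; ring.
Qed.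

Section OneStep.
Variables (v L : nat) (s : nat -> R).
Let nu := v.+1.
Hypotheses (s_low : forall i, (i < v)%N -> s i = 0) (s_lead : s v != 0).
Let m := step_m nu s.

Lemma last_step A B g : L = v.*2 ->
  nevanlinna2 (Posz A) (Posz B) g /\ moment_expansion s L g <->
  exists tau a b, [/\ A = (a + poly_index ('X * m))%N, B = (b + poly_index m)%N,
    nevanlinna2 (Posz a) (Posz b) tau, small (ninv tau) & eq_off_real g (T_M m tau)].
Proof.
move=> LE; have hL : (v.*2 <= L)%N by rewrite LE.
split.
  case=> ng ag; have E : eq_off_real g (T_M m (T_M_inv m g)) by move=> z _; rewrite T_MK.
  have st := (moment_expansion_last s_low s_lead hL _ LE).1 (moment_expansion_ext E ag).
  have [a [b [-> -> nt]]] := (nevanlinna2_T_M _ _ _ st).1 (nevanlinna2_ext E ng).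
  by exists (T_M_inv m g), a, b.
case=> tau [a [b [AE BE nt st E]]]; have E' := eq_off_real_sym E; split.
  by apply: (nevanlinna2_ext E'); apply/(nevanlinna2_T_M _ _ _ st); exists a, b.
by apply: (moment_expansion_ext E'); apply/(moment_expansion_last s_low s_lead hL _ LE).
Qed.

Hypothesis hL2 : (nu.*2 <= L)%N.
Hypothesis fr0 : step_frak nu L s 0%N != 0.
Let l := step_l nu s.
Let s' := step_seq nu L s.

(** The asymptotic condition at the next level also supplies the growth
    conditions under which the indices add up. *)
Lemma inner_step A B g :
  nevanlinna2 (Posz A) (Posz B) g /\ moment_expansion s L g <->
  exists g' a b, [/\ A = (a + poly_index ('X * m))%N, B = (b + (poly_index m + poly_index (l *: 'X)))%N,
    nevanlinna2 (Posz a) (Posz b) g', moment_expansion s' (L - nu.*2) g' & eq_off_real g (T_M m (T_L l g'))].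
Proof.
have hL : (v.*2 <= L)%N by move: hL2; rewrite /nu; lia.
have H := moment_expansion_inner s_low s_lead hL hL2 fr0.
have S := small_inner s_low s_lead hL hL2 fr0.
split.
  case=> ng ag; pose g' := T_L_inv l (T_M_inv m g).
  have E : eq_off_real g (T_M m (T_L l g')).
    by move=> z _; rewrite /T_M T_LK -/(T_M m (T_M_inv m g) z) T_MK.
  have ag' : moment_expansion s' (L - nu.*2) g' by apply/H; exact: moment_expansion_ext E ag.
  have [a [b [-> -> nt]]] := (nevanlinna2_T_M _ _ _ (S _ ag')).1 (nevanlinna2_ext E ng).
  have [b' -> nt'] := (nevanlinna2_T_L _ _ _ (moment_expansion_vanish ag')).1 nt.
  by exists g', a, b'; split=> //; rewrite -addnA [(poly_index _ + _)%N in RHS]addnC.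
case=> g' [a [b [AE BE ng' ag' E]]]; have E' := eq_off_real_sym E; split.
  apply: (nevanlinna2_ext E'); apply/(nevanlinna2_T_M _ _ _ (S _ ag')).
  exists a, (b + poly_index (l *: 'X))%N; split=> //; first by rewrite -addnA [(poly_index (l *: _) + _)%N]addnC.
  by apply/(nevanlinna2_T_L _ _ _ (moment_expansion_vanish ag')); exists b.
by apply: (moment_expansion_ext E'); apply/H.
Qed.

End OneStep.

Variables (N : nat) (n : nat -> nat) (s : nat -> R).
Hypotheses (hN : (0 < N)%N) (hn : normal_indices s N n) (hreg : regular_seq s N n).
Let ell := (2 * n N - 2)%N.
Let sq := schur_seq s n ell.
Let m := schur_m s n ell.
Let l := schur_l s n ell.
Let lev := level N n.
Let pW j z : 'M[C]_2 := \prod_(1 <= i < j.+1) (M_mx m i z * L_mx l i).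

(** Induction on the level; the product of matrices grows on the right because
    the new factors act directly on the function of the next level. *)
Lemma schur_chain j A B f : (j < N)%N ->
  nevanlinna2 (Posz A) (Posz B) f /\ moment_expansion s ell f <->
  exists g a b, [/\ A = (a + \sum_(1 <= i < j.+1) poly_index ('X * m i))%N,
    B = (b + \sum_(1 <= i < j.+1) (poly_index (m i) + poly_index (l i *: 'X)))%N,
    nevanlinna2 (Posz a) (Posz b) g /\ moment_expansion (sq j) (lev j) g &
    eq_off_real f (fun z => mobius (pW j z) (g z))].
Proof.
elim: j => [|j IH] jN.
  have E g : eq_off_real g (fun z => mobius (pW 0 z) (g z)) by move=> z _; rewrite /pW big_geq // mobius1.
  have l0 : lev 0 = ell by rewrite /lev /level; case: hn => -> _ _; rewrite subn0.
  rewrite /sq /= l0; split.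
    by move=> h; exists f, A, B; rewrite !big_geq // !addn0.
  case=> g [a [b [-> -> [h1 h2] E2]]]; rewrite !big_geq // !addn0.
  have E' : eq_off_real g f by move=> z hz; rewrite E2 // -E.
  by split; [exact: nevanlinna2_ext E' h1|exact: moment_expansion_ext E' h2].
have jN' := ltnW jN; rewrite (IH jN').
have gj := level_invariant_all hN hn hreg jN'.
have nu0 := nu_gt0 hn jN'; have [low lead] := level_lead hN hn jN' gj.
have fr0 := level_frak0 hN hn jN gj; have hi := level_inner hN hn jN.
have levE : lev j.+1 = (lev j - (n j.+1 - n j).*2)%N.
  have : (n j < n j.+1)%N by rewrite -subn_gt0.
  by rewrite /lev /level /ell; lia.
rewrite -[(n j.+1 - n j)%N](prednK nu0) in fr0 hi.
have ST A' B' g := inner_step low lead hi fr0 A' B' g.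
rewrite (prednK nu0) in ST.
have pE z t : mobius (pW j.+1 z) t = mobius (pW j z) (T_M (m j.+1) (T_L (l j.+1) (fun=> t)) z).
  rewrite /pW big_nat_recr //= mobiusM; last by rewrite mdetM mdet_M mdet_L mulr1 oner_eq0.
  by congr mobius; rewrite mobiusM // mdet_L oner_eq0.
split.
  case=> g [a [b [AE BE /ST[g' [a' [b' [aE bE n' as' E']]]] E]]].
  exists g', a', b'; split.
  - by rewrite AE aE (big_nat_recr j.+1) //= -!addnA [(poly_index _ + _)%N in LHS]addnC.
  - by rewrite BE bE (big_nat_recr j.+1) //= -[in LHS]addnA [((poly_index _ + _) + _)%N in LHS]addnC.
  - by split; rewrite ?levE.
  - by move=> z hz; rewrite E // pE E'.
case=> g' [a' [b' [AE BE [n' as'] E]]].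
pose g := T_M (m j.+1) (T_L (l j.+1) g').
exists g, (a' + poly_index ('X * m j.+1))%N, (b' + (poly_index (m j.+1) + poly_index (l j.+1 *: 'X)))%N; split.
- by rewrite AE (big_nat_recr j.+1) //= -!addnA [(poly_index _ + _)%N in RHS]addnC.
- by rewrite BE (big_nat_recr j.+1) //= -[in RHS]addnA [((poly_index _ + _) + _)%N in RHS]addnC.
- by apply/ST; exists g', a', b'; split=> //; rewrite -levE.
- by move=> z hz; rewrite E // pE.
Qed.

Let kN := nu_minus (hankel_plus s (n N).-1).
Let kappaN := nu_minus (hankel s (n N)).

Lemma parametrization A B f :
  nevanlinna2 (Posz A) (Posz B) f /\ moment_expansion s ell f <->
  exists tau a b, [/\ A = (a + kappaN)%N, B = (b + kN)%N, nevanlinna2 (Posz a) (Posz b) tau,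
    small (ninv tau) & eq_off_real f (fun z => mobius (W_mx m l N z) (tau z))].
Proof.
have [j NE] : exists j, N = j.+1 by exists N.-1; rewrite prednK.
have jN : (j < N)%N by rewrite NE.
rewrite (schur_chain _ _ _ jN).
have gj := level_invariant_all hN hn hreg jN.
have nu0 := nu_gt0 hn jN; have [low lead] := level_lead hN hn jN gj.
have LE : lev j = (n j.+1 - n j).-1.*2 by rewrite -NE; exact: (level_last hN hn (esym NE)).
have ST A' B' g := last_step low lead A' B' g LE.
rewrite (prednK nu0) in ST.
have [kE1 kE2] := index_sums hN hn hreg.
have pE z t : mobius (W_mx m l N z) t = mobius (pW j z) (T_M (m N) (fun=> t) z).
  by rewrite /W_mx {1}NE -/(pW j z) mobiusM // mdet_M oner_eq0.
have k1 a : (a + kappaN)%N = ((a + poly_index ('X * m N)) + \sum_(1 <= i < j.+1) poly_index ('X * m i))%N.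
  by rewrite /kappaN kE1 (big_nat_recr N) //= -/m -NE addnA addnAC.
have k2 b : (b + kN)%N = ((b + poly_index (m N)) + \sum_(1 <= i < j.+1) (poly_index (m i) + poly_index (l i *: 'X)))%N.
  by rewrite /kN kE2 (big_nat_recr N) //= -/m -/l -NE big_split /=; lia.
have mN : step_m (n j.+1 - n j) (schur_seq s n ell j) = m N by rewrite {1}NE.
split.
  case=> g [a [b [AE BE /ST[tau [a' [b' [aE bE nt st E']]]] E]]].
  exists tau, a', b'; rewrite k1 k2 AE BE aE bE -mN; split=> //.
  by move=> z hz; rewrite E // pE E' // mN.
case=> tau [a [b [AE BE nt st E]]].
exists (T_M (m N) tau), (a + poly_index ('X * m N))%N, (b + poly_index (m N))%N; split.
- by rewrite AE k1.
- by rewrite BE k2.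
- by apply/ST; exists tau, a, b; rewrite -mN.
- by move=> z hz; rewrite E // pE.
Qed.

End Chain.

(** The classes with a negative index are empty. *)
Lemma nevanlinna2_sub (R : realType) (A B q r : nat) (tau : R[i] -> option R[i]) :
  nevanlinna2 (A%:Z - q%:Z) (B%:Z - r%:Z) tau <->
  exists a b : nat, [/\ A = (a + q)%N, B = (b + r)%N & nevanlinna2 (Posz a) (Posz b) tau].
Proof.
split; last first.
  case=> a [b [-> -> h]].
  by rewrite !PoszD !addrK.
case E1 : (A%:Z - q%:Z) => [a|a]; case E2 : (B%:Z - r%:Z) => [b|b] //= h.
exists a, b; split; [lia|lia|exact: h].
Qed.

Theorem theorem4p2 (R : realType) (N : nat) (n : nat -> nat) (s : nat -> R)
    (kappa k : nat) (hN : (0 < N)%N)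
    (hn : normal_indices s N n) (hreg : regular_seq s N n) :
  let ell := (2 * n N - 2)%N in
  let m := schur_m s n ell in
  let l := schur_l s n ell in
  let kappaN := nu_minus (hankel s (n N)) in
  let kN := nu_minus (hankel_plus s (n N).-1) in
  let admissible (tau : R[i] -> option R[i]) :=
    nevanlinna2 (kappa%:Z - kappaN%:Z) (k%:Z - kN%:Z) tau /\
    inv_littleo_nontangential tau in
  let represented (f tau : R[i] -> option R[i]) :=
    forall z, nonreal z -> f z = mobius (W_mx m l N z) (tau z) in
  let expanded (f tau : R[i] -> option R[i]) :=
    forall z, nonreal z -> f z = cfrac m l z (tau z) 1 N.-1 in
  [/\ (exists f, moment_solution kappa k s ell f) <->
        (kappaN <= kappa)%N /\ (kN <= k)%N,
      forall f, moment_solution kappa k s ell f <->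
        exists2 tau, admissible tau & represented f tau,
      forall f tau, admissible tau -> (represented f tau <-> expanded f tau) &
      kappaN = (\sum_(1 <= j < N.+1) kappa_minus ('X * m j))%N /\
      kN = (\sum_(1 <= j < N.+1) kappa_minus (m j)
            + \sum_(1 <= j < N) kappa_minus ((l j) *: 'X))%N].
Proof.
move=> ell m l kappaN kN admissible represented expanded.
have P f := parametrization hN hn hreg kappa k f.
split.
- split.
    case=> f /moment_solutionE/P[tau [a [b [-> -> _ _ _]]]].
    by rewrite !leq_addl.
  case=> h1 h2; have [tau nt st] := parameter_exists R (kappa - kappaN) (k - kN).
  exists (fun z => mobius (W_mx m l N z) (tau z)); apply/moment_solutionE/P.
  by exists tau, (kappa - kappaN)%N, (k - kN)%N; rewrite !subnK.
- move=> f; split.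
    move=> /moment_solutionE/P[tau [a [b [AE BE nt st E]]]]; exists tau => //.
    split; last exact: nontangential_of_small nt st.
    by apply/nevanlinna2_sub; exists a, b.
  case=> tau [/nevanlinna2_sub[a [b [AE BE nt]]] /small_of_nontangential st] E.
  by apply/moment_solutionE/P; exists tau, a, b.
- move=> f tau _; have E z : mobius (W_mx m l N z) (tau z) = cfrac m l z (tau z) 1 N.-1.
    by rewrite (cfracE _ _ _ _ _ _).2 add1n prednK.
  by split=> h z hz; rewrite h // E.
rewrite /kappaN /kN; have [-> ->] := index_sums hN hn hreg; split.
  by apply: eq_bigr => i _; rewrite kappa_minusE.
by congr (_ + _)%N; apply: eq_bigr => i _; rewrite kappa_minusE.
Qed.
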